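(* Let $\Gamma$ be the subgroup of $\mathrm{PGU}_3(\mathbb{F}_{25})$ generated by (the classes of) the five matrices $$g_2=\begin{bmatrix}1&0&0\\0&\omega&0\\0&0&\omega^{-1}\end{bmatrix},\quad g_3=\begin{bmatrix}1&3&2\\3&1&2\\2&2&1\end{bmatrix},\quad g_4=\begin{bmatrix}0&1&0\\1&0&0\\0&0&4\end{bmatrix},\quad g_5=\begin{bmatrix}1&0&0\\0&0&4\\0&4&0\end{bmatrix},\quad g_6=\begin{bmatrix}0&1&0\\1&0&0\\0&0&1\end{bmatrix},$$ where $\omega:=2+3\alpha$ and $\alpha:=\sqrt{2}\in\mathbb{F}_{25}=\mathbb{F}_5(\alpha)$. Put $\Delta:=\mathrm{PGU}_3(\mathbb{F}_{25})\cap\mathrm{PGO}_3(\mathbb{F}_{25})$. Then $\Gamma$ is isomorphic to $\mathfrak{A}_7$. Moreover, if $\gamma\in\mathrm{PGU}_3(\mathbb{F}_{25})$ satisfies $\Delta\cap\gamma^{-1}\Delta\gamma\cong\mathfrak{A}_4$, then $\Gamma$ is generated by $\Delta$ and $\gamma^{-1}\Delta\gamma$. Let $\mathcal{V}$ denote the set of subgroups of $\mathrm{PGU}_3(\mathbb{F}_{25})$ conjugate to $\Gamma$. Then we have $|\mathcal{V}|=150$, and for distinct elements $\Gamma',\Gamma''\in\mathcal{V}$, the group $\Gamma'\cap\Gamma''$ is isomorphic to one of the following: $$\mathfrak{A}_6,\quad \mathrm{PSL}_2(\mathbb{F}_7),\quad (\mathfrak{A}_4\times 3):2,\quad \mathfrak{A}_5.$$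 For $n=360,168,72,60$, define a subset $\mathcal{E}_n$ of the set of unordered pairs of distinct elements of $\mathcal{V}$ by $$\mathcal{E}_n:=\{\,\{\Gamma',\Gamma''\}\mid |\Gamma'\cap\Gamma''|=n\,\}.$$ Then the graph $(\mathcal{V},\mathcal{E}_{360})$ has exactly three connected components $\mathcal{C}_1,\mathcal{C}_2,\mathcal{C}_3$, and each $\mathcal{C}_i$ is (isomorphic to) the Hoffman-Singleton graph. Moreover, for any $i\neq j$, the graph $(\mathcal{V},\mathcal{E}_{360}\cup\mathcal{E}_{168})|(\mathcal{C}_i\cup\mathcal{C}_j)$ (the induced subgraph on $\mathcal{C}_i\cup\mathcal{C}_j$) is (isomorphic to) the Higman-Sims graph.
   Context: $\mathrm{PGU}_3(\mathbb{F}_{25})$ is the subgroup of $\mathrm{PGL}_3(\mathbb{F}_{25})$ of classes of matrices $M$ such that ${}^tM\overline{M}$ is a scalar matrix, where $\overline{x}=x^5$ entrywise (equivalently, the group of projective automorphisms of the curve $x^6+y^6+z^6=0$); its order is $378000$. $\mathrm{PGO}_3(\mathbb{F}_{25})$ is the subgroup of $\mathrm{PGL}_3(\mathbb{F}_{25})$ of classes of matrices $M$ such that ${}^tMM$ is a scalar matrix (equivalently, $M$ preserves the conic $x^2+y^2+z^2=0$); thus $\Delta$ is the stabilizer in $\mathrm{PGU}_3(\mathbb{F}_{25})$ of the conic $x^2+y^2+z^2=0$. $\mathfrak{A}_m$ is the alternating group of degree $m$. The group $(\mathfrak{A}_4\times 3):2$, of order $72$, is the one isomorphic to the subgroup $\{g\in\mathfrak{A}_7\mid\{g(5),g(6),g(7)\}=\{5,6,7\}\}$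 of $\mathfrak{A}_7$. The Hoffman-Singleton graph is the unique strongly regular graph of parameters $(v,k,\lambda,\mu)=(50,7,0,1)$; the Higman-Sims graph is the unique strongly regular graph of parameters $(v,k,\lambda,\mu)=(100,22,0,6)$. *)

(* Defs.v *)
From HB Require Import structures.
From mathcomp Require Import all_boot all_order all_algebra all_fingroup all_solvable.

Set Implicit Arguments.
Unset Strict Implicit.
Unset Printing Implicit Defensive.

Import GRing.Theory GroupScope.
Local Open Scope ring_scope.

Definition scalGL (n : nat) (F : finFieldType) : {set {'GL_n[F]}} :=
  [set g : {'GL_n[F]} | is_scalar_mx (GLval g)].

Lemma scalGL_group_set (n : nat) (F : finFieldType) : group_set (scalGL n F).
Proof.
apply/group_setP; split=> [|g h]; first by rewrite inE GL_1E scalar_mx_is_scalar.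
rewrite !inE => /is_scalar_mxP[a ga] /is_scalar_mxP[b hb].
by rewrite GL_MxE ga hb -scalar_mxM scalar_mx_is_scalar.
Qed.
Canonical scalGL_group (n : nat) (F : finFieldType) :=
  Group (scalGL_group_set n F).

(* PGL_n(F) is the quotient group 'GL_n[F] / scalGL n F; its subsets, and in
   particular its subgroups, are elements of {set PGLtype n F}. *)
Notation PGLtype n F := (coset_of (scalGL n F)).

Definition SL (n : nat) (F : finFieldType) : {set {'GL_n[F]}} :=
  [set g : {'GL_n[F]} | \det (GLval g) == 1].

Lemma SL_group_set (n : nat) (F : finFieldType) : group_set (SL n F).
Proof.
apply/group_setP; split=> [|g h]; first by rewrite inE GL_1E det1.
by rewrite !inE GL_MxE det_mulmx => /eqP-> /eqP->; rewrite mulr1.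
Qed.
Canonical SL_group (n : nat) (F : finFieldType) := Group (SL_group_set n F).

Definition PSL (n : nat) (F : finFieldType) :=
  (SL n F / (SL n F :&: scalGL n F))%g.

(* The conjugation of F over its subfield with 5 elements, when #|F| = 25. *)
Definition conj5 (F : finFieldType) (x : F) : F := x ^+ 5.

Definition PGU3 (F : finFieldType) : {set PGLtype 3 F} :=
  ([set g : {'GL_3[F]} |
     is_scalar_mx ((GLval g)^T *m map_mx (@conj5 F) (GLval g))]
   / scalGL 3 F)%g.

Definition PGO3 (F : finFieldType) : {set PGLtype 3 F} :=
  ([set g : {'GL_3[F]} | is_scalar_mx ((GLval g)^T *m GLval g)]
   / scalGL 3 F)%g.

Definition Delta (F : finFieldType) : {set PGLtype 3 F} := PGU3 F :&: PGO3 F.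

Definition mx3 (F : finFieldType) (s : seq (seq F)) : 'M[F]_3 :=
  \matrix_(i < 3, j < 3) nth 0 (nth [::] s i) j.

Definition omega (F : finFieldType) (alpha : F) : F := 2 + 3 * alpha.

Definition Gamma_gens (F : finFieldType) (alpha : F) : seq 'M[F]_3 :=
  let w := omega alpha in
  [:: mx3 [:: [:: 1; 0; 0]; [:: 0; w; 0]; [:: 0; 0; w^-1]];
      mx3 [:: [:: 1; 3; 2]; [:: 3; 1; 2]; [:: 2; 2; 1]];
      mx3 [:: [:: 0; 1; 0]; [:: 1; 0; 0]; [:: 0; 0; 4]];
      mx3 [:: [:: 1; 0; 0]; [:: 0; 0; 4]; [:: 0; 4; 0]];
      mx3 [:: [:: 0; 1; 0]; [:: 1; 0; 0]; [:: 0; 0; 1]]].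

(* For #|F| = 25 and alpha ^+ 2 = 2 the five matrices are all invertible, so
   none is lost by ranging over {'GL_3[F]}: their determinants are
   1, 3, 1, -1 and -1. *)
Definition Gamma (F : finFieldType) (alpha : F) : {set PGLtype 3 F} :=
  << [set g : {'GL_3[F]} | GLval g \in Gamma_gens alpha] / scalGL 3 F >>%g.

(* The group (A_4 x 3) : 2; the points 5, 6, 7 of {1, ..., 7} are the
   elements 4, 5, 6 of 'I_7. *)
Definition A4x3_2 : {set {perm 'I_7}} :=
  let D := [set i : 'I_7 | (4 <= i)%N] in
  [set g in 'Alt_('I_7) | g @: D == D]%g.

Definition Gamma_conjs (F : finFieldType) (alpha : F) :
    {set {set PGLtype 3 F}} :=
  (Gamma alpha :^: PGU3 F)%g.

Definition E_ (F : finFieldType) (alpha : F) (n : nat) :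
    rel {set PGLtype 3 F} :=
  fun A B => [&& A \in Gamma_conjs alpha, B \in Gamma_conjs alpha, A != B
               & #|A :&: B| == n].

(* The graph induced by e on the vertex set V is a strongly regular graph of
   parameters (v, k, l, m). *)
Definition srg (T : finType) (V : {set T}) (e : rel T) (v k l m : nat) : Prop :=
  [/\ {in V &, symmetric e} /\ {in V, irreflexive e},
      #|V| = v,
      {in V, forall x, #|[set y in V | e x y]| = k},
      {in V &, forall x y, e x y -> #|[set z in V | e x z && e y z]| = l}
    & {in V &, forall x y, x != y -> ~~ e x y ->
        #|[set z in V | e x z && e y z]| = m}].

(* Each of these two graphs is, by definition, the unique strongly regular
   graph with its parameters. *)
Definition is_Hoffman_Singleton (T : finType) (V : {set T}) (e : rel T) : Prop :=
  srg V e 50 7 0 1.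

Definition is_Higman_Sims (T : finType) (V : {set T}) (e : rel T) : Prop :=
  srg V e 100 22 0 6.

(* Vertex sets of the connected components of the graph (V, e), for an edge
   relation e that holds only between elements of V. *)
Definition components (T : finType) (V : {set T}) (e : rel T) : {set {set T}} :=
  equivalence_partition (connect e) V.

(* Main.v *)
(* The proof is a coset enumeration.  All groups are generated by six explicit
   matrices: g2, ..., g6 generate Gamma, g3, ..., g6 generate Delta, and
   PGU_3(25) needs one more, diag(1, omega, 1).  The last two facts come from
   row reduction: words in the generators move the successive rows of a unitary
   (or real orthogonal) matrix to multiples of basis vectors.

   The six generators permute 150 explicit cosets of Gamma, hence 150 conjugates
   of Gamma.  These are distinct because Gamma permutes the centres of its 105
   reflections, and no representative of a nontrivial coset preserves this set.
   So Gamma is its own normalizer, and a word lies in a conjugate of Gamma if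
   and only if it fixes the corresponding one of the 150 points.

   Gamma acts on these points with orbits of sizes 1, 7, 15, 15, 35, 35, 42.  The
   action on the orbit of size 7 is an isomorphism with A_7: an element that acts
   trivially fixes the 105 centres, which contain a projective frame.  By
   transitivity every intersection is conjugate to one of Gamma with an orbit
   representative: it is the stabilizer of a point, identified through its action
   on 6 points (A_6), the projective line over F_7 (PSL_2(7)), the 3-subsets of
   the 7 points ((A_4 x 3):2) or 5 points (A_5), and its order.  For the same
   reason the graph parameters need only be counted at one vertex.

   If the intersection of Delta with its conjugate by gamma is an A_4, then this
   group and its conjugate by gamma^-1 both lie in Delta, and they are conjugate in
   Delta to the pointwise stabilizer in Gamma of three of the seven points.  The
   normalizer of the latter in PGU_3(25) lies in Gamma and permutes the three
   points, so gamma lies in Delta t Delta for a rotation t of these points, and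
   Delta together with its conjugate by t generates Gamma. *)

Require Import Defs.
From HB Require Import structures.
From mathcomp Require Import all_boot all_order all_algebra all_fingroup all_solvable.
From mathcomp Require Import ring zify.

Import GRing.Theory GroupScope.
Local Open Scope ring_scope.

(** * A computable model of the field with 25 elements *)

(** The field [F] is known only through its order and a square root of 2, so nothing computes in it.
    Every finite check runs in an inductive model of F_25 and is transported along the injective
    ring map [phi]. Likewise groups are never enumerated: an element is a word in the letters,
    evaluated either as a matrix or as a map on 150 indices, and the two readings are tied together
    by the coset table. The tables are certificates; only the boolean checks on them enter the
    argument. The main obstacle to row reduction is that membership in PGU_3 or PGO_3 is a condition
    up to scalars. A class must first be lifted to a matrix that is exactly unitary, or exactly real
    and orthogonal. This works because the norm maps F_25 onto F_5, and because the dimension is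
    odd. Isomorphisms are obtained without presentations: pairs of corresponding generators span a
    subgroup of a direct product, which is shown to be the graph of an isomorphism. Vectors are rows
    and matrices act on the right, as permutations do, so that words are read from left to right
    everywhere. *)

Inductive f5 := F0 | F1 | F2 | F3 | F4.

Definition f5_nat x : nat := match x with F0 => 0 | F1 => 1 | F2 => 2 | F3 => 3 | F4 => 4 end.
Definition nat_f5 n := match n with 0 => F0 | 1 => F1 | 2 => F2 | 3 => F3 | _ => F4 end%N.
Lemma f5_natK : cancel f5_nat nat_f5. Proof. by case. Qed.
HB.instance Definition _ := Equality.copy f5 (can_type f5_natK).

Definition f5_succ x := match x with F0 => F1 | F1 => F2 | F2 => F3 | F3 => F4 | F4 => F0 end.
Definition f5_opp x := match x with F0 => F0 | F1 => F4 | F2 => F3 | F3 => F2 | F4 => F1 end.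
Definition f5_dbl x := match x with F0 => F0 | F1 => F2 | F2 => F4 | F3 => F1 | F4 => F3 end.
Definition f5_inv x := match x with F0 => F0 | F1 => F1 | F2 => F3 | F3 => F2 | F4 => F4 end.
Definition f5_add x y :=
  match x with
  | F0 => y | F1 => f5_succ y | F2 => f5_succ (f5_succ y)
  | F3 => f5_succ (f5_succ (f5_succ y))
  | F4 => f5_succ (f5_succ (f5_succ (f5_succ y)))
  end.
Definition f5_mul x y :=
  match x with
  | F0 => F0 | F1 => y | F2 => f5_dbl y | F3 => f5_opp (f5_dbl y) | F4 => f5_opp y
  end.

(* The pair (a, b) stands for a + b sqrt 2. *)
Definition f25 : Type := f5 * f5.

Definition k0 : f25 := (F0, F0).
Definition k1 : f25 := (F1, F0).
Definition k_add (x y : f25) : f25 :=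
  let (a, b) := x in let (c, d) := y in (f5_add a c, f5_add b d).
Definition k_mul (x y : f25) : f25 :=
  let (a, b) := x in let (c, d) := y in
  (f5_add (f5_mul a c) (f5_dbl (f5_mul b d)), f5_add (f5_mul a d) (f5_mul b c)).
Definition k_opp (x : f25) : f25 := let (a, b) := x in (f5_opp a, f5_opp b).
Definition k_conj (x : f25) : f25 := let (a, b) := x in (a, f5_opp b).
Definition k_inv (x : f25) : f25 :=
  let (n, _) := k_mul x (k_conj x) in k_mul (f5_inv n, F0) (k_conj x).
Definition k_norm (x : f25) : f25 := k_mul x (k_conj x).
Definition k_of (n : nat) : f25 := (nat_f5 (n %% 5), nat_f5 (n %/ 5)).

Definition all_k : seq f25 := [seq k_of n | n <- iota 0 25].

(** Turns a universal statement over the model into one boolean evaluation. *)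
Lemma all_kP (p : pred f25) : all p all_k -> forall x, p x.
Proof. by move=> /allP h [a b]; apply: h; case: a; case: b; vm_compute. Qed.

Lemma k_mulV x : x != k0 -> k_mul x (k_inv x) = k1.
Proof.
move=> x0; apply/eqP; apply: implyP x0.
by apply: (@all_kP (fun x => (x != k0) ==> (k_mul x (k_inv x) == k1))); vm_compute.
Qed.

Lemma k_subr0 x y : k_add x (k_opp y) = k0 -> x = y.
Proof.
move: x y => [a b] [c d] [] h1 h2.
by case: a c h1 => [] [] //= _; case: b d h2 => [] [].
Qed.

(** * Vectors and matrices over the model *)

Definition vec3 : Type := f25 * f25 * f25.
Definition mat3 : Type := vec3 * vec3 * vec3.

Definition v_add (u v : vec3) : vec3 :=
  let: (a, b, c) := u in let: (d, e, f) := v in (k_add a d, k_add b e, k_add c f).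
Definition v_scale (k : f25) (v : vec3) : vec3 :=
  let: (a, b, c) := v in (k_mul k a, k_mul k b, k_mul k c).
Definition v_mul (v : vec3) (m : mat3) : vec3 :=
  let: (a, b, c) := v in let: (r1, r2, r3) := m in
  v_add (v_scale a r1) (v_add (v_scale b r2) (v_scale c r3)).
Definition m_mul (m n : mat3) : mat3 :=
  let: (r1, r2, r3) := m in (v_mul r1 n, v_mul r2 n, v_mul r3 n).
Definition m_scale (k : f25) (m : mat3) : mat3 :=
  let: (r1, r2, r3) := m in (v_scale k r1, v_scale k r2, v_scale k r3).
Definition m_one : mat3 := ((k1, k0, k0), (k0, k1, k0), (k0, k0, k1)).

(** The default [k1] for the zero vector makes the lead invertible in all cases, so that equal
    normal forms always imply proportionality. *)
Definition v_lead (v : vec3) : f25 :=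
  let: (a, b, c) := v in if a != k0 then a else if b != k0 then b else
  if c != k0 then c else k1.
Definition v_normal (v : vec3) : vec3 := v_scale (k_inv (v_lead v)) v.
(** Normalizing by the first row is enough, since the first row of an invertible matrix is
    nonzero. *)
Definition m_normal (m : mat3) : mat3 := m_scale (k_inv (v_lead m.1.1)) m.

Definition k_sub x y := k_add x (k_opp y).
(** Serves to certify that two points of the plane differ: the cross product of proportional vectors
    vanishes. *)
Definition v_cross (u v : vec3) : vec3 :=
  let: (a, b, c) := u in let: (d, e, f) := v in
  (k_sub (k_mul b f) (k_mul c e), k_sub (k_mul c d) (k_mul a f),
   k_sub (k_mul a e) (k_mul b d)).

(** * Embedding of the model into the given field *)

Section Embedding.

Variables (F : finFieldType) (alpha : F).
Hypotheses (F25 : #|F| = 25%N) (alpha2 : alpha ^+ 2 = 2).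

(** The additive group has order 25, which gives 5 * 5 = 0, and a field has no zero divisors. *)
Lemma five_eq0 : 5 = 0 :> F.
Proof.
have: (1 : F) *+ 25 = 0.
  by have := expg_cardG (in_setT (1 : F)); rewrite cardsT F25 FinRing.zmodXgE.
by rewrite -[25%N]/(5 * 5)%N natrM => /eqP; rewrite mulf_eq0 orbb => /eqP.
Qed.

Definition phi5 (x : f5) : F := (f5_nat x)%:R.

Lemma natr_mod5 (n : nat) : (n %% 5)%:R = n%:R :> F.
Proof. by rewrite {2}(divn_eq n 5) natrD natrM five_eq0 mulr0 add0r. Qed.

Lemma phi5D x y : phi5 (f5_add x y) = phi5 x + phi5 y.
Proof. by rewrite -natrD -[RHS]natr_mod5; congr _%:R; case: x; case: y. Qed.

Lemma phi5M x y : phi5 (f5_mul x y) = phi5 x * phi5 y.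
Proof. by rewrite -natrM -[RHS]natr_mod5; congr _%:R; case: x; case: y. Qed.

Lemma phi5_dbl x : phi5 (f5_dbl x) = 2 * phi5 x.
Proof. by rewrite -natrM -[RHS]natr_mod5; congr _%:R; case: x. Qed.

Lemma phi5N x : phi5 (f5_opp x) = - phi5 x.
Proof.
by apply/eqP; rewrite -addr_eq0 -natrD -natr_mod5; case: x.
Qed.

Definition phi (x : f25) : F := phi5 x.1 + phi5 x.2 * alpha.

Lemma phiD x y : phi (k_add x y) = phi x + phi y.
Proof. by case: x y => a b [c d]; rewrite /phi /= !phi5D mulrDl addrACA. Qed.

Lemma phiN x : phi (k_opp x) = - phi x.
Proof. by case: x => a b; rewrite /phi /= !phi5N mulNr opprD. Qed.

Lemma phiM x y : phi (k_mul x y) = phi x * phi y.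
Proof.
case: x y => a b [c d]; rewrite /phi /= !phi5D phi5_dbl !phi5M.
ring: alpha2.
Qed.

Lemma phi0 : phi k0 = 0. Proof. by rewrite /phi mul0r addr0. Qed.
Lemma phi1 : phi k1 = 1. Proof. by rewrite /phi mul0r addr0. Qed.

Lemma phi_neq0 x : x != k0 -> phi x != 0.
Proof.
move=> /k_mulV h; apply/eqP=> px0; have /eqP := phi1.
by rewrite -h phiM px0 mul0r eq_sym oner_eq0.
Qed.

Lemma phi_eq0 x : (phi x == 0) = (x == k0).
Proof.
by apply/idP/eqP => [|->]; [apply: contraTeq => /phi_neq0|rewrite phi0].
Qed.

Lemma phi_inj : injective phi.
Proof.
move=> x y xy; apply: k_subr0; apply/eqP.
by rewrite -phi_eq0 phiD phiN xy subrr.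
Qed.

Lemma phiV x : phi (k_inv x) = (phi x)^-1.
Proof.
have [->|x0] := eqVneq x k0; first by rewrite (_ : k_inv k0 = k0) ?phi0 ?invr0.
by apply: (mulfI (phi_neq0 x x0)); rewrite -phiM k_mulV // divff ?phi_neq0 ?phi1.
Qed.

Lemma phi_surj (z : F) : exists x, z = phi x.
Proof.
have u : uniq [seq phi x | x <- all_k] by rewrite (map_inj_uniq phi_inj).
have: z \in [seq phi x | x <- all_k].
  have [||_ ->] := uniq_min_size u (s2 := enum F); last by rewrite mem_enum.
  - by move=> y _; rewrite mem_enum.
  - by rewrite -cardE F25.
by case/mapP => x _ ->; exists x.
Qed.

(** The fifth power fixes F_5 and negates [alpha], because [alpha ^+ 4] is 4 = -1. *)
Lemma phi_conj x : conj5 (phi x) = phi (k_conj x).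
Proof.
rewrite /conj5 !exprS expr0 mulr1 -!phiM; congr phi; apply/eqP.
by move: x; apply: all_kP; vm_compute.
Qed.

Definition rowF (v : vec3) : 'rV[F]_3 :=
  let: (a, b, c) := v in \row_j nth 0 [:: phi a; phi b; phi c] j.

Definition mxF (m : mat3) : 'M[F]_3 :=
  let: (r1, r2, r3) := m in
  \matrix_(i, j) rowF (nth r1 [:: r1; r2; r3] i) 0 j.

Lemma ord3P (P : 'I_3 -> Prop) :
  P 0 -> P 1 -> P 2%:R -> forall i, P i.
Proof.
move=> h0 h1 h2 [[|[|[|//]]] hi].
- by rewrite (_ : Ordinal hi = 0) //; apply: val_inj.
- by rewrite (_ : Ordinal hi = 1) //; apply: val_inj.
- by rewrite (_ : Ordinal hi = 2%:R) //; apply: val_inj.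
Qed.

Lemma rowFD u v : rowF (v_add u v) = rowF u + rowF v.
Proof.
case: u v => [[a b] c] [[d e] f].
by apply/rowP; apply: ord3P; rewrite !mxE /= phiD.
Qed.

Lemma rowFZ k v : rowF (v_scale k v) = phi k *: rowF v.
Proof.
case: v => [[a b] c].
by apply/rowP; apply: ord3P; rewrite !mxE /= phiM.
Qed.

Lemma rowF_inj : injective rowF.
Proof.
move=> [[a b] c] [[d e] f] /rowP h.
have := h 0; have := h 1; have := h 2%:R; rewrite !mxE /=.
by do 3!move=> /phi_inj->.
Qed.

Lemma rowF_surj (u : 'rV[F]_3) : exists v, u = rowF v.
Proof.
have [[a ha] [b hb] [c hc]] := And3 (phi_surj (u 0 0)) (phi_surj (u 0 1)) (phi_surj (u 0 2%:R)).
by exists (a, b, c); apply/rowP; apply: ord3P; rewrite !mxE.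
Qed.

Lemma rowF_mul v m : rowF v *m mxF m = rowF (v_mul v m).
Proof.
case: v m => [[a b] c] [[r1 r2] r3].
rewrite /v_mul !rowFD !rowFZ; apply/rowP => j.
by rewrite !mxE !big_ord_recl big_ord0 !mxE /= addr0.
Qed.

Lemma row_mxF m : [/\ row 0 (mxF m) = rowF m.1.1, row 1 (mxF m) = rowF m.1.2
                    & row 2%:R (mxF m) = rowF m.2].
Proof.
by case: m => [[r1 r2] r3]; split; apply/rowP => j; rewrite !mxE.
Qed.

Lemma mx3_rowP (A B : 'M[F]_3) : row 0 A = row 0 B -> row 1 A = row 1 B ->
  row 2%:R A = row 2%:R B -> A = B.
Proof. by move=> h0 h1 h2; apply/row_matrixP; apply: ord3P. Qed.

Lemma mxFM m n : mxF (m_mul m n) = mxF m *m mxF n.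
Proof.
have [h0 h1 h2] := row_mxF (m_mul m n); have [g0 g1 g2] := row_mxF m.
case: m h0 h1 h2 g0 g1 g2 => [[r1 r2] r3] h0 h1 h2 g0 g1 g2.
apply: mx3_rowP; rewrite row_mul.
- by rewrite h0 g0 rowF_mul.
- by rewrite h1 g1 rowF_mul.
- by rewrite h2 g2 rowF_mul.
Qed.

Lemma mxFZ k m : mxF (m_scale k m) = phi k *: mxF m.
Proof.
have [h0 h1 h2] := row_mxF (m_scale k m); have [g0 g1 g2] := row_mxF m.
case: m h0 h1 h2 g0 g1 g2 => [[r1 r2] r3] h0 h1 h2 g0 g1 g2.
apply: mx3_rowP; rewrite linearZ /=.
- by rewrite h0 g0 rowFZ.
- by rewrite h1 g1 rowFZ.
- by rewrite h2 g2 rowFZ.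
Qed.

Lemma mxF1 : mxF m_one = 1%:M.
Proof.
by apply/matrixP; apply: ord3P; apply: ord3P; rewrite !mxE /= ?phi0 ?phi1.
Qed.

Lemma mxF_surj (A : 'M[F]_3) : exists m, A = mxF m.
Proof.
have [[a ha] [b hb] [c hc]] := And3 (rowF_surj (row 0 A)) (rowF_surj (row 1 A)) (rowF_surj (row 2%:R A)).
exists (a, b, c); have [h0 h1 h2] := row_mxF (a, b, c).
by apply: mx3_rowP; rewrite ?h0 ?h1 ?h2.
Qed.

Lemma v_lead_neq0 v : v_lead v != k0.
Proof. by case: v => [[a b] c] /=; do 3!case: ifP => //. Qed.

Lemma v_normalP v : exists2 k, k != 0 & rowF (v_normal v) = k *: rowF v.
Proof.
exists (phi (k_inv (v_lead v))); last by rewrite -rowFZ.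
by rewrite phiV invr_eq0 phi_neq0 ?v_lead_neq0.
Qed.

Lemma m_normalP m : exists2 k, k != 0 & mxF (m_normal m) = k *: mxF m.
Proof.
exists (phi (k_inv (v_lead m.1.1))); last by rewrite -mxFZ.
by rewrite phiV invr_eq0 phi_neq0 ?v_lead_neq0.
Qed.

Lemma v_normal_eq u v : v_normal u = v_normal v ->
  exists2 k, k != 0 & rowF u = k *: rowF v.
Proof.
have [[a a0 ha] [b b0 hb]] := (v_normalP u, v_normalP v) => /(congr1 rowF).
rewrite ha hb => h; exists (a^-1 * b); first by rewrite mulf_neq0 ?invr_eq0.
by rewrite -scalerA -h scalerA mulVf // scale1r.
Qed.

Lemma m_normal_eq m n : m_normal m = m_normal n ->
  exists2 k, k != 0 & mxF m = k *: mxF n.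
Proof.
have [[a a0 ha] [b b0 hb]] := (m_normalP m, m_normalP n) => /(congr1 mxF).
rewrite ha hb => h; exists (a^-1 * b); first by rewrite mulf_neq0 ?invr_eq0.
by rewrite -scalerA -h scalerA mulVf // scale1r.
Qed.

Lemma v_crossP u v k : rowF u = k *: rowF v -> v_cross u v = (k0, k0, k0).
Proof.
have [c ->] := phi_surj k; rewrite -rowFZ => /rowF_inj ->.
case: v => [[d e] f] /=.
do !congr pair; apply/eqP; rewrite -phi_eq0 /k_sub phiD phiN !phiM.
- by rewrite subr_eq0 mulrAC.
- by rewrite subr_eq0 mulrAC.
- by rewrite subr_eq0 mulrAC.
Qed.

End Embedding.

(** * Words in the generators *)

Definition mat_of (s : seq nat) : mat3 :=
  let k i := k_of (nth 0 s i) in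
  ((k 0, k 1, k 2), (k 3, k 4, k 5), (k 6, k 7, k 8))%N.

(* Entry [a + 5 b] encodes [a + b sqrt 2].  The letters are [g2], [2 g3] (the
   scaling makes it orthogonal), [g4], [g5], [g6] and [diag (1, omega, 1)]. *)
Definition letters : seq mat3 := [seq mat_of s | s <-
  [:: [:: 1; 0; 0; 0; 17; 0; 0; 0; 12]; [:: 2; 1; 4; 1; 2; 4; 4; 4; 2];
      [:: 0; 1; 0; 1; 0; 0; 0; 0; 4]; [:: 1; 0; 0; 0; 0; 4; 0; 4; 0];
      [:: 0; 1; 0; 1; 0; 0; 0; 0; 1]; [:: 1; 0; 0; 0; 17; 0; 0; 0; 1]]%N].
Definition letter (s : nat) : mat3 := nth m_one letters s.

(** Letters 0 and 5 have order 3 because omega does; the others are involutions. Inverses are thus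
    words in the same letters. *)
Definition letter_inv (s : nat) : seq nat :=
  if (s == 0)%N || (s == 5)%N then [:: s; s] else [:: s].
Fixpoint word_inv (w : seq nat) : seq nat :=
  if w is s :: w' then word_inv w' ++ letter_inv s else [::].

Definition ev (w : seq nat) : mat3 := foldr (fun s m => m_mul (letter s) m) m_one w.
Definition v_act (v : vec3) (w : seq nat) : vec3 := foldl (fun u s => v_mul u (letter s)) v w.

Definition v_conj (v : vec3) : vec3 := let: (a, b, c) := v in (k_conj a, k_conj b, k_conj c).
Definition v_dot (u v : vec3) : f25 :=
  let: (a, b, c) := u in let: (d, e, f) := v in
  k_add (k_mul a d) (k_add (k_mul b e) (k_mul c f)).
Definition m_tr (m : mat3) : mat3 :=
  let: ((a, b, c), (d, e, f), (g, h, i)) := m in ((a, d, g), (b, e, h), (c, f, i)).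
Definition m_conj (m : mat3) : mat3 :=
  let: (r1, r2, r3) := m in (v_conj r1, v_conj r2, v_conj r3).
Definition m_unitary (m : mat3) : bool := m_mul m (m_tr (m_conj m)) == m_one.

Lemma k_domain x y : k_mul x y = k0 -> x = k0 \/ y = k0.
Proof.
move=> xy0.
have : all (fun x => all (fun y => (k_mul x y == k0) ==> (x == k0) || (y == k0)) all_k) all_k.
  by vm_compute.
move/all_kP/(_ x)/all_kP/(_ y); rewrite xy0 eqxx /=.
by case/orP=> /eqP; [left|right].
Qed.

Lemma coset_normedM (gT : finGroupType) (H : {group gT}) :
  (forall x, x \in 'N(H)) -> {morph coset H : x y / (x * y)%g}.
Proof. by move=> nH x y; rewrite morphM. Qed.

Lemma coset1 (gT : finGroupType) (H : {group gT}) : coset H 1 = 1%g.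
Proof. exact: morph1. Qed.

(** * Words as elements of PGL_3 *)

Section Projective.

Variables (F : finFieldType) (alpha : F).
Hypotheses (F25 : #|F| = 25%N) (alpha2 : alpha ^+ 2 = 2).

Local Notation mxF := (mxF F alpha).
Local Notation rowF := (rowF F alpha).

Local Notation GL3 := {'GL_3[F]}.
Local Notation PGL3 := (PGLtype 3 F).

Definition proj (x : GL3) : PGL3 := coset (scalGL 3 F) x.

Lemma scalGL_norm (x : GL3) : x \in 'N(scalGL 3 F).
Proof.
apply: (subsetP (cent_sub _)); apply/centP => y.
rewrite inE => /is_scalar_mxP[a ya]; apply: val_inj.
by rewrite -[LHS]/(GLval _) -[RHS]/(GLval _) !GL_MxE ya scalar_mxC.
Qed.

Lemma projM : {morph proj : x y / (x * y)%g}.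
Proof. exact: (coset_normedM _ (scalGL 3 F) scalGL_norm). Qed.

Lemma proj1 : proj 1%g = 1%g.
Proof. exact: (coset1 _ (scalGL 3 F)). Qed.

Lemma proj_eqP (x y : GL3) :
  reflect (exists2 k, k != 0 & GLval x = k *: GLval y) (proj x == proj y).
Proof.
apply: (iffP eqP).
  move/(rcoset_kercosetP (scalGL_norm x) (scalGL_norm y))/rcosetP => [z].
  rewrite inE => /is_scalar_mxP[k hk] xzy.
  have hx : GLval x = k *: GLval y by rewrite xzy GL_MxE hk mul_scalar_mx.
  exists k => //; apply/eqP => k0; have : GLval x \in unitmx := GL_unitmx x.
  by rewrite hx k0 scale0r unitmxE det0 unitr0.
case=> k k0 hx; apply/(rcoset_kercosetP (scalGL_norm x) (scalGL_norm y)).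
have uk : (k%:M : 'M[F]_3) \in unitmx by rewrite unitmxE det_scalar unitrX ?unitfE.
pose z : GL3 := insubd (1%g : GL3) k%:M.
have hz : GLval z = k%:M by rewrite /z insubdK.
apply/rcosetP; exists z; first by rewrite inE hz scalar_mx_is_scalar.
by apply: val_inj; rewrite -[LHS]/(GLval x) -[RHS]/(GLval (z * y)%g) GL_MxE hx hz mul_scalar_mx.
Qed.

Definition GLof (m : mat3) : GL3 := insubd (1%g : GL3) (mxF m).

Lemma GLofK m : mxF m \in unitmx -> GLval (GLof m) = mxF m.
Proof. by move=> u; rewrite /GLof insubdK. Qed.

Lemma GL_mxF (x : GL3) : exists2 m, GLval x = mxF m & x = GLof m.
Proof.
have [m hm] := mxF_surj _ _ F25 alpha2 (GLval x); exists m => //.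
apply: val_inj; rewrite [RHS]GLofK -hm //.
exact: (GL_unitmx x).
Qed.

Lemma letter_unit s : mxF (letter s) \in unitmx.
Proof.
case: (ltnP s 6) => [|h]; last first.
  by rewrite /letter nth_default // mxF1 unitmx1.
have h : all (fun s => m_mul (letter s) (ev (letter_inv s)) == m_one
   ) (iota 0 6) by vm_compute.
move=> s6; move/allP: h => /(_ s); rewrite mem_iota => /(_ s6)/eqP hs.
have : mxF (letter s) *m mxF (ev (letter_inv s)) = 1%:M.
  by rewrite -mxFM // hs mxF1.
by case/mulmx1_unit.
Qed.

Definition gl (s : nat) : GL3 := GLof (letter s).
Definition Pw (w : seq nat) : PGL3 := (\prod_(s <- w) proj (gl s))%g.

Lemma Pw_cat u v : Pw (u ++ v) = (Pw u * Pw v)%g.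
Proof. by rewrite /Pw big_cat. Qed.

Lemma Pw1 s : Pw [:: s] = proj (gl s).
Proof. by rewrite /Pw big_seq1. Qed.

Lemma Pw_lift w : exists2 x : GL3, Pw w = proj x & GLval x = mxF (ev w).
Proof.
elim: w => [|s w [x hx ex]].
  exists 1%g; first by rewrite /Pw big_nil proj1.
  by rewrite GL_1E mxF1.
exists (gl s * x)%g; first by rewrite projM -hx /Pw big_cons.
by rewrite GL_MxE ex GLofK ?letter_unit //= mxFM.
Qed.

Lemma ev_unit w : mxF (ev w) \in unitmx.
Proof. by have [x _ <-] := Pw_lift w; exact: (GL_unitmx x). Qed.

Lemma Pw_eq u v : m_normal (ev u) == m_normal (ev v) -> Pw u = Pw v.
Proof.
move/eqP/(m_normal_eq _ _ F25 alpha2) => [k k0 h].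
have [[x -> hx] [y -> hy]] := (Pw_lift u, Pw_lift v).
by apply/eqP/proj_eqP; exists k; rewrite ?hx ?hy.
Qed.

Lemma rowF_act v w : rowF (v_act v w) = rowF v *m mxF (ev w).
Proof.
elim: w v => [|s w ih] v; first by rewrite -[ev [::]]/m_one mxF1 mulmx1.
rewrite -[v_act _ _]/(v_act (v_mul v (letter s)) w) ih.
by rewrite -[ev (s :: w)]/(m_mul (letter s) (ev w)) mxFM // mulmxA; congr (_ *m _); rewrite rowF_mul.
Qed.

Lemma Pw_letter_inv s : Pw (letter_inv s) = (Pw [:: s])^-1%g.
Proof.
apply/eqP; rewrite eq_sym eq_invg_mul -Pw_cat.
suff h : m_normal (ev ([:: s] ++ letter_inv s)) == m_normal (ev [::]).
  by rewrite (Pw_eq _ _ h) /Pw big_nil.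
case: (ltnP s 6) => hs; last first.
  have ls : letter s = m_one by rewrite /letter nth_default.
  have -> : letter_inv s = [:: s] by case: s hs {ls} => [|[|[|[|[|[|]]]]]].
  by rewrite /ev /= ls.
have h : all (fun s => m_normal (ev ([:: s] ++ letter_inv s)) == m_normal (ev [::])) (iota 0 6).
  by vm_compute.
by move/allP: h; apply; rewrite mem_iota.
Qed.

Lemma Pw_inv w : Pw (word_inv w) = (Pw w)^-1%g.
Proof.
elim: w => [|s w ih]; first by rewrite /Pw big_nil invg1.
by rewrite [word_inv _]/= Pw_cat ih Pw_letter_inv -invMg -Pw_cat.
Qed.

Definition letters_gen (l : seq nat) : {set PGL3} := <<[set x in [seq Pw [:: s] | s <- l]]>>%g.

Lemma Pw_gen l w : {subset w <= l} -> Pw w \in letters_gen l.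
Proof.
move=> wl; rewrite /Pw big_seq; apply: group_prod => s sw.
by apply: mem_gen; rewrite inE -Pw1; apply: map_f; apply: wl.
Qed.

(** In a finite group a generated subgroup consists of products of the generators alone, so words
    without formal inverses suffice. *)
Lemma letters_genP l g : g \in letters_gen l -> exists2 w, {subset w <= l} & g = Pw w.
Proof.
case/gen_prodgP => n [c hc ->]; elim: n c hc => [|n ih] c hc.
  by exists [::] => //; rewrite big_ord0 /Pw big_nil.
have [w wl hw] := ih _ (fun i => hc (lift ord0 i)).
have /[1!inE]/mapP[s sl hs] := hc ord0.
exists (s :: w); last by rewrite big_ord_recl hw hs -Pw_cat.
by move=> x; rewrite inE => /orP[/eqP->|/wl].
Qed.

End Projective.

(** * Generators of the unitary and real orthogonal groups *)

Definition e1 : vec3 := (k1, k0, k0).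
Definition e2 : vec3 := (k0, k1, k0).
Definition m_diag (a b c : f25) : mat3 := ((a, k0, k0), (k0, b, k0), (k0, k0, c)).
Definition k_code (x : f25) : nat := f5_nat x.1 + 5 * f5_nat x.2.

(* One letter of a shortest word that brings a non-isotropic point to
   [e1], for the points [(1 : y : z)]; the entries at isotropic points are
   irrelevant.  [descent_line] and [descent_point] treat [(0 : 1 : z)] and [(0 : 0 : 1)]. *)
Definition descent_affine : seq (seq nat) :=
  [:: [:: 0; 3; 0; 0; 1; 4; 0; 3; 1; 0; 1; 3; 1; 0; 2; 2; 1; 1; 4; 0; 2; 0; 1; 1; 0];
      [:: 3; 3; 2; 3; 5; 0; 3; 2; 5; 5; 0; 0; 3; 1; 0; 1; 0; 3; 2; 0; 0; 3; 1; 5; 2];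
      [:: 0; 2; 3; 4; 4; 3; 1; 1; 1; 3; 3; 3; 5; 5; 1; 2; 1; 5; 5; 1; 5; 5; 1; 2; 3];
      [:: 0; 4; 1; 1; 2; 3; 4; 1; 4; 5; 3; 3; 4; 5; 2; 4; 1; 5; 2; 2; 2; 5; 1; 2; 3];
      [:: 0; 5; 4; 3; 5; 0; 3; 3; 5; 5; 1; 0; 0; 4; 0; 1; 0; 5; 4; 0; 0; 3; 3; 1; 4];
      [:: 1; 0; 1; 5; 0; 2; 2; 5; 1; 4; 5; 2; 0; 0; 5; 5; 5; 0; 0; 4; 4; 2; 0; 4; 4];
      [:: 0; 5; 5; 5; 5; 5; 4; 5; 5; 0; 0; 5; 1; 2; 3; 0; 0; 3; 2; 5; 0; 4; 3; 3; 5];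
      [:: 1; 4; 3; 5; 3; 0; 4; 0; 0; 2; 0; 5; 1; 3; 5; 0; 3; 4; 3; 5; 1; 4; 0; 0; 1];
      [:: 1; 1; 0; 1; 5; 3; 4; 0; 0; 5; 0; 1; 4; 5; 4; 0; 2; 5; 0; 4; 3; 5; 0; 0; 5];
      [:: 0; 5; 5; 2; 5; 2; 2; 2; 1; 3; 3; 4; 2; 4; 3; 2; 4; 2; 4; 1; 4; 4; 5; 5; 3];
      [:: 1; 1; 5; 5; 0; 4; 4; 0; 0; 5; 0; 4; 0; 5; 1; 0; 5; 5; 5; 0; 5; 4; 0; 0; 0];
      [:: 1; 0; 5; 5; 0; 5; 2; 5; 5; 0; 4; 2; 0; 0; 2; 2; 4; 0; 0; 4; 5; 0; 5; 5; 0];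
      [:: 0; 0; 5; 5; 2; 0; 5; 5; 1; 2; 5; 0; 5; 5; 0; 4; 0; 5; 0; 0; 0; 3; 4; 5; 2];
      [:: 1; 5; 5; 1; 5; 0; 3; 3; 3; 4; 0; 0; 5; 0; 0; 1; 0; 1; 4; 0; 0; 3; 3; 3; 4];
      [:: 1; 0; 4; 2; 0; 2; 3; 3; 3; 1; 5; 2; 0; 0; 4; 3; 2; 0; 0; 4; 1; 5; 4; 2; 5];
      [:: 1; 5; 5; 5; 3; 1; 4; 0; 0; 0; 0; 5; 4; 1; 0; 0; 4; 0; 1; 3; 3; 0; 0; 0; 5];
      [:: 0; 0; 5; 3; 0; 4; 2; 3; 3; 1; 2; 4; 0; 0; 5; 4; 5; 0; 0; 2; 2; 2; 5; 5; 4];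
      [:: 3; 3; 5; 5; 3; 0; 3; 0; 5; 2; 5; 0; 5; 2; 0; 2; 0; 3; 5; 0; 0; 3; 5; 1; 2];
      [:: 1; 2; 5; 5; 1; 0; 5; 2; 3; 4; 4; 0; 1; 5; 0; 3; 0; 5; 2; 0; 0; 3; 5; 1; 4];
      [:: 1; 0; 4; 2; 0; 1; 5; 5; 1; 5; 3; 5; 0; 0; 4; 5; 2; 0; 0; 5; 2; 5; 1; 3; 5];
      [:: 0; 0; 5; 5; 0; 4; 2; 0; 5; 0; 5; 1; 0; 0; 4; 3; 2; 0; 0; 5; 2; 0; 5; 0; 4];
      [:: 0; 5; 5; 5; 5; 3; 4; 5; 3; 5; 0; 5; 3; 2; 3; 5; 3; 4; 2; 3; 2; 4; 2; 5; 0];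
      [:: 0; 5; 5; 5; 3; 4; 4; 0; 0; 1; 0; 4; 4; 3; 5; 0; 5; 1; 3; 2; 0; 0; 0; 0; 5];
      [:: 1; 1; 3; 1; 3; 5; 4; 0; 0; 5; 0; 4; 5; 3; 4; 0; 1; 4; 5; 5; 5; 5; 0; 0; 3];
      [:: 0; 5; 5; 5; 5; 0; 5; 5; 5; 3; 5; 5; 2; 0; 5; 0; 5; 0; 4; 5; 0; 2; 5; 0; 5]]%N.
Definition descent_line : seq nat :=
  [:: 2; 2; 0; 0; 1; 1; 0; 1; 1; 0; 1; 5; 1; 1; 0; 3; 1; 1; 1; 0; 1; 0; 1; 1; 0]%N.
Definition descent_point : nat := 3.
(* Words that fix [e1] and bring the anisotropic points of the line [x = 0] to [e2]. *)
Definition line_words : seq (seq nat) :=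
  [:: [:: 0]; [:: 0; 1; 0; 2; 5; 1; 5; 3; 2; 1]; [::]; [::];
    [:: 0; 1; 2; 3; 5; 1; 2; 3; 5; 1]; [:: 2; 1; 5; 1; 5; 1; 5; 1; 2; 3]; [::];
    [:: 0; 2; 1; 5; 1; 5; 1; 5; 1; 2]; [:: 2; 0; 1; 5; 1; 5; 1; 5; 1; 2]; [::];
    [:: 1; 4; 5; 1; 5; 1; 5; 1; 2]; [:: 1; 2; 5; 1; 0; 2; 1; 0; 5; 5; 1];
    [:: 1; 5; 3; 2; 1; 5; 3; 2; 1]; [:: 1; 2; 3; 5; 1; 2; 3; 5; 1];
    [:: 0; 2; 1; 5; 1; 5; 1; 5; 1; 2; 3]; [:: 2; 1; 5; 1; 5; 1; 5; 1; 2];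
    [:: 0; 1; 3; 4; 5; 1; 5; 1; 5; 1; 2]; [:: 1; 0; 2; 5; 1; 5; 3; 2; 1];
    [:: 1; 2; 3; 2; 5; 1; 2; 3; 5; 1]; [:: 2; 1; 5; 1; 0; 2; 1; 5; 5; 1; 2];
    [:: 1; 3; 4; 5; 1; 5; 1; 5; 1; 2]; [::]; [:: 4; 0; 1; 5; 1; 5; 1; 5; 1; 2];
    [:: 0; 1; 4; 5; 1; 5; 1; 5; 1; 2]; [::]; [:: 3]]%N.
(* Words in [g3, ..., g6] that reduce the first row of a real orthogonal matrix, and
   words for the real orthogonal matrices that fix [e1]. *)
Definition real_row_words : seq (seq nat) :=
  [:: [::]; [:: 1]; [:: 2]; [:: 1; 2]; [:: 2; 1]; [:: 3; 2]; [:: 1; 2; 1];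
    [:: 1; 3; 2]; [:: 3; 2; 1]; [:: 1; 3; 2; 1]; [:: 2; 1; 3; 2]; [:: 4; 3; 2; 1];
    [:: 1; 4; 3; 2; 1]; [:: 2; 1; 3; 2; 1]; [:: 2; 1; 4; 3; 2; 1]]%N.
Definition real_monomial_words : seq (seq nat) :=
  [:: [::]; [:: 3]; [:: 2; 4]; [:: 2; 4; 3]; [:: 3; 2; 4]; [:: 3; 2; 4; 3];
    [:: 2; 3; 4; 3; 2]; [:: 2; 3; 2; 4; 3; 2]]%N.
Definition sign_words : seq (seq nat) := [:: [::]; [:: 2; 4]; [:: 3; 2; 4; 3]; [:: 2; 3; 2; 4; 3; 2]]%N.

Definition descent (p : vec3) : nat :=
  let: (a, b, c) := p in
  if a != k0 then nth 0%N (nth [::] descent_affine (k_code b)) (k_code c)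
  else if b != k0 then nth 0%N descent_line (k_code c) else descent_point.

(** [n] is fuel; that 10 letters are enough for every point is part of what [descent_ok] checks. *)
Fixpoint descent_word (n : nat) (p : vec3) : seq nat :=
  if n isn't n'.+1 then [::] else
  if p == e1 then [::] else
  let s := descent p in s :: descent_word n' (v_normal (v_mul p (letter s))).

(** The letters are unitary and preserve the Hermitian norm, so only points of nonzero norm can
    reach [e1]. Rows of unitary matrices have norm 1. *)
Definition anisotropic (p : vec3) : bool := v_dot p (v_conj p) != k0.

Definition has_descent (p : vec3) : bool :=
  anisotropic p ==>
  let w := descent_word 10 p in
  all (fun s => s < 6)%N w && (v_normal (v_act p w) == e1).

Lemma descent_ok :
  [/\ all (fun y => all (fun z => has_descent (k1, y, z)) all_k) all_k,
      all (fun z => has_descent (k0, k1, z)) all_k & has_descent (k0, k0, k1)].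
Proof. by split; vm_compute. Qed.

Definition has_line_word (p : vec3) (w : seq nat) : bool :=
  anisotropic p ==>
  [&& all (fun s => s < 6)%N w, v_normal (v_act e1 w) == e1 & v_normal (v_act p w) == e2].

Lemma line_words_ok :
  all (fun z => has_line_word (k0, k1, z) (nth [::] line_words (k_code z))) all_k &&
  has_line_word (k0, k0, k1) (nth [::] line_words 25).
Proof. by vm_compute. Qed.

(** The six elements of norm 1 are the powers of omega up to sign. Modulo scalars a diagonal unitary
    matrix is given by two exponents of omega modulo 3 and one of the four sign patterns in
    [sign_words]: 36 classes. *)
Definition torus_words : seq (seq nat) :=
  [seq nseq ij.1 5 ++ nseq ij.2 0 ++ w | ij <- [seq (i, j) | i <- iota 0 3, j <- iota 0 3],
     w <- sign_words]%N.

Lemma torus_words_ok :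
  let units := [seq x <- all_k | k_norm x == k1] in
  let evs := [seq m_normal (ev w) | w <- torus_words] in
  all (all (fun s => s < 6)%N) torus_words &&
  all (fun a => all (fun b => all (fun c => m_normal (m_diag a b c) \in evs) units) units) units.
Proof. by vm_compute. Qed.

Definition real_k : seq f25 := [seq (nat_f5 n, F0) | n <- iota 0 5].
Definition m_real (m : mat3) : bool := m_conj m == m.
Definition in_D (w : seq nat) : bool := all (fun s => 0 < s < 5)%N w.

Definition real_row_ok (v : vec3) : bool :=
  (v_dot v v == k1) ==> has (fun w => v_normal (v_act v w) == e1) real_row_words.

(** The form x^2 + y^2 + z^2 takes the value 1 at 30 vectors over F_5, that is, at 15 pairs of
    opposite vectors, one for each word. *)
Lemma real_rows_ok :
  all in_D real_row_words &&
  all (fun a => all (fun b => all (fun c => real_row_ok (a, b, c)) real_k) real_k) real_k.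
Proof. by vm_compute. Qed.

Definition real_monomial_ok (evs : seq mat3) (a : f25) (v u : vec3) : bool :=
  (v_dot v u == k0) && (v_dot u u == k1) ==> (m_normal ((a, k0, k0), v, u) \in evs).

(** Over F_5 the equation b^2 + c^2 = 1 has only the solutions with one coordinate 0 and the other 1
    or -1. A real orthogonal matrix that fixes the point [e1] is therefore monomial, and there are
    eight of them up to sign. *)
Lemma real_monomials_ok :
  let evs := [seq m_normal (ev w) | w <- real_monomial_words] in
  all in_D real_monomial_words &&
  all (fun a => all (fun b => all (fun c =>
    (k_mul a a == k1) && (v_dot (k0, b, c) (k0, b, c) == k1) ==>
    all (fun d => all (fun e => real_monomial_ok evs a (k0, b, c) (k0, d, e))
      real_k) real_k) real_k) real_k) real_k.
Proof. by vm_compute. Qed.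

Lemma real_kP (x : f25) : k_conj x = x -> x \in real_k.
Proof. by case: x => [[] []]; vm_compute. Qed.

(** * Unitary representatives of projective classes *)

Section Unitary.

Variables (F : finFieldType) (alpha : F).
Hypotheses (F25 : #|F| = 25%N) (alpha2 : alpha ^+ 2 = 2).

Local Notation mxF := (mxF F alpha).
Local Notation phi := (phi F alpha).
Local Notation GL3 := {'GL_3[F]}.
Local Notation GLof := (GLof F alpha).
Local Notation Pw := (Pw F alpha).
Local Notation letters_gen := (letters_gen F alpha).

Lemma pchar5 : 5%N \in [pchar F].
Proof. by rewrite inE /= (five_eq0 F F25) eqxx. Qed.

Local Notation frob := (pFrobenius_aut pchar5).

Lemma conj5E : @conj5 F =1 frob.
Proof. by move=> x; rewrite pFrobenius_autE. Qed.

Lemma conj5_mx m n (A : 'M[F]_(m, n)) : map_mx (@conj5 F) A = map_mx frob A.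
Proof. by apply: eq_map_mx; exact: conj5E. Qed.

Lemma mxF_inj : injective mxF.
Proof.
move=> m n mn; have [a1 a2 a3] := row_mxF F alpha m; have [b1 b2 b3] := row_mxF F alpha n.
have inj := rowF_inj _ _ F25 alpha2; move: a1 a2 a3; rewrite mn b1 b2 b3.
move=> /inj h1 /inj h2 /inj h3.
by case: m n h1 h2 h3 {mn b1 b2 b3} => [[? ?] ?] [[? ?] ?] /= -> -> ->.
Qed.

Lemma mxF_tr m : mxF (m_tr m) = (mxF m)^T.
Proof.
case: m => [[[[a b] c] [[d e] f]] [[g h] i]].
by apply/matrixP; apply: ord3P; apply: ord3P; rewrite !mxE.
Qed.

Lemma mxF_conj m : mxF (m_conj m) = map_mx (@conj5 F) (mxF m).
Proof.
case: m => [[[[a b] c] [[d e] f]] [[g h] i]].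
by apply/matrixP; apply: ord3P; apply: ord3P; rewrite !mxE /= ?mxE /= phi_conj.
Qed.

Lemma m_unitaryE m :
  m_unitary m = (mxF m *m (map_mx frob (mxF m))^T == 1%:M).
Proof.
rewrite -conj5_mx -mxF_conj -mxF_tr -mxFM // -(mxF1 F alpha).
by rewrite /m_unitary (inj_eq mxF_inj).
Qed.

Lemma m_unitaryM m n : m_unitary m -> m_unitary n -> m_unitary (m_mul m n).
Proof.
rewrite !m_unitaryE => /eqP hm /eqP hn.
by rewrite mxFM // map_mxM trmx_mul mulmxA -(mulmxA (mxF m)) hn mulmx1 hm.
Qed.

Lemma letter_unitary s : m_unitary (letter s).
Proof.
case: (ltnP s 6) => [|h]; last by rewrite /letter nth_default.
have h : all (fun s => m_unitary (letter s)) (iota 0 6) by vm_compute.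
by move=> s6; apply: (allP h); rewrite mem_iota.
Qed.

Lemma ev_unitary w : m_unitary (ev w).
Proof. by elim: w => //= s w; apply: m_unitaryM; exact: letter_unitary. Qed.

Lemma m_unitary_unit m : m_unitary m -> mxF m \in unitmx.
Proof. by rewrite m_unitaryE => /eqP/mulmx1_unit[]. Qed.

Lemma m_unitary_scalar m : m_unitary m ->
  is_scalar_mx ((mxF m)^T *m map_mx (@conj5 F) (mxF m)).
Proof.
rewrite m_unitaryE conj5_mx => /eqP/mulmx1C/(congr1 trmx).
by rewrite trmx_mul trmxK trmx1 => ->; exact: scalar_mx_is_scalar.
Qed.

(** The scalar [k] is nonzero and lies in F_5, where every element is a norm; scaling by an element
    of norm [k^-1] makes the matrix unitary. *)
Lemma unitary_rescale m k : k != 0 ->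
  mxF m *m (map_mx frob (mxF m))^T = k%:M ->
  exists2 t, t != k0 & m_unitary (m_scale t m).
Proof.
move=> k_neq0 hm; have [z hz] := phi_surj _ _ F25 alpha2 k.
have z0 : z != k0 by apply: contra_neq k_neq0 => z0; rewrite hz z0 phi0.
(* The product of a matrix with its conjugate transpose is Hermitian, so its diagonal entry [k] is
   fixed by conjugation. *)
have zz : frob k = k.
  have /(congr1 (fun A : 'M_3 => (map_mx frob A)^T 0 0)) := hm.
  rewrite map_mxM trmx_mul -map_trmx trmxK -map_mx_comp.
  have -> : map_mx (frob \o frob) (mxF m) = mxF m.
    apply/matrixP => i j; rewrite mxE /=.
    have [[a b] ->] := phi_surj _ _ F25 alpha2 (mxF m i j).
    by rewrite -!conj5E !phi_conj //; case: b.
  by rewrite hm !mxE eqxx !mulr1n.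
have zc : k_conj z = z.
  by apply: (phi_inj _ _ F25 alpha2); rewrite -phi_conj // conj5E -hz.
have [t t0 ht] : exists2 t, t != k0 & k_mul (k_norm t) z = k1.
  have : all (fun z => (z != k0) ==> has (fun t => (t != k0) && (k_mul (k_norm t) z == k1)) all_k) real_k.
    by vm_compute.
  by move/allP/(_ _ (real_kP z zc)); rewrite z0 => /hasP[t _ /andP[t0 /eqP]]; exists t.
exists t => //; rewrite m_unitaryE mxFZ // map_mxZ linearZ /= -scalemxAl -scalemxAr hm hz.
rewrite !scale_scalar_mx -conj5E phi_conj // -!phiM //.
have -> : k_mul t (k_mul (k_conj t) z) = k_mul (k_norm t) z.
  by apply: (phi_inj _ _ F25 alpha2); rewrite !phiM // mulrA.
by rewrite ht phi1.
Qed.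

(** [PGU3] puts the transpose on the left, [m_unitary] puts the conjugate transpose on the right.
    The two agree up to the scalar because a one-sided inverse of a square matrix is two-sided. *)
Lemma unitary_lift (x : GL3) :
  is_scalar_mx ((GLval x)^T *m map_mx (@conj5 F) (GLval x)) ->
  exists2 m, m_unitary m & exists2 k, k != 0 & mxF m = k *: GLval x.
Proof.
rewrite conj5_mx => /is_scalar_mxP[k hk].
have [m hm _] := GL_mxF _ _ F25 alpha2 x.
have ux : GLval x \in unitmx := GL_unitmx x.
have uc : map_mx frob (GLval x) \in unitmx by rewrite map_unitmx.
have k_neq0 : k != 0.
  apply/eqP=> k0; have : (GLval x)^T *m map_mx frob (GLval x) \in unitmx.
    by rewrite unitmx_mul unitmx_tr ux.
  by rewrite hk k0 unitmxE det_scalar expr0n /= unitr0.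
have h : mxF m *m (map_mx frob (mxF m))^T = k%:M.
  have e : (k^-1 *: (GLval x)^T) *m map_mx frob (GLval x) = 1%:M.
    by rewrite -scalemxAl hk scale_scalar_mx mulVf.
  have /(congr1 trmx) := mulmx1C e.
  rewrite -scalemxAr linearZ /= trmx_mul trmxK trmx1 hm => /(congr1 ( *:%R k)).
  by rewrite scalerA divff // scale1r scalemx1.
have [t t0 ht] := unitary_rescale _ _ k_neq0 h.
exists (m_scale t m) => //; exists (phi t); last by rewrite mxFZ // hm.
exact: phi_neq0.
Qed.

Lemma proj_GLof m n k : mxF m \in unitmx -> k != 0 -> mxF m = k *: mxF n ->
  proj F (GLof m) = proj F (GLof n).
Proof.
move=> um k_neq0 h; have un : mxF n \in unitmx by move: um; rewrite h unitmxZ ?unitfE.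
by apply/eqP/proj_eqP; exists k => //; rewrite !GLofK.
Qed.

Lemma Pw_GLof w : Pw w = proj F (GLof (ev w)).
Proof.
have [x -> hx] := Pw_lift _ _ F25 alpha2 w; congr proj.
by apply: val_inj; rewrite -[LHS]/(GLval x) -[RHS]/(GLval (GLof _)) GLofK // ev_unit.
Qed.

(** One stage of a row reduction: multiplying on the right by an available word does not affect
    membership. *)
Lemma proj_GLofM m w l : mxF m \in unitmx -> {subset w <= l} ->
  proj F (GLof (m_mul m (ev w))) \in letters_gen l -> proj F (GLof m) \in letters_gen l.
Proof.
move=> um wl.
have -> : GLof (m_mul m (ev w)) = (GLof m * GLof (ev w))%g.
  apply: val_inj; rewrite -[LHS]/(GLval _) -[RHS]/(GLval _) GL_MxE !GLofK ?mxFM //.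
    by rewrite ev_unit.
  by rewrite unitmx_mul um ev_unit.
by rewrite projM -Pw_GLof groupMr //; exact: Pw_gen.
Qed.

Lemma proj_normal m l (ws : seq (seq nat)) : mxF m \in unitmx ->
  (forall w, w \in ws -> {subset w <= l}) ->
  m_normal m \in [seq m_normal (ev w) | w <- ws] -> proj F (GLof m) \in letters_gen l.
Proof.
move=> um hws /mapP[w /hws wl /(m_normal_eq _ _ F25 alpha2)[k k_neq0 h]].
by rewrite (proj_GLof _ (ev w) k) // -Pw_GLof; exact: Pw_gen.
Qed.

Lemma m_unitaryP (r1 r2 r3 : vec3) : m_unitary (r1, r2, r3) =
  [&& v_dot r1 (v_conj r1) == k1, v_dot r2 (v_conj r2) == k1, v_dot r3 (v_conj r3) == k1,
      v_dot r1 (v_conj r2) == k0, v_dot r1 (v_conj r3) == k0, v_dot r2 (v_conj r3) == k0,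
      v_dot r2 (v_conj r1) == k0, v_dot r3 (v_conj r1) == k0 & v_dot r3 (v_conj r2) == k0].
Proof.
case: r1 r2 r3 => [[a b] c] [[d e] f] [[g h] i].
rewrite /m_unitary /= !xpair_eqE.
by do ?[case: eqP => _ //=; rewrite ?andbF //=].
Qed.

End Unitary.

(** * Generators of PGU_3 and Gamma *)

Section Generators.

Variables (F : finFieldType) (alpha : F).
Hypotheses (F25 : #|F| = 25%N) (alpha2 : alpha ^+ 2 = 2).

Local Notation mxF := (mxF F alpha).
Local Notation rowF := (rowF F alpha).
Local Notation phi := (phi F alpha).
Local Notation GLof := (GLof F alpha).
Local Notation letters_gen := (letters_gen F alpha).

Lemma anisotropicE k v p : k != 0 -> rowF v = k *: rowF p ->
  anisotropic v = anisotropic p.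
Proof.
have [c ->] := phi_surj _ _ F25 alpha2 k => k_neq0; rewrite -rowFZ // => /rowF_inj-> //.
rewrite /anisotropic -!(phi_eq0 _ _ F25 alpha2).
suff -> : v_dot (v_scale c p) (v_conj (v_scale c p)) = k_mul (k_norm c) (v_dot p (v_conj p)).
  rewrite phiM // mulf_eq0 negb_or !phi_eq0 //.
  suff -> : k_norm c != k0 by [].
  by move: k_neq0; rewrite phi_eq0 //; case: c => [[] []].
case: p => [[x y] z]; apply: (phi_inj _ _ F25 alpha2) => /=.
have conjM a b : k_conj (k_mul a b) = k_mul (k_conj a) (k_conj b).
  by case: a => [[] []]; case: b => [[] []].
by rewrite !(phiD, phiM, conjM) //; ring.
Qed.

Lemma point_normal v : v != (k0, k0, k0) ->
  exists p, [/\ [\/ exists y z, p = (k1, y, z), exists z, p = (k0, k1, z) | p = (k0, k0, k1)]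
    & exists2 k, k != 0 & rowF v = k *: rowF p].
Proof.
have scaleV x y : x != k0 -> k_mul x (k_mul (k_inv x) y) = y.
  move=> x0; apply: (phi_inj _ _ F25 alpha2).
  by rewrite !phiM // phiV // mulVKf // phi_neq0.
have mul_k0 x : k_mul x k0 = k0 by case: x => [[] []].
have mul_k1 x : k_mul x k1 = x by case: x => [[] []].
case: v => [[a b] c].
have [->|a0] := eqVneq a k0; last first.
  move=> _; exists (k1, k_mul (k_inv a) b, k_mul (k_inv a) c); split.
    by constructor 1; do 2!eexists.
  exists (phi a); first exact: phi_neq0.
  by rewrite -rowFZ // /v_scale mul_k1 !scaleV.
have [->|b0] := eqVneq b k0; last first.
  move=> _; exists (k0, k1, k_mul (k_inv b) c); split; first by constructor 2; eexists.
  exists (phi b); first exact: phi_neq0.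
  by rewrite -rowFZ // /v_scale mul_k1 mul_k0 !scaleV.
have [->|c0] := eqVneq c k0; first by rewrite eqxx.
move=> _; exists (k0, k0, k1); split; first by constructor 3.
exists (phi c); first exact: phi_neq0.
by rewrite -rowFZ // /v_scale mul_k1 mul_k0.
Qed.

Lemma v_normal_act p q w : v_normal q = q -> v_normal (v_act p w) = q ->
  exists2 k, k != 0 & rowF p *m mxF (ev w) = k *: rowF q.
Proof.
move=> hq hp; rewrite -rowF_act //; apply: v_normal_eq => //.
by rewrite hp.
Qed.

Lemma anisotropic_descent v : anisotropic v ->
  exists2 w, {subset w <= iota 0 6} & exists2 k, k != 0 & rowF v *m mxF (ev w) = k *: rowF e1.
Proof.
move=> va; have v0 : v != (k0, k0, k0) by apply: contraTneq va => ->.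
have [p [hp [k k_neq0 hk]]] := point_normal _ v0.
have pa : anisotropic p by rewrite -(anisotropicE _ _ _ k_neq0 hk).
have {hp} : has_descent p.
  have [/all_kP h1 /all_kP h2 h3] := descent_ok.
  case: hp => [[y [z ->]]|[z ->]|-> //]; last exact: h2.
  by move: (h1 y) => /all_kP.
rewrite /has_descent pa => /andP[/allP hw /eqP hn].
have [t t_neq0 ht] := v_normal_act _ e1 _ erefl hn.
exists (descent_word 10 p); first by move=> s /hw; rewrite mem_iota.
exists (k * t); first by rewrite mulf_neq0.
by rewrite hk -scalemxAl ht scalerA.
Qed.

Lemma anisotropic_line v : anisotropic v -> v.1.1 = k0 ->
  exists2 w, {subset w <= iota 0 6} &
    (exists2 k, k != 0 & rowF e1 *m mxF (ev w) = k *: rowF e1) /\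
    (exists2 k, k != 0 & rowF v *m mxF (ev w) = k *: rowF e2).
Proof.
move=> va v1; have v0 : v != (k0, k0, k0) by apply: contraTneq va => ->.
have [p [hp [k k_neq0 hk]]] := point_normal _ v0.
have pa : anisotropic p by rewrite -(anisotropicE _ _ _ k_neq0 hk).
have [/all_kP h1 h2] := andP line_words_ok.
have [w] : exists w, has_line_word p w.
  case: hp => [[y [z hp]]|[z ->]|->]; last 2 first.
  - by eexists; exact: h1.
  - by eexists; exact: h2.
  case/eqP: k_neq0; move/rowP: hk => /(_ 0); case: v v1 {va v0} => [[a b] c] /= ->.
  by rewrite hp !mxE /= phi0 phi1 mulr1.
rewrite /has_line_word pa => /and3P[/allP hw /eqP he /eqP hn].
have [t t_neq0 ht] := v_normal_act _ e1 _ erefl he.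
have [u u_neq0 hu] := v_normal_act _ e2 _ erefl hn.
exists w; first by move=> s /hw; rewrite mem_iota.
split; first by exists t.
by exists (k * u); [rewrite mulf_neq0|rewrite hk -scalemxAl hu scalerA].
Qed.

Lemma rowF_e1 v k : rowF v = k *: rowF e1 -> exists a, v = (a, k0, k0).
Proof.
have [c ->] := phi_surj _ _ F25 alpha2 k; rewrite -rowFZ // => /rowF_inj-> //.
by exists c; case: c => [[] []].
Qed.

Lemma rowF_e2 v k : rowF v = k *: rowF e2 -> exists a, v = (k0, a, k0).
Proof.
have [c ->] := phi_surj _ _ F25 alpha2 k; rewrite -rowFZ // => /rowF_inj-> //.
by exists c; case: c => [[] []].
Qed.

Lemma k_dot_eq0 (x y : f25) : k_norm x = k1 -> k_mul x (k_conj y) = k0 -> y = k0.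
Proof.
move=> hx /k_domain[x0|]; last by case: y => [[] []].
by rewrite x0 in hx.
Qed.

Lemma v_dot_e1 a v : v_dot (a, k0, k0) v = k_mul a v.1.1.
Proof.
have add_k0 u : k_add u k0 = u by case: u => [[] []].
have mul_0k u : k_mul k0 u = k0 by case: u => [[] []].
by case: v => [[x y] z]; rewrite /v_dot !mul_0k !add_k0.
Qed.

Lemma v_dot_e2 a v : v_dot (k0, a, k0) v = k_mul a v.1.2.
Proof.
have add_k0 u : k_add u k0 = u by case: u => [[] []].
have add_0k u : k_add k0 u = u by case: u => [[] []].
have mul_0k u : k_mul k0 u = k0 by case: u => [[] []].
by case: v => [[x y] z]; rewrite /v_dot !mul_0k add_k0 add_0k.
Qed.

Lemma v_dot_e3 a v : v_dot (k0, k0, a) v = k_mul a v.2.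
Proof.
have add_0k u : k_add k0 u = u by case: u => [[] []].
have mul_0k u : k_mul k0 u = k0 by case: u => [[] []].
by case: v => [[x y] z]; rewrite /v_dot !mul_0k !add_0k.
Qed.

(** Orthogonality to a first row proportional to [e1] clears the rest of the first column. *)
Lemma unitary_e1 a r2 r3 : m_unitary ((a, k0, k0), r2, r3) ->
  [/\ k_norm a = k1, r2.1.1 = k0 & r3.1.1 = k0].
Proof.
rewrite m_unitaryP !v_dot_e1; case: r2 r3 => [[x y] z] [[x' y'] z'].
move=> /andP[/eqP a1 /and5P[_ _ /eqP h2 /eqP h3 _]].
by split=> //; [exact: (k_dot_eq0 a x)|exact: (k_dot_eq0 a x')].
Qed.

Lemma unitary_e2 a b r3 : m_unitary ((a, k0, k0), (k0, b, k0), r3) ->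
  exists c, r3 = (k0, k0, c) /\ [/\ k_norm a = k1, k_norm b = k1 & k_norm c = k1].
Proof.
move=> h; have [a1 _] := unitary_e1 _ _ _ h.
move: h; rewrite m_unitaryP !v_dot_e1 !v_dot_e2; case: r3 => [[x y] z] + x0.
move=> /and5P[_ /eqP b1 /eqP c1 _ /and3P[_ /eqP h3 _]].
have y0 := k_dot_eq0 b y b1 h3; rewrite -[_.1.1]/x in x0.
by rewrite x0 y0 in c1 *; exists z; split => //; rewrite v_dot_e3 in c1.
Qed.

Lemma mem_all_k x : x \in all_k.
Proof. by move: x; apply: all_kP; vm_compute. Qed.

Lemma torus_gen a b c : k_norm a = k1 -> k_norm b = k1 -> k_norm c = k1 ->
  m_unitary (m_diag a b c) ->
  proj F (GLof (m_diag a b c)) \in letters_gen (iota 0 6).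
Proof.
move=> a1 b1 c1 um; have [hw h] := andP torus_words_ok.
apply: (proj_normal _ _ F25 alpha2 _ _ torus_words).
- exact: m_unitary_unit.
- by move=> w /(allP hw)/allP hl s /hl; rewrite mem_iota.
have unitP x : k_norm x = k1 -> x \in [seq x <- all_k | k_norm x == k1].
  by move=> x1; rewrite mem_filter x1 eqxx mem_all_k.
by move/allP: h => /(_ a (unitP a a1))/allP/(_ b (unitP b b1))/allP/(_ c (unitP c c1)).
Qed.

Lemma unitary_gen m : m_unitary m -> proj F (GLof m) \in letters_gen (iota 0 6).
Proof.
move=> um; case: m um => [[r1 r2] r3] um.
have ra : anisotropic r1.
  by move: (um); rewrite m_unitaryP /anisotropic => /andP[/eqP->].
have [w wl [k _ hk]] := anisotropic_descent _ ra.
apply: (proj_GLofM _ _ F25 alpha2 _ w) => //; first exact: m_unitary_unit.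
have {um ra} um := m_unitaryM _ _ F25 alpha2 _ _ um (ev_unitary _ _ F25 alpha2 w).
move: hk; rewrite rowF_mul // => /rowF_e1[a ha].
move: um; rewrite /m_mul ha.
move: (v_mul r2 _) (v_mul r3 _) => {wl ha}r2 {}r3 {w}.
move=> um; have [a1 r21 r31] := unitary_e1 _ _ _ um.
have ra : anisotropic r2.
  by move: (um); rewrite m_unitaryP /anisotropic => /and3P[_ /eqP->].
(* The second word fixes the point [e1], so the first row keeps the shape it already has. *)
have [w wl [[t _ ht] [u _ hu]]] := anisotropic_line _ ra r21.
apply: (proj_GLofM _ _ F25 alpha2 _ w) => //; first exact: m_unitary_unit.
have {um ra} um := m_unitaryM _ _ F25 alpha2 _ _ um (ev_unitary _ _ F25 alpha2 w).
move: um hu; rewrite rowF_mul // => + /rowF_e2[b hb].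
have /(rowF_e1 _ _)[c hc] : rowF (v_mul (a, k0, k0) (ev w)) = (phi a * t) *: rowF e1.
  have -> : (a, k0, k0) = v_scale a e1 by case: (a) => [[] []].
  by rewrite -rowF_mul // rowFZ // -scalemxAl ht scalerA.
rewrite /m_mul hb hc; move: (v_mul r3 _) => r4 um.
have [d [hd [c1 b1 d1]]] := unitary_e2 _ _ _ um.
by move: um; rewrite hd; apply: torus_gen.
Qed.

Lemma PGU3P g : reflect (exists2 m, m_unitary m & g = proj F (GLof m)) (g \in PGU3 F).
Proof.
apply: (iffP idP) => [/morphimP[x _]|[m um ->]].
  rewrite inE => /(unitary_lift _ _ F25 alpha2)[m um [k k_neq0 hk]] ->.
  exists m => //; apply/eqP/proj_eqP; exists k^-1; rewrite ?invr_eq0 //.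
  by rewrite GLofK ?m_unitary_unit // hk scalerA mulVf // scale1r.
apply: mem_morphim; first exact: scalGL_norm.
by rewrite inE GLofK ?m_unitary_unit // m_unitary_scalar.
Qed.

Lemma PGU3_gen : PGU3 F = letters_gen (iota 0 6).
Proof.
apply/setP => g; apply/PGU3P/idP => [[m um ->]|]; first exact: unitary_gen.
case/letters_genP => w _ ->; exists (ev w); first exact: (ev_unitary _ _ F25 alpha2).
exact: Pw_GLof.
Qed.

Lemma Gamma_gen : Gamma alpha = letters_gen (iota 0 5).
Proof.
have phi_nat a : phi (a, F0) = (f5_nat a)%:R by rewrite /phi mul0r addr0.
have wE : omega alpha = phi (k_of 17) by rewrite /omega /phi.
have wV : (omega alpha)^-1 = phi (k_of 12) by rewrite wE -phiV.
(* Letter 1 is [2 g3], and 3 * 2 = 1 in F_5, so [g3] itself is 3 times that letter. *)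
have mats : Gamma_gens alpha =
    [:: mxF (letter 0); mxF (m_scale (k_of 3) (letter 1)); mxF (letter 2); mxF (letter 3);
        mxF (letter 4)].
  rewrite /Gamma_gens /= wV wE.
  congr [:: _; _; _; _; _]; apply/matrixP; apply: ord3P; apply: ord3P;
    by rewrite !mxE /= ?mxE /= ?phi_nat.
rewrite /Gamma /letters_gen; congr <<_>>%g; apply/setP => g; rewrite inE.
have k3 : phi (k_of 3) != 0 by exact: phi_neq0.
apply/morphimP/mapP => [[x _]|[s]].
  rewrite inE mats !inE => hx ->.
  have [s [s5 [k k_neq0 hk]]] : exists s, (s < 5)%N /\ exists2 k, k != 0 & GLval x = k *: mxF (letter s).
    case/or4P: hx => [/eqP|/eqP|/eqP|/orP[]/eqP] hx.
    - by exists 0; split => //; exists 1; rewrite ?oner_eq0 ?scale1r.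
    - by exists 1%N; split => //; exists (phi (k_of 3)); rewrite ?hx ?mxFZ.
    - by exists 2%N; split => //; exists 1; rewrite ?oner_eq0 ?scale1r.
    - by exists 3%N; split => //; exists 1; rewrite ?oner_eq0 ?scale1r.
    - by exists 4%N; split => //; exists 1; rewrite ?oner_eq0 ?scale1r.
  exists s; first by rewrite mem_iota.
  rewrite Pw1; apply/eqP/proj_eqP; exists k => //.
  by rewrite /gl GLofK ?letter_unit.
rewrite mem_iota => /= s5 ->; rewrite Pw1.
have [x hx xs] : exists2 x, proj F (gl F alpha s) = proj F x & GLval x \in Gamma_gens alpha.
  have gls t : GLval (gl F alpha t) = mxF (letter t) by rewrite GLofK ?letter_unit.
  case: (eqVneq s 1%N) => [->|s1]; last first.
    exists (gl F alpha s) => //; rewrite gls mats !inE.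
    by case: s s5 s1 => [|[|[|[|[|]]]]] //= _ _; rewrite ?eqxx ?orbT.
  have hB : GLval (GLof (m_scale (k_of 3) (letter 1))) = phi (k_of 3) *: mxF (letter 1).
    by rewrite GLofK mxFZ // unitmxZ ?unitfE // letter_unit.
  exists (GLof (m_scale (k_of 3) (letter 1))); last by rewrite mats !inE hB -mxFZ // eqxx orbT.
  apply/eqP/proj_eqP; exists (phi (k_of 3))^-1; rewrite ?invr_eq0 //.
  by rewrite hB gls scalerA mulVf // scale1r.
by exists x => //; [exact: scalGL_norm|rewrite inE].
Qed.

End Generators.

(** * Generators of Delta *)

Section RealOrthogonal.

Variables (F : finFieldType) (alpha : F).
Hypotheses (F25 : #|F| = 25%N) (alpha2 : alpha ^+ 2 = 2).

Local Notation mxF := (mxF F alpha).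
Local Notation rowF := (rowF F alpha).
Local Notation phi := (phi F alpha).
Local Notation GLof := (GLof F alpha).
Local Notation letters_gen := (letters_gen F alpha).
Local Notation frob := (pFrobenius_aut (pchar5 F F25)).

Lemma m_realM m n : m_real m -> m_real n -> m_real (m_mul m n).
Proof.
move=> /eqP hm /eqP hn; apply/eqP/(mxF_inj _ _ F25 alpha2).
by rewrite mxF_conj // conj5_mx !mxFM // map_mxM -!conj5_mx -!mxF_conj // hm hn.
Qed.

Lemma letter_real s : (0 < s < 5)%N -> m_real (letter s).
Proof. by case: s => [|[|[|[|[|]]]]]. Qed.

Lemma ev_real w : in_D w -> m_real (ev w).
Proof.
by elim: w => //= s w ih /andP[hs /ih hw]; apply: m_realM; first exact: letter_real.
Qed.

Lemma in_D_sub w : in_D w -> {subset w <= iota 1 4}.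
Proof. by move/allP=> h s /h; rewrite mem_iota. Qed.

Lemma sub_in_D w : {subset w <= iota 1 4} -> in_D w.
Proof. by move=> h; apply/allP=> s /h; rewrite mem_iota. Qed.

Lemma real_unitary_gen m : m_real m -> m_unitary m ->
  proj F (GLof m) \in letters_gen (iota 1 4).
Proof.
have realV (r1 r2 r3 : vec3) : m_real (r1, r2, r3) ->
    [/\ v_conj r1 = r1, v_conj r2 = r2 & v_conj r3 = r3].
  by move=> /eqP[-> -> ->].
have realK a b c : v_conj (a, b, c) = (a, b, c) -> [/\ a \in real_k, b \in real_k & c \in real_k].
  by case=> /real_kP ha /real_kP hb /real_kP hc.
case: m => [[r1 r2] r3] rm um.
have [c1 _ _] := realV _ _ _ rm.
have n1 : v_dot r1 r1 = k1 by move: (um); rewrite m_unitaryP c1 => /andP[/eqP->].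
have [hw h] := andP real_rows_ok.
have {h} [w wr wn] : exists2 w, w \in real_row_words & v_normal (v_act r1 w) = e1.
  case: r1 c1 n1 {rm um} => [[a b] c] /realK[ha hb hc] n1.
  move/allP: h => /(_ a ha)/allP/(_ b hb)/allP/(_ c hc).
  by rewrite /real_row_ok n1 eqxx => /hasP[w hw' /eqP]; exists w.
have {hw wr} wD : in_D w by move/allP: hw => /(_ w wr).
have [k k_neq0 hk] := v_normal_act _ _ F25 alpha2 _ e1 _ erefl wn.
apply: (proj_GLofM _ _ F25 alpha2 _ w).
- exact: m_unitary_unit.
- exact: in_D_sub.
have {}um := m_unitaryM _ _ F25 alpha2 _ _ um (ev_unitary _ _ F25 alpha2 w).
have {}rm := m_realM _ _ rm (ev_real _ wD).
move: hk; rewrite rowF_mul // => /(rowF_e1 _ _ F25 alpha2)[a ha].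
move: um rm; rewrite /m_mul ha; move: (v_mul r2 _) (v_mul r3 _) => s2 s3 um rm.
have [_ s21 s31] := unitary_e1 _ _ _ um.
have [/realK[ra _ _] ] := realV _ _ _ rm.
case: s2 s21 um rm => [[? b] c] /= -> um rm /realK[_ rb rc].
case: s3 s31 um rm => [[? d] e] /= -> um rm /realK[_ rd re].
have [hw h] := andP real_monomials_ok.
apply: (proj_normal _ _ F25 alpha2 _ _ real_monomial_words).
- exact: m_unitary_unit.
- by move=> u /(allP hw); exact: in_D_sub.
have [v1 v2 v3] := realV _ _ _ rm.
move: (um); rewrite m_unitaryP v1 v2 v3.
move=> /and5P[a1 b1 d1 _ /and3P[_ bd _]].
move/allP: h => /(_ a ra)/allP/(_ b rb)/allP/(_ c rc).
have -> : k_mul a a == k1 by move: a1; rewrite v_dot_e1.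
rewrite b1 => /allP/(_ d rd)/allP/(_ e re).
by rewrite /real_monomial_ok bd d1.
Qed.

(** A matrix that is both unitary and orthogonal up to scalars is proportional to its conjugate.
    Normalizing one entry to 1 makes it real, and a real scalar then makes it orthogonal, hence
    unitary. *)
Lemma Delta_lift g : g \in Delta F ->
  exists2 m, m_real m & m_unitary m /\ g = proj F (GLof m).
Proof.
rewrite inE => /andP[/PGU3P - /(_ _ F25 alpha2)[m0 um0 ->]].
case/morphimP => y _; rewrite inE => /is_scalar_mxP[c hc].
move/eqP/proj_eqP => [k k_neq0]; rewrite GLofK ?m_unitary_unit // => hk.
have um : mxF m0 \in unitmx by exact: m_unitary_unit.
have h1 : (mxF m0)^T *m mxF m0 = (k ^+ 2 * c)%:M.
  by rewrite hk [(_ *: _)^T]linearZ /= -scalemxAl -scalemxAr hc scalerA scale_scalar_mx expr2.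
have [d hd] := is_scalar_mxP (m_unitary_scalar _ _ F25 alpha2 _ um0).
set s := k ^+ 2 * c in h1.
have s0 : s != 0.
  apply/eqP=> s0; have : (mxF m0)^T *m mxF m0 \in unitmx by rewrite unitmx_mul unitmx_tr um.
  by rewrite h1 s0 unitmxE det_scalar expr0n /= unitr0.
(* Both [mxF m0] and its conjugate become scalar when multiplied by the transpose of [mxF m0], which
   is invertible. *)
have conj_m0 : map_mx (@conj5 F) (mxF m0) = (d / s) *: mxF m0.
  have ut : (mxF m0)^T \in unitmx by rewrite unitmx_tr.
  apply: (can_inj (mulKmx ut)); rewrite hd -scalemxAr h1 scale_scalar_mx.
  by rewrite divfK.
pose n := m_normal m0.
have [e e_neq0 he] := m_normalP _ _ F25 alpha2 m0.
have lead1 : exists j, mxF n 0 j = 1.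
  have r1 : row 0 (mxF n) = rowF (v_normal m0.1.1).
    by have [-> _ _] := row_mxF F alpha n; rewrite /n; case: (m0) => [[? ?] ?].
  have : m0.1.1 != (k0, k0, k0).
    case: (m0) um0 => [[q q2] q3] + /=; apply: contraL => /eqP->.
    by rewrite m_unitaryP.
  case: (m0.1.1) r1 => [[p q] r] r1 v0.
  have E j : mxF n 0 j = rowF (v_normal (p, q, r)) 0 j by rewrite -r1 mxE.
  have mulV u : u != k0 -> phi (k_mul (k_inv u) u) = 1.
    by move=> u0; rewrite phiM // phiV // mulVf // phi_neq0.
  have [p0|p0] := eqVneq p k0; last by exists 0; rewrite E /= p0 mxE /= mulV.
  have [q0|q0] := eqVneq q k0; last by exists 1; rewrite E /= p0 q0 mxE /= mulV.
  have [r0|r0] := eqVneq r k0; first by rewrite p0 q0 r0 eqxx in v0.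
  by exists 2%:R; rewrite E /= p0 q0 r0 mxE /= mulV.
have rn : m_real n.
  apply/eqP/(mxF_inj _ _ F25 alpha2); rewrite mxF_conj //.
  have [t ht] : exists t, map_mx (@conj5 F) (mxF n) = t *: mxF n.
    exists (frob e * (d / s) / e); rewrite he conj5_mx map_mxZ -conj5_mx conj_m0 !scalerA.
    by rewrite mulfVK.
  (* Comparing the entry equal to 1 with its conjugate shows that the factor [t] is 1. *)
  have [j hj] := lead1; have := ht => /matrixP/(_ 0 j).
  rewrite !mxE hj mulr1 conj5E rmorph1 => t1.
  by rewrite ht -t1 scale1r.
have hn : mxF n *m (mxF n)^T = (e ^+ 2 * s)%:M.
  have /mulmx1C : (s^-1 *: (mxF m0)^T) *m mxF m0 = 1%:M.
    by rewrite -scalemxAl h1 scale_scalar_mx mulVf.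
  rewrite -scalemxAr => /(congr1 ( *:%R s)); rewrite scalerA divff // scale1r => h2.
  rewrite he [(_ *: _)^T]linearZ /= -scalemxAl -scalemxAr h2 scalerA scalemx1 scale_scalar_mx.
  by rewrite expr2.
have [z hz] := phi_surj _ _ F25 alpha2 (e ^+ 2 * s).
have [x hx] := phi_surj _ _ F25 alpha2 (\det (mxF n)).
have nc : map_mx frob (mxF n) = mxF n by rewrite -conj5_mx -mxF_conj // (eqP rn).
have phi_real u : frob (phi u) = phi u -> u \in real_k.
  by rewrite -conj5E phi_conj // => /(phi_inj _ _ F25 alpha2)/real_kP.
have xr : x \in real_k by apply: phi_real; rewrite -hx -det_map_mx nc.
have zr : z \in real_k.
  apply: phi_real; rewrite -hz.
  have /(congr1 (fun A : 'M_3 => map_mx frob A 0 0)) := hn.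
  by rewrite map_mxM -map_trmx nc hn !mxE eqxx !mulr1n.
(* Taking determinants of [hn] gives x^2 = z^3. The exponent 3 is odd, so [z] is a square in F_5 and
   the factor [t] below can be taken real. *)
have xz : k_mul x x = k_mul z (k_mul z z).
  apply: (phi_inj _ _ F25 alpha2); rewrite !phiM // -hx -hz.
  have /(congr1 determinant) := hn; rewrite det_mulmx det_tr det_scalar => ->.
  by rewrite exprS [in LHS]expr2.
have z0 : z != k0.
  apply/eqP=> z0; have : e ^+ 2 * s != 0 by rewrite mulf_neq0 ?expf_neq0.
  by rewrite hz z0 phi0 eqxx.
have [t tr tz] : exists2 t, t \in real_k & k_mul (k_mul t t) z = k1.
  have : all (fun x => all (fun z => (k_mul x x == k_mul z (k_mul z z)) && (z != k0) ==>
     has (fun t => k_mul (k_mul t t) z == k1) real_k) real_k) real_k by vm_compute.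
  by move/allP/(_ x xr)/allP/(_ z zr); rewrite xz eqxx z0 => /hasP[t ? /eqP]; exists t.
have t0 : t != k0 by apply/eqP=> t0; move: tz; rewrite t0; case: (z) => [[] []].
have tc : k_conj t = t by have := allP (isT : all (fun t => k_conj t == t) real_k) t tr => /eqP.
have un : m_unitary (m_scale t n).
  rewrite (m_unitaryE _ _ F25 alpha2) mxFZ // map_mxZ nc [(_ *: _)^T]linearZ /= -scalemxAl -scalemxAr hn hz.
  by rewrite !scale_scalar_mx -conj5E phi_conj // tc mulrA -!phiM // tz phi1.
exists (m_scale t n).
  apply/eqP/(mxF_inj _ _ F25 alpha2).
  rewrite mxF_conj // (conj5_mx _ F25) (mxFZ _ _ F25 alpha2 t n) map_mxZ nc.
  have ft : frob (phi t) = phi t by rewrite -conj5E phi_conj // tc.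
  by congr (_ *: _).
split=> //; apply: (proj_GLof _ _ _ _ (phi t * e)^-1) => //.
  by rewrite invr_eq0 mulf_neq0 // phi_neq0.
by rewrite (mxFZ _ _ F25 alpha2 t n) he !scalerA -mulrA mulVf ?scale1r // mulf_neq0 // phi_neq0.
Qed.

Lemma Delta_gen : Delta F = letters_gen (iota 1 4).
Proof.
apply/setP => g; apply/idP/idP => [/Delta_lift[m rm [um ->]]|].
  exact: real_unitary_gen.
case/letters_genP => w /sub_in_D wD ->.
have uw := ev_unitary _ _ F25 alpha2 w.
rewrite inE; apply/andP; split; first by apply/(PGU3P _ _ F25 alpha2); exists (ev w); rewrite ?Pw_GLof.
rewrite (Pw_GLof _ _ F25 alpha2); apply: mem_morphim; first exact: scalGL_norm.
rewrite inE GLofK ?m_unitary_unit //.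
have {2}<- : m_conj (ev w) = ev w by exact/eqP/ev_real.
by rewrite mxF_conj // m_unitary_scalar.
Qed.

End RealOrthogonal.

(** * The 150 conjugates of Gamma *)

(* The permutations of the 150 cosets of Gamma induced by right multiplication by
   the letters 0, ..., 5.  Coset 0 is Gamma; the cosets 1, ..., 7 are the seven
   points of the natural action of A_7. *)
Definition act_table : seq (seq nat) :=
  [:: [:: 0; 6; 2; 3; 4; 5; 7; 1; 9; 11; 13; 8; 10; 12; 19; 17; 21; 18; 15; 20; 14; 22; 16; 24;
    26; 28; 23; 25; 27; 34; 31; 33; 35; 30; 37; 36; 32; 29; 59; 61; 63; 40; 64; 66; 43;
    67; 45; 47; 68; 70; 49; 71; 51; 53; 72; 54; 56; 57; 58; 60; 38; 62; 39; 41; 65; 42;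
    44; 46; 69; 48; 50; 52; 55; 94; 96; 98; 75; 99; 101; 78; 102; 80; 82; 103; 105; 84;
    106; 86; 88; 107; 89; 91; 92; 93; 95; 73; 97; 74; 76; 100; 77; 79; 81; 104; 83; 85;
    87; 90; 109; 112; 115; 118; 108; 121; 111; 123; 127; 130; 114; 131; 122; 126; 132;
    110; 117; 116; 113; 125; 139; 136; 124; 142; 120; 145; 144; 134; 138; 147; 129; 140;
    128; 137; 119; 133; 135; 143; 148; 141; 149; 146];
  [:: 0; 2; 1; 3; 4; 5; 7; 6; 8; 9; 14; 11; 16; 18; 10; 20; 12; 21; 13; 22; 15; 17; 19; 23;
    24; 29; 26; 31; 32; 25; 34; 27; 28; 36; 30; 37; 33; 35; 38; 39; 41; 40; 42; 44; 43;
    46; 45; 47; 58; 60; 59; 62; 61; 63; 65; 64; 66; 67; 48; 50; 49; 52; 51; 53; 55; 54;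
    56; 57; 69; 68; 70; 71; 72; 73; 74; 76; 75; 77; 79; 78; 81; 80; 82; 93; 95; 94; 97;
    96; 98; 100; 99; 101; 102; 83; 85; 84; 87; 86; 88; 90; 89; 91; 92; 104; 103; 105;
    106; 107; 110; 113; 108; 119; 117; 109; 114; 124; 128; 112; 131; 111; 133; 123; 122;
    121; 115; 137; 130; 138; 116; 140; 126; 118; 143; 120; 146; 135; 147; 125; 127; 141;
    129; 139; 142; 132; 148; 145; 134; 136; 144; 149];
  [:: 0; 1; 3; 2; 4; 5; 7; 6; 10; 12; 8; 13; 9; 11; 14; 17; 16; 15; 18; 20; 19; 22; 21; 25;
    27; 23; 28; 24; 26; 29; 33; 31; 32; 30; 37; 36; 35; 34; 38; 39; 41; 40; 48; 50; 49;
    52; 51; 53; 42; 44; 43; 46; 45; 47; 55; 54; 56; 57; 58; 60; 59; 62; 61; 63; 69; 68;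
    70; 71; 65; 64; 66; 67; 72; 73; 74; 76; 75; 83; 85; 84; 87; 86; 88; 77; 79; 78; 81;
    80; 82; 90; 89; 91; 92; 93; 95; 94; 97; 96; 98; 104; 103; 105; 106; 100; 99; 101;
    102; 107; 111; 114; 116; 108; 118; 113; 109; 125; 110; 129; 112; 128; 122; 126; 120;
    127; 136; 115; 121; 123; 119; 117; 138; 140; 132; 133; 135; 134; 124; 147; 130; 142;
    131; 141; 139; 145; 144; 143; 146; 137; 149; 148];
  [:: 0; 1; 2; 4; 3; 5; 7; 6; 9; 8; 15; 11; 17; 18; 20; 10; 21; 12; 13; 19; 14; 16; 22; 26;
    24; 30; 23; 31; 33; 34; 25; 27; 36; 28; 29; 35; 32; 37; 38; 42; 44; 43; 39; 41; 40;
    46; 45; 47; 48; 50; 49; 55; 54; 56; 52; 51; 53; 57; 58; 60; 59; 65; 64; 66; 62; 61;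
    63; 67; 69; 68; 70; 72; 71; 73; 77; 79; 78; 74; 76; 75; 81; 80; 82; 83; 85; 84; 90;
    89; 91; 87; 86; 88; 92; 93; 95; 94; 100; 99; 101; 97; 96; 98; 102; 104; 103; 105;
    107; 106; 109; 108; 113; 120; 112; 110; 122; 126; 116; 117; 132; 133; 111; 123; 114;
    121; 130; 127; 115; 125; 128; 141; 124; 143; 118; 119; 144; 135; 147; 138; 137; 140;
    139; 129; 145; 131; 134; 142; 148; 136; 146; 149];
  [:: 0; 1; 2; 3; 5; 4; 7; 6; 11; 9; 13; 8; 12; 10; 18; 20; 16; 19; 14; 17; 15; 22; 21; 24;
    23; 27; 26; 25; 28; 31; 34; 29; 32; 37; 30; 36; 35; 33; 39; 38; 41; 40; 42; 46; 45;
    44; 43; 47; 48; 52; 51; 50; 49; 53; 55; 54; 57; 56; 58; 62; 61; 60; 59; 63; 65; 64;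
    67; 66; 69; 68; 71; 70; 72; 74; 73; 76; 75; 77; 81; 80; 79; 78; 82; 83; 87; 86; 85;
    84; 88; 90; 89; 92; 91; 93; 97; 96; 95; 94; 98; 100; 99; 102; 101; 104; 103; 106;
    105; 107; 112; 109; 117; 118; 108; 113; 114; 124; 129; 110; 111; 131; 134; 126; 135;
    130; 115; 136; 121; 138; 140; 116; 123; 119; 144; 146; 120; 122; 125; 147; 127; 139;
    128; 141; 142; 148; 132; 149; 133; 137; 143; 145];
  [:: 58; 21; 47; 53; 56; 57; 22; 16; 83; 103; 100; 104; 99; 77; 94; 97; 35; 74; 96; 95;
    73; 36; 32; 108; 109; 114; 112; 118; 111; 135; 132; 120; 6; 122; 134; 7; 1; 144; 34;
    33; 107; 89; 27; 86; 87; 85; 105; 82; 23; 81; 102; 78; 79; 88; 98; 75; 91; 92; 93;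
    37; 29; 30; 31; 90; 25; 28; 106; 84; 24; 26; 80; 101; 76; 148; 145; 113; 126; 119;
    123; 115; 130; 117; 2; 140; 127; 116; 138; 136; 3; 141; 147; 4; 5; 0; 149; 146; 143;
    133; 121; 131; 142; 110; 124; 128; 139; 125; 129; 137; 48; 68; 71; 65; 69; 55; 64;
    52; 45; 49; 42; 13; 62; 54; 39; 51; 50; 46; 72; 67; 9; 66; 70; 12; 61; 15; 38; 60;
    44; 40; 43; 11; 8; 41; 10; 18; 59; 17; 19; 63; 20; 14]]%N.

(** One word for each orbit of Gamma, carrying coset 0 to the representative of that orbit. *)
Definition rep_words : seq (seq nat) :=
  [:: [::]; [:: 5; 1; 2; 3; 5; 1; 5]; [:: 5; 5; 1; 5; 5]; [:: 5; 1; 5]; [:: 5; 1; 2; 3; 4];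
    [:: 5; 5; 1; 2; 3; 4]; [:: 5; 1; 5; 5]]%N.

(** Words in the letters of Gamma that carry the representative of an orbit to each of its members,
    listed by coset number. *)
Definition orbit_words : seq (seq nat) :=
  [:: [::]; [::]; [:: 1]; [:: 1; 2]; [:: 1; 2; 3]; [:: 1; 2; 3; 4]; [:: 0]; [:: 0; 0];
    [::]; [:: 0]; [:: 2]; [:: 4]; [:: 0; 2]; [:: 2; 0]; [:: 2; 1]; [:: 2; 3];
    [:: 0; 2; 1]; [:: 0; 2; 3]; [:: 2; 0; 1]; [:: 2; 1; 0]; [:: 2; 1; 3];
    [:: 0; 2; 1; 0]; [:: 2; 1; 0; 1]; [::]; [:: 0]; [:: 2]; [:: 3]; [:: 0; 2]; [:: 2; 0];
    [:: 2; 1]; [:: 2; 3]; [:: 0; 2; 1]; [:: 2; 0; 1]; [:: 2; 0; 3]; [:: 2; 1; 0];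
    [:: 2; 0; 1; 0]; [:: 2; 0; 1; 3]; [:: 2; 0; 3; 4]; [::]; [:: 4]; [:: 0; 0; 1; 2; 3];
    [:: 0; 1; 2; 3]; [:: 4; 3]; [:: 0; 1; 2]; [:: 0; 0; 1; 2]; [:: 4; 0; 1; 2];
    [:: 0; 1; 2; 4]; [:: 0; 1; 2; 0; 1; 3; 2]; [:: 4; 3; 2]; [:: 0; 0; 1]; [:: 0; 1];
    [:: 0; 1; 4]; [:: 4; 0; 1]; [:: 0; 1; 2; 0; 1; 3]; [:: 4; 0; 1; 3]; [:: 0; 1; 4; 3];
    [:: 0; 1; 2; 0; 1]; [:: 0; 1; 2; 0; 1; 4]; [:: 4; 3; 2; 1]; [:: 0]; [:: 0; 0];
    [:: 4; 0]; [:: 0; 4]; [:: 0; 1; 2; 0; 3]; [:: 0; 4; 3]; [:: 4; 0; 3];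
    [:: 0; 1; 2; 0]; [:: 0; 1; 2; 0; 4]; [:: 4; 0; 3; 2]; [:: 0; 4; 3; 2];
    [:: 0; 0; 1; 0]; [:: 0; 1; 4; 0]; [:: 0; 1; 4; 0; 3]; [::]; [:: 4];
    [:: 0; 0; 1; 2; 3]; [:: 0; 1; 2; 3]; [:: 4; 3]; [:: 0; 1; 2]; [:: 0; 0; 1; 2];
    [:: 4; 0; 1; 2]; [:: 0; 1; 2; 4]; [:: 0; 1; 2; 0; 1; 3; 2]; [:: 4; 3; 2];
    [:: 0; 0; 1]; [:: 0; 1]; [:: 0; 1; 4]; [:: 4; 0; 1]; [:: 0; 1; 2; 0; 1; 3];
    [:: 4; 0; 1; 3]; [:: 0; 1; 4; 3]; [:: 0; 1; 2; 0; 1]; [:: 0; 1; 2; 0; 1; 4];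
    [:: 4; 3; 2; 1]; [:: 0]; [:: 0; 0]; [:: 4; 0]; [:: 0; 4]; [:: 0; 1; 2; 0; 3];
    [:: 0; 4; 3]; [:: 4; 0; 3]; [:: 0; 1; 2; 0]; [:: 0; 1; 2; 0; 4]; [:: 4; 0; 3; 2];
    [:: 0; 4; 3; 2]; [:: 0; 0; 1; 0]; [:: 0; 1; 4; 0]; [:: 0; 1; 4; 0; 3]; [::]; [:: 0];
    [:: 1]; [:: 2]; [:: 4]; [:: 0; 1]; [:: 0; 2]; [:: 1; 0]; [:: 1; 2]; [:: 1; 4];
    [:: 2; 0]; [:: 2; 1]; [:: 2; 3]; [:: 0; 1; 0]; [:: 0; 2; 3]; [:: 1; 0; 0];
    [:: 1; 0; 1]; [:: 1; 0; 2]; [:: 1; 0; 3]; [:: 1; 2; 0]; [:: 1; 2; 1]; [:: 1; 2; 4];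
    [:: 1; 4; 0]; [:: 2; 0; 1]; [:: 2; 0; 3]; [:: 2; 1; 3]; [:: 2; 3; 4];
    [:: 0; 2; 3; 4]; [:: 1; 0; 1; 2]; [:: 1; 0; 2; 1]; [:: 1; 2; 0; 1]; [:: 1; 2; 1; 0];
    [:: 1; 2; 1; 4]; [:: 1; 2; 4; 3]; [:: 2; 0; 1; 0]; [:: 2; 0; 1; 3]; [:: 2; 0; 3; 4];
    [:: 2; 1; 3; 0]; [:: 2; 1; 3; 4]; [:: 1; 0; 1; 2; 1]; [:: 2; 0; 1; 3; 4];
    [:: 2; 1; 3; 0; 4]]%N.

Definition chain_words : seq (seq (seq nat)) :=
  [:: [:: [::]; [:: 1]; [:: 1; 2]; [:: 1; 2; 3]; [:: 1; 2; 3; 4]; [:: 0]; [:: 0; 0]];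
  [:: [::]; [:: 2]; [:: 2; 3]; [:: 2; 3; 4]; [:: 0; 1; 0]; [:: 1; 0; 1]];
  [:: [::]; [:: 3]; [:: 3; 4]; [:: 0; 1; 2; 1; 0]; [:: 2; 0; 1; 0; 2]];
  [:: [::]; [:: 4]; [:: 0; 1; 2; 3; 2; 1; 0]; [:: 3; 0; 1; 2; 1; 0; 3]];
  [:: [::]; [:: 0; 1; 2; 3; 4; 3; 2; 1; 0]; [:: 4; 0; 1; 2; 3; 2; 1; 0; 4]]]%N.

(* If the coset i is moved to j by the letter s, the element of Gamma that carries
   the representative of j to the one of i followed by s is written as a product of
   chain words; the entry lists the index of the word at each level of the chain. *)
Definition coset_digits : seq (seq (seq nat)) :=
  [:: [:: [:: 5]; [::]; [:: 2; 3; 4]; [:: 5; 2; 4; 1; 2]; [:: 2; 3; 4]; [:: 5; 2; 4; 1; 2];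
    [::]; [::]; [::]; [:: 6; 0; 0; 1]; [::]; [:: 6; 0; 0; 1]; [::]; [::]; [::]; [::];
    [::]; [:: 2; 3; 0; 1]; [:: 2; 3; 0; 1]; [:: 2; 3; 0; 1]; [:: 2; 3; 0; 1]; [::]; [::];
    [::]; [:: 6; 0; 1]; [::]; [:: 6; 0; 1]; [::]; [::]; [::]; [:: 2; 3; 0; 1];
    [:: 2; 3; 0; 1]; [::]; [::]; [:: 5; 3; 3; 3]; [:: 2; 3; 0; 1]; [:: 2; 3; 0; 1];
    [:: 2; 2; 3; 1]; [::]; [::]; [:: 5; 1]; [:: 5; 1]; [::]; [::]; [:: 5; 1]; [:: 5; 1];
    [:: 5; 1]; [:: 6; 1; 1]; [::]; [::]; [:: 5; 1]; [::]; [:: 5; 1]; [:: 5; 2];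
    [:: 5; 1]; [:: 5; 1]; [:: 6; 1; 1]; [:: 5; 2]; [:: 5]; [::]; [::]; [::]; [::]; [::];
    [::]; [::]; [:: 5; 1]; [::]; [::]; [::]; [:: 5; 1]; [:: 5; 1]; [::]; [::]; [::];
    [:: 6; 1]; [:: 6; 1]; [::]; [::]; [:: 6; 1]; [:: 6; 1]; [:: 6; 1]; [:: 5; 1; 1];
    [::]; [::]; [:: 6; 1]; [::]; [:: 6; 1]; [:: 6; 2]; [:: 6; 1]; [:: 6; 1];
    [:: 5; 1; 1]; [:: 6; 2]; [:: 5]; [::]; [::]; [::]; [::]; [::]; [::]; [::]; [:: 6; 1];
    [::]; [::]; [::]; [:: 6; 1]; [:: 6; 1]; [::]; [::]; [:: 5; 0; 0; 1]; [::]; [::];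
    [:: 5; 0; 0; 1]; [::]; [::]; [::]; [::]; [::]; [::]; [:: 0; 0; 4; 1]; [::];
    [:: 6; 0; 1]; [::]; [::]; [:: 5; 0; 0; 1]; [::]; [:: 6; 0; 1]; [::]; [::];
    [:: 5; 0; 0; 1]; [:: 5; 0; 0; 1]; [::]; [::]; [::]; [::]; [::]; [:: 0; 0; 4; 1];
    [:: 0; 0; 4; 1]; [:: 5; 0; 3]; [:: 5; 0; 3]; [:: 5; 0; 3]; [:: 5; 0; 3; 2; 1];
    [:: 0; 0; 4; 1]; [:: 0; 0; 4; 1]; [::]; [:: 0; 0; 4; 1]; [:: 0; 0; 4; 1];
    [:: 3; 1; 1; 2; 1]; [:: 0; 0; 4; 1]; [::]];
  [:: [:: 1]; [::]; [::]; [:: 0; 4; 1]; [:: 0; 4; 1]; [:: 0; 4; 1]; [:: 5; 2; 4; 1; 2];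
    [:: 2; 3; 4]; [:: 0; 0; 3; 0; 1]; [:: 3; 1; 1; 0; 1]; [::]; [:: 0; 0; 3; 0; 1]; [::];
    [::]; [::]; [::]; [::]; [:: 2; 3; 0; 1]; [::]; [::]; [::]; [:: 2; 3; 0; 1]; [::];
    [:: 0; 0; 4; 0; 2]; [:: 3; 1; 4; 2]; [::]; [:: 0; 0; 4; 0; 2]; [::]; [::]; [::];
    [:: 2; 3; 0; 1]; [::]; [::]; [::]; [:: 2; 3; 0; 1]; [:: 5; 3; 3; 3]; [::];
    [:: 2; 2; 3; 1]; [:: 5; 1]; [:: 5; 1]; [:: 6; 0; 1]; [:: 6; 0; 1]; [:: 5; 1];
    [:: 6; 0; 1]; [:: 6; 0; 1]; [:: 6; 0; 1]; [:: 6; 0; 1]; [:: 0; 1; 0; 1]; [::]; [::];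
    [::]; [::]; [::]; [::]; [::]; [::]; [::]; [::]; [::]; [::]; [::]; [::]; [::]; [::];
    [::]; [::]; [::]; [::]; [:: 6]; [:: 5]; [:: 5; 1]; [:: 5; 1]; [:: 5; 1]; [:: 6; 1];
    [:: 6; 1]; [:: 5; 0; 1]; [:: 5; 0; 1]; [:: 6; 1]; [:: 5; 0; 1]; [:: 5; 0; 1];
    [:: 5; 0; 1]; [:: 5; 0; 1]; [:: 0; 1; 0; 1]; [::]; [::]; [::]; [::]; [::]; [::];
    [::]; [::]; [::]; [::]; [::]; [::]; [::]; [::]; [::]; [::]; [::]; [::]; [::]; [::];
    [:: 6]; [:: 5]; [:: 6; 1]; [:: 6; 1]; [:: 6; 1]; [::]; [::]; [::]; [::]; [::]; [::];
    [:: 0; 0; 4; 1]; [::]; [::]; [::]; [::]; [::]; [::]; [::]; [:: 0; 0; 4; 1]; [::];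
    [::]; [::]; [:: 6; 0; 2]; [::]; [::]; [::]; [:: 5; 0; 1; 1]; [::]; [::]; [::]; [::];
    [:: 0; 0; 4; 1]; [::]; [::]; [::]; [:: 3; 1; 2; 2; 1]; [::]; [:: 5; 0; 3; 2; 1];
    [:: 0; 0; 4; 1]; [::]; [::]; [:: 0; 0; 4; 1]; [::]; [::]; [::]; [:: 0; 0; 4; 1]];
  [:: [:: 0; 1]; [:: 0; 4; 1]; [::]; [::]; [:: 2; 3; 0; 1]; [:: 2; 3; 0; 1]; [:: 0; 4; 1];
    [:: 0; 4; 1]; [::]; [::]; [::]; [:: 6; 0; 0; 1]; [::]; [:: 6; 0; 0; 1];
    [:: 0; 0; 3; 0; 1]; [:: 5; 0; 1]; [:: 3; 1; 1; 0; 1]; [:: 5; 0; 1]; [:: 3; 1; 3; 3];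
    [:: 2; 3; 4; 1; 1]; [:: 5; 4; 3; 0; 1]; [:: 3; 1; 1; 0; 1]; [:: 3; 1; 1; 0; 1]; [::];
    [::]; [::]; [:: 6; 0; 1]; [::]; [:: 6; 0; 1]; [:: 0; 0; 4; 0; 2]; [:: 6; 0; 1];
    [:: 3; 1; 4; 2]; [:: 3; 1; 1; 0; 2]; [:: 6; 0; 1]; [:: 5; 3; 4; 2; 2];
    [:: 3; 3; 0; 1; 2]; [:: 2; 4; 1; 2; 2]; [:: 6; 2; 2; 3; 1]; [:: 6; 0; 1];
    [:: 6; 0; 1]; [:: 5; 0; 0; 1]; [:: 5; 0; 0; 1]; [::]; [::]; [::]; [::]; [::]; [::];
    [::]; [::]; [::]; [::]; [::]; [::]; [:: 6]; [:: 5]; [:: 5; 1]; [:: 5; 1]; [:: 5; 1];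
    [:: 6; 0; 1]; [:: 6; 0; 1]; [:: 6; 0; 1]; [:: 6; 0; 1]; [:: 0; 1; 0; 1]; [::]; [::];
    [:: 5; 1]; [::]; [::]; [::]; [:: 5; 1]; [::]; [:: 0; 1]; [:: 5; 0; 1]; [:: 5; 0; 1];
    [:: 6; 0; 0; 1]; [:: 6; 0; 0; 1]; [::]; [::]; [::]; [::]; [::]; [::]; [::]; [::];
    [::]; [::]; [::]; [::]; [:: 6]; [:: 5]; [:: 6; 1]; [:: 6; 1]; [:: 6; 1];
    [:: 5; 0; 1]; [:: 5; 0; 1]; [:: 5; 0; 1]; [:: 5; 0; 1]; [:: 0; 1; 0; 1]; [::]; [::];
    [:: 6; 1]; [::]; [::]; [::]; [:: 6; 1]; [::]; [:: 5; 1]; [::]; [::]; [::]; [::];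
    [:: 5; 0; 0; 1]; [:: 0; 0; 4; 1]; [::]; [::]; [::]; [::]; [:: 5; 0; 0; 1]; [::];
    [:: 6; 0; 1]; [:: 6; 0; 3; 1; 1]; [:: 6; 0; 1]; [::]; [::]; [::]; [:: 2; 1; 2; 2];
    [::]; [::]; [::]; [:: 5; 0; 3]; [:: 5; 0; 0; 1]; [:: 6; 0; 1]; [:: 3; 1; 2];
    [:: 6; 0; 1]; [:: 6; 0; 1]; [::]; [::]; [:: 5; 0; 3]; [:: 0; 0; 4; 1];
    [:: 5; 0; 0; 1]; [:: 0; 0; 2; 1]; [:: 0; 0; 4; 1]; [:: 3; 1; 4; 0; 1]; [:: 6; 0; 1];
    [:: 4; 1; 2; 0; 1]; [:: 3; 1; 2]; [::]; [:: 3; 1; 4; 0; 1]; [:: 4; 1; 2; 0; 1]];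
  [:: [:: 0; 0; 1]; [:: 2; 3; 0; 1]; [:: 2; 3; 0; 1]; [::]; [::]; [:: 0; 2; 3; 3];
    [:: 2; 3; 0; 1]; [:: 2; 3; 0; 1]; [:: 5; 0; 1]; [:: 5; 0; 1]; [::]; [:: 0; 0; 2; 1];
    [::]; [:: 2; 3; 0; 1]; [::]; [::]; [:: 2; 3; 0; 1]; [::]; [:: 2; 3; 0; 1];
    [:: 2; 3; 0; 1]; [::]; [:: 2; 3; 0; 1]; [:: 2; 3; 0; 1]; [::]; [:: 6; 0; 1]; [::];
    [::]; [:: 2; 3; 0; 1]; [::]; [:: 2; 3; 0; 1]; [::]; [:: 2; 3; 0; 1]; [::]; [::];
    [:: 2; 3; 0; 1]; [:: 2; 3; 0; 1]; [::]; [:: 5; 0; 0; 1]; [:: 5; 0; 0; 1]; [::]; [::];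
    [::]; [::]; [::]; [::]; [:: 6]; [:: 5]; [:: 5; 1]; [:: 6; 0; 1]; [:: 5; 0; 0; 1];
    [:: 5; 0; 0; 1]; [::]; [::]; [::]; [::]; [::]; [::]; [:: 0; 1]; [:: 6; 0; 1];
    [:: 5; 0; 0; 1]; [:: 5; 0; 0; 1]; [::]; [::]; [::]; [::]; [::]; [::]; [:: 0; 1];
    [:: 6; 0; 1]; [:: 6; 0; 1]; [:: 0; 1; 0; 1]; [::]; [::]; [:: 6; 0; 0; 1]; [::]; [::];
    [::]; [::]; [::]; [::]; [:: 6]; [:: 5]; [:: 6; 1]; [:: 5; 0; 1]; [:: 6; 0; 0; 1];
    [:: 6; 0; 0; 1]; [::]; [::]; [::]; [::]; [::]; [::]; [:: 5; 1]; [:: 5; 0; 1];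
    [:: 6; 0; 0; 1]; [:: 6; 0; 0; 1]; [::]; [::]; [::]; [::]; [::]; [::]; [:: 5; 1];
    [:: 5; 0; 1]; [:: 5; 0; 1]; [:: 0; 1; 0; 1]; [::]; [::]; [:: 6; 0; 1]; [:: 6; 0; 1];
    [:: 6; 0; 1]; [::]; [:: 0; 0; 2; 1]; [:: 6; 0; 1]; [::]; [::]; [:: 3; 1; 2];
    [:: 0; 0; 2; 1]; [::]; [::]; [::]; [:: 6; 0; 1]; [::]; [:: 6; 0; 1]; [:: 6; 0; 2];
    [:: 3; 1; 2]; [::]; [:: 3; 1; 2]; [:: 3; 1; 2]; [::]; [:: 5; 0; 1; 1]; [::]; [::];
    [::]; [:: 5; 0; 0; 1]; [:: 5; 0; 0; 1]; [:: 4; 1; 1; 3; 1]; [:: 3; 1; 2];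
    [:: 3; 1; 2]; [:: 3; 1; 2; 2; 1]; [:: 5; 0; 3; 2; 1]; [::]; [:: 0; 0; 4; 1]; [::];
    [:: 5; 0; 0; 1]; [:: 0; 0; 4; 1]; [:: 5; 0; 0; 1]; [:: 4; 1; 1; 3; 1];
    [:: 5; 0; 0; 1]; [:: 5; 0; 3]];
  [:: [:: 0; 0; 0; 1]; [:: 0; 2; 3; 3]; [:: 0; 2; 3; 3]; [:: 0; 2; 3; 3]; [::]; [::];
    [:: 0; 2; 3; 3]; [:: 0; 2; 3; 3]; [::]; [:: 6; 0; 0; 1]; [:: 6; 0; 0; 1]; [::];
    [:: 6; 0; 0; 1]; [:: 6; 0; 0; 1]; [:: 6; 0; 0; 1]; [:: 0; 2; 4; 2]; [:: 6; 0; 0; 1];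
    [:: 2; 2; 4; 1]; [:: 6; 0; 0; 1]; [:: 6; 3; 4; 2]; [:: 0; 2; 4; 2]; [:: 6; 0; 0; 1];
    [:: 6; 0; 0; 1]; [:: 5; 0; 0; 1]; [:: 5; 0; 0; 1]; [:: 5; 0; 0; 1]; [:: 0; 0; 2; 1];
    [:: 5; 0; 0; 1]; [:: 5; 0; 0; 1]; [:: 5; 0; 0; 1]; [:: 2; 2; 3; 1]; [:: 5; 0; 0; 1];
    [:: 5; 0; 0; 1]; [::]; [:: 5; 3; 3; 3]; [:: 5; 3; 3; 3]; [:: 2; 2; 3; 1]; [::]; [::];
    [::]; [:: 6]; [:: 5]; [:: 5; 0; 0; 1]; [::]; [::]; [::]; [::]; [:: 0; 1];
    [:: 5; 0; 0; 1]; [::]; [::]; [::]; [::]; [:: 0; 1]; [:: 5; 0; 0; 1]; [:: 5; 0; 0; 1];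
    [::]; [::]; [:: 5; 0; 0; 1]; [::]; [::]; [::]; [::]; [:: 0; 1]; [:: 5; 0; 0; 1];
    [:: 5; 0; 0; 1]; [::]; [::]; [:: 5; 0; 0; 1]; [:: 5; 0; 0; 1]; [:: 5; 1]; [:: 5; 1];
    [:: 0; 1; 0; 1]; [::]; [::]; [:: 6]; [:: 5]; [:: 6; 0; 0; 1]; [::]; [::]; [::]; [::];
    [:: 5; 1]; [:: 6; 0; 0; 1]; [::]; [::]; [::]; [::]; [:: 5; 1]; [:: 6; 0; 0; 1];
    [:: 6; 0; 0; 1]; [::]; [::]; [:: 6; 0; 0; 1]; [::]; [::]; [::]; [::]; [:: 5; 1];
    [:: 6; 0; 0; 1]; [:: 6; 0; 0; 1]; [::]; [::]; [:: 6; 0; 0; 1]; [:: 6; 0; 0; 1];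
    [:: 6; 1]; [:: 6; 1]; [:: 0; 1; 0; 1]; [::]; [:: 5; 0; 0; 1]; [::]; [:: 5; 0; 0; 1];
    [::]; [:: 5; 0; 0; 1]; [:: 5; 0; 0; 1]; [:: 5; 0; 0; 1]; [::]; [::]; [:: 5; 0; 0; 1];
    [:: 5; 0; 0; 1]; [::]; [:: 5; 0; 1; 1]; [::]; [::]; [:: 5; 0; 0; 1]; [:: 5; 0; 0; 1];
    [:: 6; 0; 2]; [:: 5; 0; 3]; [::]; [::]; [::]; [:: 5; 0; 0; 1]; [::]; [::]; [::];
    [::]; [:: 5; 0; 0; 1]; [:: 5; 0; 0; 1]; [:: 5; 0; 3]; [:: 5; 0; 3]; [::];
    [:: 3; 1; 2]; [:: 5; 0; 3]; [::]; [::]; [::]; [::]; [:: 5; 0; 0; 1]; [::]; [::]];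
  [:: [::]; [:: 1; 0; 2; 2; 2]; [:: 6; 2; 4; 0; 1]; [:: 5; 0; 4; 0; 1]; [:: 0; 1; 3; 3; 1];
    [:: 6; 2; 4; 0; 1]; [:: 1; 0; 2; 2; 2]; [:: 1; 0; 2; 2; 2]; [::]; [::]; [::];
    [:: 6; 0; 0; 1]; [::]; [::]; [:: 6; 3; 4; 2]; [::]; [:: 4; 2; 1; 3; 1]; [::];
    [:: 2; 3; 0; 1]; [:: 6; 3; 4; 2]; [:: 0; 2; 4; 2]; [:: 1; 0; 2; 3; 1];
    [:: 4; 2; 1; 3; 1]; [::]; [::]; [::]; [:: 6; 0; 2]; [::]; [::]; [:: 5; 3; 3; 3];
    [::]; [:: 2; 3; 0; 1]; [:: 2; 3; 0; 1]; [::]; [:: 5; 3; 3; 3]; [:: 2; 3; 0; 1]; [::];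
    [::]; [:: 2; 2; 3; 1]; [::]; [:: 3; 2; 1; 0; 1]; [:: 0; 1; 0; 2; 1]; [::];
    [:: 6; 0; 0; 2; 1]; [:: 3; 1; 1; 2; 1]; [:: 3; 2; 1; 0; 1]; [:: 0; 1; 0; 2; 1];
    [:: 1; 5; 4; 3]; [::]; [:: 3; 2; 1; 0; 1]; [:: 6; 0; 0; 2; 1]; [:: 6; 0; 0; 2; 1];
    [:: 3; 1; 1; 2; 1]; [:: 2; 5; 3; 2]; [:: 3; 2; 1; 0; 1]; [:: 0; 1; 0; 2; 1];
    [:: 3; 0; 4; 3]; [:: 1; 5; 4; 3]; [::]; [::]; [:: 2; 2; 3; 1]; [::]; [:: 2; 3; 0; 1];
    [:: 6; 0; 0; 2; 1]; [::]; [::]; [:: 6; 0; 0; 2; 1]; [:: 0; 1; 0; 2; 1]; [::];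
    [:: 6; 0; 1]; [:: 3; 1; 1; 2; 1]; [:: 6; 0; 0; 2; 1]; [:: 6; 0; 0; 2; 1];
    [:: 0; 0; 1; 2; 2]; [:: 0; 0; 2; 0; 2]; [:: 1; 3; 2; 3]; [:: 5; 1; 2; 2];
    [:: 0; 0; 2; 0; 2]; [:: 5; 1; 2; 2]; [:: 1; 3; 1]; [:: 1; 3; 1]; [:: 5; 1; 2; 2];
    [:: 1; 5; 3; 3; 2]; [:: 5; 0; 2; 2; 2]; [:: 1; 3; 1]; [:: 5; 1; 2; 2];
    [:: 0; 5; 2; 3]; [:: 1; 2; 1; 2]; [:: 4; 0; 1; 3; 2]; [:: 1; 3; 1];
    [:: 4; 2; 4; 3; 2]; [:: 3; 2; 4; 2; 1]; [:: 1; 5; 3; 3; 2]; [::]; [:: 0; 0; 2; 0; 2];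
    [:: 0; 0; 2; 0; 2]; [:: 0; 0; 1; 2; 2]; [:: 0; 0; 2; 0; 2]; [:: 5; 2; 2; 2];
    [:: 0; 0; 1; 2; 2]; [:: 0; 0; 1; 2; 2]; [:: 5; 1; 2; 2]; [:: 0; 1; 1; 2];
    [:: 0; 0; 2; 0; 2]; [:: 0; 0; 2; 0; 2]; [:: 1; 3; 1]; [:: 5; 1; 2; 2];
    [:: 3; 4; 1; 3; 2]; [::]; [::]; [:: 5; 5; 3; 2; 1]; [::]; [:: 5; 0; 0; 1];
    [:: 4; 0; 4; 2; 2]; [::]; [:: 0; 4; 0; 2; 1]; [:: 0; 4; 0; 2; 1]; [:: 0; 4; 0; 2; 1];
    [::]; [:: 0; 0; 1; 3; 1]; [::]; [:: 4; 4; 3; 0; 2]; [::]; [:: 5; 5; 3; 2; 1];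
    [:: 3; 0; 0; 0; 1]; [:: 5; 5; 3; 2; 1]; [:: 5; 5; 3; 2; 1]; [:: 5; 5; 3; 2; 1];
    [:: 0; 0; 1; 3; 1]; [:: 5; 5; 3; 2; 1]; [:: 0; 4; 0; 2; 1]; [:: 0; 0; 2; 0; 1]; [::];
    [:: 0; 0; 1; 3; 1]; [::]; [::]; [:: 3; 5; 1; 0; 1]; [:: 6; 5; 3]; [:: 3; 0; 2; 2];
    [:: 6; 0; 2; 3; 1]; [:: 6; 0; 2; 3; 1]; [:: 5; 5; 3; 2; 1]; [:: 0; 0; 2; 0; 1];
    [:: 2; 3; 1; 0; 1]; [::]; [:: 0; 0; 1; 3; 1]; [:: 2; 2; 2; 2; 1]; [:: 6; 4; 4; 1];
    [:: 0; 2; 2; 3; 2]; [:: 2; 2; 2; 2; 1]]]%N.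

Definition center_codes : seq (seq nat * seq nat) :=
  [:: ([:: 1; 0; 3; 2; 4; 5; 6], [:: 1; 2; 3]); ([:: 1; 0; 4; 3; 2; 5; 6], [:: 1; 3; 4]);
    ([:: 1; 0; 5; 3; 4; 2; 6], [:: 1; 18; 8]);
    ([:: 1; 0; 6; 3; 4; 5; 2], [:: 1; 13; 23]); ([:: 1; 0; 2; 4; 3; 5; 6], [:: 1; 1; 2]);
    ([:: 1; 0; 2; 5; 4; 3; 6], [:: 1; 7; 17]);
    ([:: 1; 0; 2; 6; 4; 5; 3], [:: 1; 22; 12]);
    ([:: 1; 0; 2; 3; 5; 4; 6], [:: 1; 16; 19]);
    ([:: 1; 0; 2; 3; 6; 5; 4], [:: 1; 11; 14]); ([:: 1; 0; 2; 3; 4; 6; 5], [:: 1; 1; 4]);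
    ([:: 2; 3; 0; 1; 4; 5; 6], [:: 1; 3; 1]); ([:: 2; 4; 0; 3; 1; 5; 6], [:: 1; 2; 2]);
    ([:: 2; 5; 0; 3; 4; 1; 6], [:: 1; 18; 22]);
    ([:: 2; 6; 0; 3; 4; 5; 1], [:: 1; 13; 7]); ([:: 2; 1; 0; 4; 3; 5; 6], [:: 1; 1; 3]);
    ([:: 2; 1; 0; 5; 4; 3; 6], [:: 1; 16; 11]);
    ([:: 2; 1; 0; 6; 4; 5; 3], [:: 1; 11; 16]);
    ([:: 2; 1; 0; 3; 5; 4; 6], [:: 1; 7; 13]);
    ([:: 2; 1; 0; 3; 6; 5; 4], [:: 1; 22; 18]); ([:: 2; 1; 0; 3; 4; 6; 5], [:: 1; 1; 1]);
    ([:: 3; 2; 1; 0; 4; 5; 6], [:: 1; 4; 2]); ([:: 3; 4; 2; 0; 1; 5; 6], [:: 1; 3; 3]);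
    ([:: 3; 5; 2; 0; 4; 1; 6], [:: 1; 23; 17]);
    ([:: 3; 6; 2; 0; 4; 5; 1], [:: 1; 8; 12]); ([:: 3; 1; 4; 0; 2; 5; 6], [:: 1; 2; 4]);
    ([:: 3; 1; 5; 0; 4; 2; 6], [:: 1; 14; 19]);
    ([:: 3; 1; 6; 0; 4; 5; 2], [:: 1; 19; 14]);
    ([:: 3; 1; 2; 0; 5; 4; 6], [:: 1; 12; 8]);
    ([:: 3; 1; 2; 0; 6; 5; 4], [:: 1; 17; 23]); ([:: 3; 1; 2; 0; 4; 6; 5], [:: 1; 4; 4]);
    ([:: 4; 2; 1; 3; 0; 5; 6], [:: 1; 4; 3]); ([:: 4; 3; 2; 1; 0; 5; 6], [:: 1; 2; 1]);
    ([:: 4; 5; 2; 3; 0; 1; 6], [:: 1; 14; 11]);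
    ([:: 4; 6; 2; 3; 0; 5; 1], [:: 1; 19; 16]); ([:: 4; 1; 3; 2; 0; 5; 6], [:: 1; 3; 2]);
    ([:: 4; 1; 5; 3; 0; 2; 6], [:: 1; 23; 13]);
    ([:: 4; 1; 6; 3; 0; 5; 2], [:: 1; 8; 18]);
    ([:: 4; 1; 2; 5; 0; 3; 6], [:: 1; 12; 22]);
    ([:: 4; 1; 2; 6; 0; 5; 3], [:: 1; 17; 7]); ([:: 4; 1; 2; 3; 0; 6; 5], [:: 1; 4; 1]);
    ([:: 5; 2; 1; 3; 4; 0; 6], [:: 1; 12; 0]); ([:: 5; 3; 2; 1; 4; 0; 6], [:: 1; 0; 13]);
    ([:: 5; 4; 2; 3; 1; 0; 6], [:: 0; 1; 18]);
    ([:: 5; 6; 2; 3; 4; 0; 1], [:: 1; 12; 13]);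
    ([:: 5; 1; 3; 2; 4; 0; 6], [:: 0; 1; 12]); ([:: 5; 1; 4; 3; 2; 0; 6], [:: 1; 0; 17]);
    ([:: 5; 1; 6; 3; 4; 0; 2], [:: 1; 12; 17]);
    ([:: 5; 1; 2; 4; 3; 0; 6], [:: 1; 18; 0]);
    ([:: 5; 1; 2; 6; 4; 0; 3], [:: 1; 18; 13]);
    ([:: 5; 1; 2; 3; 6; 0; 4], [:: 1; 18; 17]);
    ([:: 6; 2; 1; 3; 4; 5; 0], [:: 1; 17; 0]); ([:: 6; 3; 2; 1; 4; 5; 0], [:: 1; 0; 18]);
    ([:: 6; 4; 2; 3; 1; 5; 0], [:: 0; 1; 13]);
    ([:: 6; 5; 2; 3; 4; 1; 0], [:: 1; 17; 18]);
    ([:: 6; 1; 3; 2; 4; 5; 0], [:: 0; 1; 17]); ([:: 6; 1; 4; 3; 2; 5; 0], [:: 1; 0; 12]);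
    ([:: 6; 1; 5; 3; 4; 2; 0], [:: 1; 17; 12]);
    ([:: 6; 1; 2; 4; 3; 5; 0], [:: 1; 13; 0]);
    ([:: 6; 1; 2; 5; 4; 3; 0], [:: 1; 13; 18]);
    ([:: 6; 1; 2; 3; 5; 4; 0], [:: 1; 13; 12]); ([:: 0; 2; 1; 4; 3; 5; 6], [:: 0; 0; 1]);
    ([:: 0; 2; 1; 5; 4; 3; 6], [:: 1; 13; 24]);
    ([:: 0; 2; 1; 6; 4; 5; 3], [:: 1; 18; 9]); ([:: 0; 2; 1; 3; 5; 4; 6], [:: 1; 13; 6]);
    ([:: 0; 2; 1; 3; 6; 5; 4], [:: 1; 18; 21]); ([:: 0; 2; 1; 3; 4; 6; 5], [:: 1; 1; 0]);
    ([:: 0; 3; 4; 1; 2; 5; 6], [:: 0; 1; 0]); ([:: 0; 3; 5; 1; 4; 2; 6], [:: 1; 21; 12]);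
    ([:: 0; 3; 6; 1; 4; 5; 2], [:: 1; 6; 17]); ([:: 0; 3; 2; 1; 5; 4; 6], [:: 1; 9; 12]);
    ([:: 0; 3; 2; 1; 6; 5; 4], [:: 1; 24; 17]); ([:: 0; 3; 2; 1; 4; 6; 5], [:: 1; 0; 4]);
    ([:: 0; 4; 3; 2; 1; 5; 6], [:: 1; 0; 0]); ([:: 0; 4; 5; 3; 1; 2; 6], [:: 1; 9; 24]);
    ([:: 0; 4; 6; 3; 1; 5; 2], [:: 1; 24; 9]); ([:: 0; 4; 2; 5; 1; 3; 6], [:: 1; 21; 6]);
    ([:: 0; 4; 2; 6; 1; 5; 3], [:: 1; 6; 21]); ([:: 0; 4; 2; 3; 1; 6; 5], [:: 0; 1; 4]);
    ([:: 0; 5; 3; 2; 4; 1; 6], [:: 1; 9; 6]); ([:: 0; 5; 4; 3; 2; 1; 6], [:: 1; 21; 18]);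
    ([:: 0; 5; 6; 3; 4; 1; 2], [:: 1; 4; 15]);
    ([:: 0; 5; 2; 4; 3; 1; 6], [:: 1; 17; 24]);
    ([:: 0; 5; 2; 6; 4; 1; 3], [:: 1; 15; 1]);
    ([:: 0; 5; 2; 3; 6; 1; 4], [:: 1; 20; 20]);
    ([:: 0; 6; 3; 2; 4; 5; 1], [:: 1; 24; 21]);
    ([:: 0; 6; 4; 3; 2; 5; 1], [:: 1; 6; 13]); ([:: 0; 6; 5; 3; 4; 2; 1], [:: 1; 4; 10]);
    ([:: 0; 6; 2; 4; 3; 5; 1], [:: 1; 12; 9]); ([:: 0; 6; 2; 5; 4; 3; 1], [:: 1; 10; 1]);
    ([:: 0; 6; 2; 3; 5; 4; 1], [:: 1; 5; 5]); ([:: 0; 1; 3; 2; 5; 4; 6], [:: 1; 21; 24]);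
    ([:: 0; 1; 3; 2; 6; 5; 4], [:: 1; 6; 9]); ([:: 0; 1; 3; 2; 4; 6; 5], [:: 0; 1; 1]);
    ([:: 0; 1; 4; 5; 2; 3; 6], [:: 1; 9; 18]);
    ([:: 0; 1; 4; 6; 2; 5; 3], [:: 1; 24; 13]); ([:: 0; 1; 4; 3; 2; 6; 5], [:: 1; 0; 1]);
    ([:: 0; 1; 5; 4; 3; 2; 6], [:: 1; 17; 6]); ([:: 0; 1; 5; 6; 4; 2; 3], [:: 1; 20; 5]);
    ([:: 0; 1; 5; 3; 6; 2; 4], [:: 1; 15; 4]);
    ([:: 0; 1; 6; 4; 3; 5; 2], [:: 1; 12; 21]);
    ([:: 0; 1; 6; 5; 4; 3; 2], [:: 1; 5; 20]); ([:: 0; 1; 6; 3; 5; 4; 2], [:: 1; 10; 4]);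
    ([:: 0; 1; 2; 4; 3; 6; 5], [:: 1; 4; 0]); ([:: 0; 1; 2; 5; 6; 3; 4], [:: 1; 1; 15]);
    ([:: 0; 1; 2; 6; 5; 4; 3], [:: 1; 1; 10])]%N.

(* The 150 cosets are numbered so that the orbits of Gamma are intervals. *)
Definition orbit_class (i : nat) : nat :=
  (if i == 0 then 0 else if i < 8 then 1 else if i < 23 then 2 else if i < 38 then 3 else
   if i < 73 then 4 else if i < 108 then 5 else 6)%N.
Definition orbit_rep (k : nat) : nat := nth 0%N [:: 0; 1; 8; 23; 38; 73; 108]%N k.
Definition orbit_card (k : nat) : nat := nth 0%N [:: 1; 7; 15; 15; 35; 35; 42]%N k.
Definition stab_card (k : nat) : nat := nth 0%N [:: 2520; 360; 168; 168; 72; 72; 60]%N k.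
(* Gamma preserves the three components of the graph, and diag (1, omega, 1) permutes
   them cyclically. *)
Definition component_of (i : nat) : nat := nth 0%N [:: 0; 0; 1; 2; 1; 2; 0]%N (orbit_class i).

Definition act (s i : nat) : nat := nth 0%N (nth [::] act_table s) i.
Definition acts (w : seq nat) (i : nat) : nat := foldl (fun j s => act s j) i w.
Definition rep_word (i : nat) : seq nat := nth [::] rep_words (orbit_class i).
Definition orbit_word (i : nat) : seq nat := nth [::] orbit_words i.
Definition coset_word (i : nat) : seq nat := rep_word i ++ orbit_word i.

Definition letters_below (n : nat) (w : seq nat) : bool := all (fun s => s < n)%N w.

Definition act_ok_at (s i : nat) : bool :=
  [&& (act s i < 150)%N, acts (s :: letter_inv s) i == i, acts (letter_inv s ++ [:: s]) i == i,
      component_of (act s i) == ((component_of i + (s == 5)) %% 3)%N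
    & (s < 5)%N ==> (orbit_class (act s i) == orbit_class i)].

Lemma act_ok : all (fun s => all (act_ok_at s) (iota 0 150)) (iota 0 6).
Proof. by vm_compute. Qed.

Definition word_ok_at (i : nat) : bool :=
  [&& letters_below 6 (coset_word i), letters_below 5 (orbit_word i),
      acts (orbit_word i) (orbit_rep (orbit_class i)) == i
    & acts (rep_word i) 0 == orbit_rep (orbit_class i)].

Lemma word_ok : all word_ok_at (iota 0 150).
Proof. by vm_compute. Qed.

(* [chain_words] lists transversals of the successive stabilizers of the
   points 0, 1, 2, 3, 4, so that every element of Gamma is a product of five
   of these words. *)
Definition chain_word (k x : nat) : seq nat := nth [::] (nth [::] chain_words k) x.
Definition digits_word (d : seq nat) : seq nat :=
  flatten [seq chain_word k (nth 0%N d k) | k <- [:: 4; 3; 2; 1; 0]%N].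

Lemma chain_words_ok : all (all (letters_below 5)) chain_words.
Proof. by vm_compute. Qed.

(** The matrix of [digits_word], computed from a table of evaluated chain words so that the 900
    checks of [cosets_ok] do not evaluate them again. *)
Definition digits_mat (mats : seq (seq mat3)) (d : seq nat) : mat3 :=
  if d is [::] then m_one else
  foldr (fun k => m_mul (nth m_one (nth [::] mats k) (nth 0%N d k))) m_one [:: 4; 3; 2; 1; 0]%N.

Definition coset_ok (mats : seq (seq mat3)) (reps : seq mat3) (s i : nat) : bool :=
  m_normal (m_mul (nth m_one reps i) (letter s)) ==
  m_normal (m_mul (digits_mat mats (nth [::] (nth [::] coset_digits s) i))
                  (nth m_one reps (act s i))).

Definition chain_mats : seq (seq mat3) := [seq [seq ev w | w <- ws] | ws <- chain_words].
Definition coset_mats : seq mat3 := [seq ev (coset_word i) | i <- iota 0 150].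

Lemma cosets_ok : all (fun s => all (coset_ok chain_mats coset_mats s) (iota 0 150)) (iota 0 6).
Proof. by vm_compute. Qed.

Definition vec_of (s : seq nat) : vec3 :=
  (k_of (nth 0%N s 0), k_of (nth 0%N s 1), k_of (nth 0%N s 2)).

(* The centres of the 105 reflections in Gamma, each with the permutation of
   the seven points induced by the reflection. *)
Definition centers : seq (seq nat * vec3) := [seq (e.1, vec_of e.2) | e <- center_codes].

Definition pact (w : seq nat) (x : nat) : nat := (acts w x.+1).-1.

(** For the right action, the conjugate of [p] by [w] sends the image of [x] to the image of
    [p x]. *)
Definition conjugates (w : seq nat) (p q : seq nat) : bool :=
  all (fun x => nth 0%N q (pact w x) == pact w (nth 0%N p x)) (iota 0 7).

Lemma centers_ok :
  all (fun s => all (fun e => has (fun e' =>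
    (v_normal (v_mul e.2 (letter s)) == e'.2) && conjugates [:: s] e.1 e'.1) centers) centers)
    (iota 0 5).
Proof. by vm_compute. Qed.

(** The last clause says that a centre is determined by the permutation of its reflection. This is
    what lets a trivial action on seven points fix every centre. *)
Lemma centers_normal : all (fun e => (v_normal e.2 == e.2) &&
  ((size e.1 == 7) && all (fun x => x < 7)%N e.1)%N) centers &&
  all (fun e => all (fun e' => (e.1 == e'.1) ==> (e == e')) centers) centers.
Proof. by vm_compute. Qed.

Lemma center_frame : all (fun v => has (fun e => e.2 == v) centers)
  [:: e1; e2; (k0, k0, k1); vec_of [:: 1; 1; 2]%N].
Proof. by vm_compute. Qed.

(* For each k, an element of Gamma whose conjugate by [rep_words k] moves a
   centre outside the set of centres. *)
Definition moved_centers : seq (nat * vec3) :=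
  [:: (0%N, e1); (0%N, (k0, k0, k1)); (0%N, e1); (0%N, e1); (1%N, e1); (1%N, e1); (0%N, e1)].

Lemma moved_centers_ok : all (fun k =>
  let: (s, v) := nth (0%N, e1) moved_centers k in
  let w := nth [::] rep_words k in
  let u := v_act v (word_inv w ++ s :: w) in
  [&& (s < 5)%N, has (fun e => e.2 == v) centers
    & all (fun e => v_cross u e.2 != (k0, k0, k0)) centers]) (iota 1 6).
Proof. by vm_compute. Qed.

Lemma acts_cat u v i : acts (u ++ v) i = acts v (acts u i).
Proof. by rewrite /acts foldl_cat. Qed.

Lemma act_okP s i : (s < 6)%N -> (i < 150)%N -> act_ok_at s i.
Proof. by move=> hs hi; apply: (allP (allP act_ok s _)); rewrite mem_iota. Qed.

Lemma word_okP i : (i < 150)%N -> word_ok_at i.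
Proof. by move=> hi; apply: (allP word_ok); rewrite mem_iota. Qed.

Lemma acts_lt w i : letters_below 6 w -> (i < 150)%N -> (acts w i < 150)%N.
Proof.
elim: w i => //= s w ih i /andP[hs hw] hi; apply: ih => //.
by have /and5P[] := act_okP s i hs hi.
Qed.

Lemma letters_below_inv n w : letters_below n w -> letters_below n (word_inv w).
Proof.
elim: w => //= s w ih /andP[hs hw]; rewrite /letters_below all_cat.
apply/andP; split; first exact: ih.
by rewrite /letter_inv; case: ifP => _ /=; rewrite !hs.
Qed.

Lemma letters_below_cat n u v : letters_below n u -> letters_below n v -> letters_below n (u ++ v).
Proof. by rewrite /letters_below all_cat => -> ->. Qed.

Lemma letters_below_leq m n w : (m <= n)%N -> letters_below m w -> letters_below n w.
Proof. by move=> mn /allP h; apply/allP=> s /h hs; exact: leq_trans mn. Qed.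

Lemma letters_belowP n w : reflect {subset w <= iota 0 n} (letters_below n w).
Proof.
by apply: (iffP allP) => h s /h; rewrite mem_iota.
Qed.

Lemma acts_invK w i : letters_below 6 w -> (i < 150)%N -> acts (word_inv w) (acts w i) = i.
Proof.
elim: w i => //= s w ih i /andP[hs hw] hi.
have /and5P[h1 /eqP h2 _ _ _] := act_okP s i hs hi.
by rewrite acts_cat ih.
Qed.

Lemma acts_Kinv w i : letters_below 6 w -> (i < 150)%N -> acts w (acts (word_inv w) i) = i.
Proof.
elim: w i => //= s w ih i /andP[hs hw] hi.
have h : (acts (word_inv w) i < 150)%N by rewrite acts_lt ?letters_below_inv.
have /and5P[h1 _ /eqP h2 _ _] := act_okP s _ hs h.
by rewrite acts_cat; rewrite acts_cat in h2; rewrite /= in h2; rewrite h2 ih.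
Qed.

Lemma coset_word_below i : (i < 150)%N -> letters_below 6 (coset_word i).
Proof. by case/word_okP/and4P. Qed.

Lemma acts_coset_word i : (i < 150)%N -> acts (coset_word i) 0 = i.
Proof. by case/word_okP/and4P => _ _ /eqP h /eqP h'; rewrite acts_cat h' h. Qed.

Lemma orbit_class_acts w i : letters_below 5 w -> (i < 150)%N ->
  orbit_class (acts w i) = orbit_class i.
Proof.
elim: w i => //= s w ih i /andP[hs hw] hi.
have /and5P[h1 _ _ _ /implyP h2] := act_okP s i (ltnW hs) hi.
by rewrite ih // (eqP (h2 hs)).
Qed.

Lemma rep_lt k : (orbit_rep k < 150)%N.
Proof. by case: k => [|[|[|[|[|[|[|k]]]]]]] //; rewrite /orbit_rep nth_default. Qed.

Lemma orbit_class_lt i : (orbit_class i < 7)%N.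
Proof. by rewrite /orbit_class; do !case: ifP. Qed.

Lemma orbit_class_rep k : (k < 7)%N -> orbit_class (orbit_rep k) = k.
Proof. by case: k => [|[|[|[|[|[|[|k]]]]]]]. Qed.

(** The source of all later reductions to one base point: a word moves [i] to 0, and then an element
    of Gamma, which fixes 0, moves the other index to its orbit representative. *)
Lemma pair_to_rep i j : (i < 150)%N -> (j < 150)%N ->
  exists2 w, letters_below 6 w & acts w i = 0%N /\ exists2 k, (k < 7)%N & acts w j = orbit_rep k.
Proof.
move=> hi hj; pose u := word_inv (coset_word i).
have hu : letters_below 6 u by rewrite letters_below_inv ?coset_word_below.
have hj' : (acts u j < 150)%N by exact: acts_lt.
pose v := word_inv (orbit_word (acts u j)).
have /and4P[_ hv /eqP e _] := word_okP _ hj'.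
have v5 : letters_below 5 v by rewrite letters_below_inv.
exists (u ++ v); first by rewrite letters_below_cat // (letters_below_leq 5).
have u0 : acts u i = 0%N.
  by have := acts_invK (coset_word i) 0 (coset_word_below _ hi) erefl; rewrite acts_coset_word.
(* Class 0 contains the index 0 only, and letters of Gamma preserve classes. *)
have v0 : acts v 0 = 0%N.
  have := orbit_class_acts _ 0 v5 erefl.
  have : (acts v 0 < 150)%N by rewrite acts_lt // (letters_below_leq 5).
  rewrite /orbit_class /=; case: (acts v 0) => // n _.
  by do !case: ifP.
rewrite !acts_cat u0 v0; split=> //.
exists (orbit_class (acts u j)); first exact: orbit_class_lt.
have := acts_invK (orbit_word (acts u j)) (orbit_rep (orbit_class (acts u j))).
by rewrite e; apply; [apply: (letters_below_leq 5)|apply: rep_lt].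
Qed.

(** * Membership in a conjugate as fixing an index *)

Section Conjugates.

Variables (F : finFieldType) (alpha : F).
Hypotheses (F25 : #|F| = 25%N) (alpha2 : alpha ^+ 2 = 2).

Local Notation mxF := (mxF F alpha).
Local Notation rowF := (rowF F alpha).
Local Notation PGL3 := (PGLtype 3 F).
Local Notation Pw := (Pw F alpha).

Definition letters_group (l : seq nat) : {group PGL3} :=
  <<[set x in [seq Pw [:: s] | s <- l]]>>%G.

Local Notation Gam := (letters_group (iota 0 5)).
Local Notation PGU := (letters_group (iota 0 6)).

Definition W (i : nat) : {set PGL3} := (Gam :^ Pw (coset_word i))%g.

Lemma Pw_group n w : letters_below n w -> Pw w \in letters_group (iota 0 n).
Proof. by move/letters_belowP => h; exact: Pw_gen. Qed.

Lemma groupP_word n g : g \in letters_group (iota 0 n) -> exists2 w, letters_below n w & g = Pw w.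
Proof. by case/letters_genP => w wl ->; exists w => //; apply/letters_belowP. Qed.

Lemma ev_cat u v : mxF (ev (u ++ v)) = mxF (ev u) *m mxF (ev v).
Proof.
elim: u => [|s u ih]; first by rewrite -[ev [::]]/m_one mxF1 mul1mx.
by rewrite -[ev _]/(m_mul (letter s) (ev (u ++ v))) mxFM // ih mulmxA -mxFM.
Qed.

Lemma digits_matE d : exists2 w, letters_below 5 w &
  mxF (digits_mat chain_mats d) = mxF (ev w).
Proof.
case: d => [|x d]; first by exists [::].
have chain5 k y : letters_below 5 (chain_word k y).
  rewrite /chain_word; have [hk|hk] := ltnP k (size chain_words); last first.
    by rewrite (nth_default [::] hk) nth_nil.
  have [hy|hy] := ltnP y (size (nth [::] chain_words k)); last by rewrite (nth_default [::] hy).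
  exact: (allP (allP chain_words_ok _ (mem_nth [::] hk)) _ (mem_nth [::] hy)).
have evE k y : nth m_one (nth [::] chain_mats k) y = ev (chain_word k y).
  rewrite /chain_mats /chain_word; have [hk|hk] := ltnP k (size chain_words); last first.
    rewrite (nth_default [::] hk) nth_nil [nth [::] (map _ _) k]nth_default ?size_map //.
    by rewrite nth_nil.
  rewrite (nth_map [::]) //; have [hy|hy] := ltnP y (size (nth [::] chain_words k)).
    by rewrite (nth_map [::]).
  by rewrite (nth_default [::] hy) nth_default ?size_map.
exists (digits_word (x :: d)).
  rewrite /digits_word; elim: [:: 4; 3; 2; 1; 0]%N => // k l ih.
  by apply: letters_below_cat ih; exact: chain5.
move: chain_mats evE => mats evE.
rewrite /digits_mat /digits_word; elim: [:: 4; 3; 2; 1; 0]%N => // k l ih.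
rewrite -[foldr _ _ _]/(m_mul (nth m_one (nth [::] mats k) (nth 0%N (x :: d) k)) _) mxFM // ih evE.
by rewrite -ev_cat.
Qed.

Lemma coset_act s i : (s < 6)%N -> (i < 150)%N ->
  exists2 g, g \in Gam & (Pw (coset_word i) * Pw [:: s] = g * Pw (coset_word (act s i)))%g.
Proof.
move=> hs hi; have : coset_ok chain_mats coset_mats s i.
  by apply: (allP (allP cosets_ok s _)); rewrite mem_iota.
have hj : (act s i < 150)%N by have /and5P[] := act_okP s i hs hi.
rewrite /coset_ok /coset_mats !(nth_map 0%N) ?size_iota // !nth_iota // !add0n => /eqP.
have [w w5 hw] := digits_matE (nth [::] (nth [::] coset_digits s) i).
move/(m_normal_eq _ _ F25 alpha2) => [k k_neq0].
rewrite !mxFM // hw => h; exists (Pw w); first exact: Pw_group.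
rewrite -!Pw_cat.
have [[x -> hx] [y -> hy]] := (Pw_lift _ _ F25 alpha2 (coset_word i ++ [:: s]),
  Pw_lift _ _ F25 alpha2 (w ++ coset_word (act s i))).
apply/eqP/proj_eqP; exists k => //; rewrite hx hy (ev_cat w) -h (ev_cat _ [:: s]).
by congr (_ *m _); rewrite /ev /= mxFM // mxF1 mulmx1.
Qed.

Lemma coset_acts w i : letters_below 6 w -> (i < 150)%N ->
  exists2 g, g \in Gam & (Pw (coset_word i) * Pw w = g * Pw (coset_word (acts w i)))%g.
Proof.
elim: w i => [|s w ih] i; first by exists 1%g; rewrite ?group1 // mul1g /Pw big_nil mulg1.
case/andP=> hs hw hi; have [g gG hg] := coset_act _ _ hs hi.
have hj : (act s i < 150)%N by have /and5P[] := act_okP s i hs hi.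
have [g' gG' hg'] := ih _ hw hj.
exists (g * g')%g; first by rewrite groupM.
by rewrite -(cat1s s w) Pw_cat mulgA hg -mulgA hg' mulgA.
Qed.

Lemma W_acts w i : letters_below 6 w -> (i < 150)%N -> (W i :^ Pw w)%g = W (acts w i).
Proof.
move=> hw hi; have [g gG hg] := coset_acts _ _ hw hi.
by rewrite /W -conjsgM hg conjsgM (conjGid gG).
Qed.

Lemma Pw_coset0 : Pw (coset_word 0) = 1%g.
Proof. by rewrite (_ : coset_word 0 = [::]) // /Pw big_nil. Qed.

Lemma W0 : W 0 = Gam.
Proof. by rewrite /W Pw_coset0 conjsg1. Qed.

Lemma PGU_coset g : g \in PGU -> exists i, (i < 150)%N /\
  exists2 x, x \in Gam & g = (x * Pw (coset_word i))%g.
Proof.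
case/groupP_word => w hw ->; have [x xG hx] := coset_acts _ 0 hw erefl.
exists (acts w 0); split; first exact: acts_lt.
by exists x => //; rewrite -hx Pw_coset0 mul1g.
Qed.

(** Moving a centre by an element conjugates its reflection, so the permutation recorded with the
    centre is conjugated along with it. *)
Lemma center_act w e : letters_below 5 w -> e \in centers ->
  exists2 e', e' \in centers & conjugates w e.1 e'.1 /\
    exists2 k, k != 0 & rowF e.2 *m mxF (ev w) = k *: rowF e'.2.
Proof.
have [/allP ok1 _] := andP centers_normal.
elim: w e => [|s w ih] e hw he.
  exists e => //; split; first by apply/allP => x _; rewrite /pact /=.
  by exists 1; rewrite ?oner_eq0 // -[ev [::]]/m_one mxF1 mulmx1 scale1r.
have {hw} [hs hw] := andP hw.
have /allP/(_ e he)/hasP[e1 he1 /andP[/eqP hv c1]] : all (fun e => has (fun e' =>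
    (v_normal (v_mul e.2 (letter s)) == e'.2) && conjugates [:: s] e.1 e'.1) centers) centers.
  by apply: (allP centers_ok); rewrite mem_iota.
have [e' he' [c2 [k k_neq0 hk]]] := ih _ hw he1.
have [/eqP n1 /andP[/eqP sz1 /allP lt1]] := andP (ok1 _ he1).
have [t t_neq0 ht] : exists2 t, t != 0 & rowF e.2 *m mxF (letter s) = t *: rowF e1.2.
  by rewrite rowF_mul //; apply: (v_normal_eq _ _ F25 alpha2); rewrite hv n1.
exists e' => //; split; last first.
  exists (t * k); first by rewrite mulf_neq0.
  by rewrite -[ev _]/(m_mul (letter s) (ev w)) mxFM // mulmxA ht -scalemxAl hk scalerA.
have hpact x : (x < 7)%N -> pact (s :: w) x = pact w (pact [:: s] x) /\ (pact [:: s] x < 7)%N.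
  move=> hx; have : all (fun s => all (fun x => (0 < act s x.+1 < 8)%N) (iota 0 7)) (iota 0 5).
    by vm_compute.
  move/allP/(_ s); rewrite mem_iota => /(_ hs)/allP/(_ x); rewrite mem_iota => /(_ hx).
  by rewrite /pact /=; case: (act s x.+1).
have [_ /andP[/eqP sze /allP lte]] := andP (ok1 _ he).
apply/allP => x; rewrite mem_iota => hx.
have [p1 p2] := hpact x hx.
have hex : (nth 0 e.1 x < 7)%N by apply/lte/mem_nth; rewrite sze.
have [q1 q2] := hpact _ hex.
rewrite p1 q1.
move/allP: c1 => /(_ x); rewrite mem_iota => /(_ hx)/eqP <-.
by move/allP: c2 => /(_ (pact [:: s] x)); rewrite mem_iota => /(_ p2).
Qed.

Lemma W_rep_neq k : (0 < k < 7)%N -> W (orbit_rep k) <> Gam.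
Proof.
move=> hk; have : k \in iota 1 6 by rewrite mem_iota.
move/(allP moved_centers_ok); case: (nth _ moved_centers k) => s v.
set w := nth [::] rep_words k => /and3P[hs /hasP[e he /eqP ev_v] /allP hc].
have -> : W (orbit_rep k) = (Gam :^ Pw w)%g.
  have [/and4P[_ _ _ _] hr] := (word_okP _ (rep_lt k), orbit_class_rep k (proj2 (andP hk))).
  rewrite /W /coset_word /rep_word hr -/w.
  suff -> : orbit_word (orbit_rep k) = [::] by rewrite cats0.
  by case: k hk {hc hr} @w => [|[|[|[|[|[|[|k]]]]]]].
move=> GG; have : (Pw [:: s] ^ Pw w)%g \in Gam.
  by rewrite -GG memJ_conjg; apply: (Pw_group 5); rewrite /letters_below /= hs.
have -> : (Pw [:: s] ^ Pw w)%g = Pw (word_inv w ++ s :: w).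
  by rewrite conjgE -(Pw_inv _ _ F25 alpha2) -!Pw_cat.
case/groupP_word => u u5.
have [[x -> hx] [y -> hy]] := (Pw_lift _ _ F25 alpha2 (word_inv w ++ s :: w), Pw_lift _ _ F25 alpha2 u).
move/eqP/proj_eqP => [t t_neq0]; rewrite hx hy => hxy.
have [e' he' [_ [q _ hq]]] := center_act _ _ u5 he.
(* If the conjugated letter were in Gamma, it would send the chosen centre to some centre, whereas
   the cross products with all centres are nonzero. *)
have := hc _ he'; rewrite (v_crossP _ _ F25 alpha2 _ _ (t * q)) ?eqxx //.
by rewrite rowF_act // hxy -scalemxAr -ev_v hq scalerA.
Qed.

Lemma W_inj i j : (i < 150)%N -> (j < 150)%N -> W i = W j -> i = j.
Proof.
move=> hi hj Wij; have [w hw [wi [k hk wj]]] := pair_to_rep _ _ hi hj.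
have := W_acts _ _ hw hi; rewrite Wij W_acts // wi wj W0 => Wk.
have k0 : k = 0%N by case: k hk {wj} Wk => // k hk /W_rep_neq.
rewrite -(acts_invK _ _ hw hi) -(acts_invK _ _ hw hj) wi wj k0 //.
Qed.

Lemma norm_Gam g : g \in PGU -> (Gam :^ g)%g = Gam -> g \in Gam.
Proof.
case/PGU_coset => i [hi [x xG ->]]; rewrite conjsgM conjGid // => Wi.
have -> : i = 0%N by apply: W_inj => //; rewrite W0.
by rewrite Pw_coset0 mulg1.
Qed.

Lemma coset_word_PGU i : (i < 150)%N -> Pw (coset_word i) \in PGU.
Proof. by move=> hi; exact/Pw_group/coset_word_below. Qed.

Lemma Gam_sub_PGU : Gam \subset PGU.
Proof.
apply/subsetP => g /groupP_word[w hw ->].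
by apply: Pw_group; exact: (letters_below_leq 5).
Qed.

(** Each conjugate is its own normalizer, by transport of [norm_Gam], so belonging to it amounts to
    normalizing it. *)
Lemma mem_W g i : g \in PGU -> (i < 150)%N -> (g \in W i) = ((W i :^ g)%g == W i).
Proof.
move=> gG hi; have rG := coset_word_PGU _ hi.
apply/idP/eqP => [gW|Wg]; first exact: (@conjGid _ (Gam :^ Pw (coset_word i))%G).
rewrite /W mem_conjg; apply: norm_Gam; first by rewrite groupJ ?groupV.
by rewrite conjgE invgK !conjsgM [(_ :^ g)%g]Wg conjsgK.
Qed.

Lemma mem_W_word w i : letters_below 6 w -> (i < 150)%N -> (Pw w \in W i) = (acts w i == i).
Proof.
move=> hw hi; rewrite mem_W ?Pw_group // W_acts //.
apply/eqP/eqP => [|-> //]; apply: W_inj => //; exact: acts_lt.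
Qed.

End Conjugates.

(** * The isomorphism of Gamma with A_7 *)

Lemma gen_ind (gT : finGroupType) (A : {set gT}) (P : gT -> Prop) :
  P 1%g -> (forall x, x \in A -> P x) -> (forall x y, P x -> P y -> P (x * y)%g) ->
  forall x, x \in <<A>>%g -> P x.
Proof.
move=> P1 PA PM x /gen_prodgP[n [c cA ->]].
by elim/big_ind: _ => // i _; exact: PA.
Qed.

(** * Isomorphisms as subgroups of a direct product *)

Section PairGroups.

Variables (gT hT : finGroupType) (X : {set gT * hT}).
Local Notation Th := <<X>>%g.

Let fst_Th := [morphism of restrm (subsetT Th) (@fst gT hT)].
Let snd_Th := [morphism of restrm (subsetT Th) (@snd gT hT)].

Lemma pair_fst_inj : (forall y, (1%g, y) \in Th -> y = 1%g) -> 'injm fst_Th.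
Proof.
move=> h; apply/subsetP=> -[x y] /morphpreP[xy /set1P x1].
have {}x1 : x = 1%g := x1; rewrite x1 in xy *.
by rewrite (h y xy) group1.
Qed.

Lemma pair_snd_inj : (forall x, (x, 1%g) \in Th -> x = 1%g) -> 'injm snd_Th.
Proof.
move=> h; apply/subsetP=> -[x y] /morphpreP[xy /set1P y1].
have {}y1 : y = 1%g := y1; rewrite y1 in xy *.
by rewrite (h x xy) group1.
Qed.

Lemma pair_fst_im : (fst_Th @* Th = <<[set x.1 | x in X]>>)%g.
Proof.
rewrite morphim_gen ?subset_gen // morphimEsub ?subset_gen //.
Qed.

Lemma pair_snd_im : (snd_Th @* Th = <<[set x.2 | x in X]>>)%g.
Proof.
rewrite morphim_gen ?subset_gen // morphimEsub ?subset_gen //.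
Qed.

(* A subgroup of a product that meets both factors trivially is the graph of
   an isomorphism between its projections. *)
Lemma pair_morphism :
  (forall y, (1%g, y) \in Th -> y = 1%g) -> (forall x, (x, 1%g) \in Th -> x = 1%g) ->
  exists f : {morphism <<[set x.1 | x in X]>> >-> hT},
    [/\ 'injm f, (f @* <<[set x.1 | x in X]>> = <<[set x.2 | x in X]>>)%g
      & forall x, x \in Th -> f x.1 = x.2].
Proof.
move=> h1 h2; have i1 := pair_fst_inj h1; have i2 := pair_snd_inj h2.
pose g x := (invm i1 x).2.
have gE p : p \in Th -> g p.1 = p.2.
  by move=> pT; rewrite /g -[p.1]/(fst_Th p) invmE.
have lift x : x \in <<[set x.1 | x in X]>>%g -> exists2 p, p \in Th & x = p.1.
  by rewrite -pair_fst_im => /morphimP[p _ pT ->]; exists p.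
have gM : {in <<[set x.1 | x in X]>>%g &, {morph g : x y / (x * y)%g}}.
  move=> x y /lift[p pT ->] /lift[q qT ->].
  by rewrite -[(p.1 * q.1)%g]/((p * q)%g.1) !gE ?groupM.
exists (Morphism gM); split=> //; last first.
  rewrite -pair_snd_im morphimEdom /=; apply/setP => y; apply/imsetP/morphimP.
    by case=> x /lift[p pT ->] ->; exists p => //=; rewrite gE.
  case=> p _ pT ->; exists p.1; last by rewrite gE.
  by rewrite -pair_fst_im; apply: (mem_morphim fst_Th).
apply/injmP => x y /lift[p pT ->] /lift[q qT ->] /=; rewrite !gE // => e.
by congr (_.1); apply: (injmP i2).
Qed.

(** Only one of the two kernels has to be computed. With [Th] the group generated by the pairs, its
    order is that of its first projection, at most that of [H], at most that of [L], at most that of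
    the second projection, at most that of [Th]; hence all are equal and both projections are
    isomorphisms. *)
Lemma pair_isog (H : {group gT}) (L : {group hT}) :
  (forall y, (1%g, y) \in Th -> y = 1%g) ->
  [set x.1 | x in X] \subset H -> L \subset <<[set x.2 | x in X]>>%g -> (#|H| <= #|L|)%N ->
  H \isog L.
Proof.
move=> h1 XH LX HL; have i1 := pair_fst_inj h1.
have sH : (fst_Th @* Th)%g \subset H by rewrite pair_fst_im gen_subG.
have c1 := card_injm i1 (subxx _).
have c2 : (#|snd_Th @* Th| <= #|Th|)%N by exact: leq_morphim.
have c3 : (#|L| <= #|snd_Th @* Th|)%N by rewrite pair_snd_im subset_leq_card.
have c4 := subset_leq_card sH.
have eH : (fst_Th @* Th)%g = H.
  by apply/eqP; rewrite eqEcard sH (leq_trans HL) // (leq_trans c3) // (leq_trans c2) // c1.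
have eL : (snd_Th @* Th)%g = L.
  apply/esym/eqP; rewrite eqEcard pair_snd_im LX -pair_snd_im (leq_trans c2) // -c1.
  exact: leq_trans c4 HL.
have i2 : 'injm snd_Th.
  by rewrite -card_im_injm eqn_leq c2 -c1 (leq_trans c4) // (leq_trans HL).
have iso1 : Th \isog H by rewrite -eH sub_isog.
have iso2 : Th \isog L by rewrite -eL sub_isog.
exact: isog_trans (isog_symr iso1) iso2.
Qed.

End PairGroups.

(** A total definition, with value 1 on functions that are not injective, so that a permutation can
    be named before injectivity is proved. *)
Definition perm_of {T : finType} (f : T -> T) : {perm T} :=
  if @idP (injectiveb f) is ReflectT h then perm (elimT (injectiveP f) h) else 1%g.

Lemma perm_ofE (T : finType) (f : T -> T) : injective f -> perm_of f =1 f.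
Proof.
move=> /injectiveP fI x; rewrite /perm_of; case: {-}_ / idP => [h|/(_ fI)//].
by rewrite permE.
Qed.

(** Only the last two points can move, and an even permutation cannot just exchange them. *)
Lemma even_fix_almost_all n (s : 'S_n) : s \in 'Alt_('I_n) ->
  (forall j : 'I_n, (j.+2 < n)%N -> s j = j) -> s = 1%g.
Proof.
rewrite Alt_even => s_even fix_s.
suff h : forall i : 'I_n, s i != i -> forall j, s j = tperm i (s i) j.
  apply/permP => i; rewrite perm1; apply/eqP; apply: contraLR s_even => si.
  have -> : s = tperm i (s i) by apply/permP => j; exact: h.
  by rewrite odd_tperm eq_sym si.
move=> i si j.
have big k : s k != k -> (n <= k.+2)%N by rewrite leqNgt; apply: contraNN => /fix_s->.
have bi := big i si.
have ssi : s (s i) != s i by rewrite (inj_eq perm_inj).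
have bsi := big _ ssi.
have two k : s k != k -> k = i \/ k = s i.
  move=> /big bk; have := ltn_ord i; have := ltn_ord (s i); have := ltn_ord k.
  have neq : (s i : nat) <> i by move/val_inj/eqP; apply/negP.
  move=> hk hsi hi.
  have : (k : nat) = i \/ (k : nat) = s i by lia.
  by case=> /val_inj; auto.
have [->|ji] := eqVneq j i; first by rewrite tpermL.
have [->|jsi] := eqVneq j (s i).
  have sssi : s (s (s i)) != s (s i) by rewrite (inj_eq perm_inj).
  by rewrite tpermR; case/two: sssi => // e; rewrite e eqxx in ssi.
rewrite tpermD 1?eq_sym //; apply/eqP; apply: contraT => /two[] /eqP; first by rewrite (negPf ji).
by rewrite (negPf jsi).
Qed.

(** Sifting along a stabilizer chain: an element of [Q] is divided by elements of [H] that agree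
    with it at the next point, until it fixes all points but the last two. Parity then makes it
    trivial, which is why levels with [k.+2 < n] suffice. *)
Lemma sift_sub n (Q H : {group 'S_n}) : Q \subset 'Alt_('I_n) ->
  (forall (k : 'I_n) (s : 'S_n), (k.+2 < n)%N -> s \in Q ->
     (forall j : 'I_n, (j < k)%N -> s j = j) ->
     exists2 u, u \in H :&: Q & (forall j : 'I_n, (j < k)%N -> u j = j) /\ u k = s k) ->
  Q \subset H.
Proof.
move=> QA sift; apply/subsetP => s sQ.
suff h m k (t : 'S_n) : (n <= m + k)%N -> t \in Q -> (forall j : 'I_n, (j < k)%N -> t j = j) ->
    t \in H by apply: (h n 0%N); rewrite ?addn0.
elim: m k t => [|m ih] k t nk tQ tfix.
  suff -> : t = 1%g by rewrite group1.
  by apply: even_fix_almost_all; [exact: (subsetP QA)|move=> j jn; apply: tfix; lia].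
have [kn|kn] := leqP n k.+2.
  suff -> : t = 1%g by rewrite group1.
  by apply: even_fix_almost_all; [exact: (subsetP QA)|move=> j jn; apply: tfix; lia].
have kn' : (k < n)%N by lia.
have [u /setIP[uH uQ] [ufix uk]] := sift (Ordinal kn') t kn tQ tfix.
have -> : t = (t * u^-1 * u)%g by rewrite mulgKV.
rewrite groupM //; apply: (ih k.+1); first by rewrite addnS.
  by rewrite groupM ?groupV.
move=> j; rewrite ltnS leq_eqVlt => /orP[/eqP jk|jk]; rewrite permM.
  have -> : j = Ordinal kn' by exact: val_inj.
  by rewrite -uk permK.
by rewrite tfix // -{1}(ufix j jk) permK.
Qed.

(** * The permutations of the seven points *)

Definition pt7 (k : nat) : 'I_7 := inord k.

(* The permutations of the seven points induced by g2, ..., g6. *)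
Definition sigma (s : nat) : 'S_7 :=
  match s with
  | 0 => tperm (pt7 0) (pt7 5) * tperm (pt7 0) (pt7 6)
  | 1 => tperm (pt7 0) (pt7 1) * tperm (pt7 5) (pt7 6)
  | 2 => tperm (pt7 1) (pt7 2) * tperm (pt7 5) (pt7 6)
  | 3 => tperm (pt7 2) (pt7 3) * tperm (pt7 5) (pt7 6)
  | 4 => tperm (pt7 3) (pt7 4) * tperm (pt7 5) (pt7 6)
  | _ => 1
  end%g.
Definition sigmaw (w : seq nat) : 'S_7 := (\prod_(s <- w) sigma s)%g.

Lemma sigma_act s (x : 'I_7) : (s < 5)%N -> (sigma s x).+1 = act s x.+1.
Proof.
have pt7E k (hk : (k < 7)%N) : Ordinal hk = pt7 k by apply: val_inj; rewrite /= inordK.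
have ne k m : (k < 7)%N -> (m < 7)%N -> (pt7 k == pt7 m) = (k == m).
  by move=> hk hm; rewrite -val_eqE /= !inordK.
have valE k : (k < 7)%N -> val (pt7 k) = k by move=> hk; rewrite /= inordK.
case: s => [|[|[|[|[|]]]]] //= _;
  case: x => [[|[|[|[|[|[|[|//]]]]]]] hx]; rewrite (pt7E _ hx) permM !permE /= !ne //= ?permE /= ?ne //= ?valE //.
Qed.

Lemma sigmaw_cat u v : sigmaw (u ++ v) = (sigmaw u * sigmaw v)%g.
Proof. by rewrite /sigmaw big_cat. Qed.

Lemma sigmaw_acts w (x : 'I_7) : letters_below 5 w -> (sigmaw w x).+1 = acts w x.+1.
Proof.
elim: w x => [|s w ih] x /=; first by rewrite /sigmaw big_nil perm1.
by case/andP=> hs hw; rewrite /sigmaw big_cons permM -/(sigmaw w) ih // sigma_act.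
Qed.

Lemma sigmaw_pact w (x : 'I_7) : letters_below 5 w -> (sigmaw w x : nat) = pact w x.
Proof. by move=> hw; rewrite /pact -sigmaw_acts. Qed.

Lemma sigma_even s : sigma s \in 'Alt_('I_7).
Proof.
have ne k m : (k < 7)%N -> (m < 7)%N -> (pt7 k == pt7 m) = (k == m).
  by move=> hk hm; rewrite -val_eqE /= !inordK.
rewrite Alt_even; case: s => [|[|[|[|[|s]]]]]; rewrite ?odd_perm1 //= odd_permM !odd_tperm !ne //.
Qed.

Definition sigma_group (l : seq nat) : {group 'S_7} := <<[set x in [seq sigma s | s <- l]]>>%G.

Lemma sigmaw_group n w : letters_below n w -> sigmaw w \in sigma_group (iota 0 n).
Proof.
move/allP=> hw; rewrite /sigmaw big_seq; apply: group_prod => s sw.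
by apply: mem_gen; rewrite inE; apply: map_f; rewrite mem_iota; exact: hw.
Qed.

Lemma chain_ok : all (fun k => all (fun y => let w := chain_word k y in
    [&& (pact w k == k + y)%N & all (fun j => pact w j == j) (iota 0 k)])
  (iota 0 (7 - k))) (iota 0 5).
Proof. by vm_compute. Qed.

Lemma chain_word_below k y : letters_below 5 (chain_word k y).
Proof.
rewrite /chain_word; have [hk|hk] := ltnP k (size chain_words); last first.
  by rewrite (nth_default [::] hk) nth_nil.
have [hy|hy] := ltnP y (size (nth [::] chain_words k)); last by rewrite (nth_default [::] hy).
exact: (allP (allP chain_words_ok _ (mem_nth [::] hk)) _ (mem_nth [::] hy)).
Qed.

Lemma fix_lower_ge n (s : 'S_n) (k : 'I_n) :
  (forall j : 'I_n, (j < k)%N -> s j = j) -> (k <= s k)%N.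
Proof.
move=> sfix; rewrite leqNgt; apply/negP => lt; have := sfix _ lt.
by move/perm_inj => e; rewrite e ltnn in lt.
Qed.

Lemma sigma_group_Alt : sigma_group (iota 0 5) = 'Alt_('I_7) :> {set _}.
Proof.
apply/eqP; rewrite eqEsubset; apply/andP; split.
  by rewrite gen_subG; apply/subsetP=> x; rewrite inE => /mapP[s _ ->]; exact: sigma_even.
apply: sift_sub => // k s hk sA sfix.
have hks := fix_lower_ge _ _ _ sfix; set y := (s k - k)%N.
have hsk := ltn_ord (s k).
have /allP/(_ k) := chain_ok; rewrite mem_iota => /(_ hk)/allP/(_ y).
rewrite mem_iota leq0n add0n ltn_sub2r // => /(_ isT) /andP[/eqP h1 /allP h2].
exists (sigmaw (chain_word k y)).
  rewrite inE sigmaw_group ?chain_word_below //=.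
  by rewrite /sigmaw; apply: group_prod => t _; exact: sigma_even.
split=> [j jk|]; apply: val_inj; rewrite /= sigmaw_pact ?chain_word_below //.
  by apply/eqP/h2; rewrite mem_iota.
by rewrite h1 subnKC.
Qed.

(** * Faithfulness of the action on seven points *)

Section Seven.

Variables (F : finFieldType) (alpha : F).
Hypotheses (F25 : #|F| = 25%N) (alpha2 : alpha ^+ 2 = 2).

Local Notation mxF := (mxF F alpha).
Local Notation rowF := (rowF F alpha).
Local Notation PGL3 := (PGLtype 3 F).
Local Notation Pw := (Pw F alpha).
Local Notation Gam := (letters_group F alpha (iota 0 5)).

(* This set generates the graph of the isomorphism of Gamma with A_7. *)
Definition sigma_pairs : {set PGL3 * 'S_7} :=
  [set z in [seq (Pw [:: s], sigma s) | s <- iota 0 5]].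

Lemma sigma_pairs_word z : z \in <<sigma_pairs>>%g ->
  exists2 w, letters_below 5 w & z = (Pw w, sigmaw w).
Proof.
move: z; apply: gen_ind.
- by exists [::] => //; rewrite /Pw /sigmaw !big_nil.
- move=> z; rewrite inE => /mapP[s]; rewrite mem_iota => hs ->.
  by exists [:: s]; rewrite /letters_below /= ?andbT // /sigmaw big_seq1.
move=> _ _ [u hu ->] [v hv ->]; exists (u ++ v); first exact: letters_below_cat.
by rewrite Pw_cat sigmaw_cat.
Qed.

Lemma word_sigma_pairs w : letters_below 5 w -> (Pw w, sigmaw w) \in <<sigma_pairs>>%g.
Proof.
elim: w => [|s w ih]; first by rewrite /Pw /sigmaw !big_nil group1.
case/andP => hs hw.
have -> : (Pw (s :: w), sigmaw (s :: w)) = ((Pw [:: s], sigma s) * (Pw w, sigmaw w))%g.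
  by rewrite /Pw /sigmaw !big_cons big_nil mulg1.
rewrite groupM ?ih //; apply: mem_gen; rewrite inE; apply/mapP; exists s => //.
by rewrite mem_iota.
Qed.

(** The recorded permutations are conjugated trivially, so every centre is fixed. Fixing the three
    coordinate points makes the matrix diagonal, and fixing (1 : 1 : 2) makes its entries equal. *)
Lemma trivial_action w : letters_below 5 w -> sigmaw w = 1%g -> Pw w = 1%g.
Proof.
move=> hw sw1; have pid x : (x < 7)%N -> pact w x = x.
  by move=> hx; rewrite -[x]/(val (Ordinal hx)) -sigmaw_pact // sw1 perm1.
have fixed v : v \in [:: e1; e2; (k0, k0, k1); vec_of [:: 1; 1; 2]%N] ->
    exists k, rowF v *m mxF (ev w) = k *: rowF v.
  move/(allP center_frame)/hasP => [e he /eqP <-].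
  have [e' he' [c [k _ hk]]] := center_act _ _ F25 alpha2 _ _ hw he.
  exists k; suff ee : e = e' by rewrite {2}ee.
  have [/allP h1 h2] := andP centers_normal.
  have [_ /andP[/eqP sz /allP lt]] := andP (h1 _ he).
  have [_ /andP[/eqP sz' /allP lt']] := andP (h1 _ he').
  have /allP/(_ _ he)/allP/(_ _ he')/implyP h := h2; apply/eqP/h/eqP.
  apply: (@eq_from_nth _ 0%N) => [|x]; rewrite sz ?sz' // => hx.
  have hp : (nth 0 e.1 x < 7)%N by apply/lt/mem_nth; rewrite sz.
  by move/allP: c => /(_ x); rewrite mem_iota => /(_ hx)/eqP; rewrite !pid.
have [x -> hx] := Pw_lift _ _ F25 alpha2 w.
rewrite -(proj1 F); apply/eqP/proj_eqP; rewrite GL_1E hx.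
have [a1 h1] := fixed e1 isT; have [a2 h2] := fixed e2 isT.
have [a3 h3] := fixed (k0, k0, k1) isT; have [a4 h4] := fixed (vec_of [:: 1; 1; 2]%N) isT.
have frameE : rowF (vec_of [:: 1; 1; 2]%N) = rowF e1 + rowF e2 + 2 *: rowF (k0, k0, k1).
  have p2 : (2 : F) = phi F alpha (F2, F0) by rewrite /phi mul0r addr0.
  by rewrite p2 -rowFZ // -!rowFD.
move: h4; rewrite frameE !mulmxDl -scalemxAl h1 h2 h3 => h4.
have e10 : rowF e1 0 0 = 1 by rewrite mxE /= phi1.
have two0 : (2 : F) != 0.
  by have -> : (2 : F) = phi F alpha (F2, F0); [rewrite /phi mul0r addr0|rewrite phi_neq0].
have a41 : a1 = a4.
  by have /rowP/(_ 0) := h4; rewrite !mxE /= !phi0 !phi1 !(mulr0, addr0, mulr1).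
have a42 : a2 = a4.
  by have /rowP/(_ 1) := h4; rewrite !mxE /= !phi0 !phi1 !(mulr0, addr0, add0r, mulr1).
have a43 : a3 = a4.
  have /rowP/(_ 2%:R) := h4; rewrite !mxE /= !phi0 !phi1 !(mulr0, add0r, mulr1).
  by rewrite mulrC => /(mulIf two0).
have hM : mxF (ev w) = a4%:M.
  have [g1 g2 g3] := row_mxF F alpha m_one.
  have rM i : row i (mxF (ev w)) = row i (mxF m_one) *m mxF (ev w).
    by rewrite mxF1 -row_mul mul1mx.
  have rS i : row i a4%:M = a4 *: row i (mxF m_one) by rewrite mxF1 -scalemx1 linearZ.
  apply: (mx3_rowP F); rewrite rM rS.
  - by rewrite g1 h1 a41.
  - by rewrite g2 h2 a42.
  - by rewrite g3 h3 a43.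
exists a4; last by rewrite hM scalemx1.
apply/eqP => a0; have : mxF (ev w) \in unitmx by apply: ev_unit.
by rewrite hM a0 unitmxE det_scalar expr0n /= unitr0.
Qed.

Lemma sevenP : exists f : {morphism Gam >-> 'S_7},
  [/\ 'injm f, (f @* Gam = 'Alt_('I_7))%g & forall w, letters_below 5 w -> f (Pw w) = sigmaw w].
Proof.
have E1 : [set x.1 | x in sigma_pairs] = [set x in [seq Pw [:: s] | s <- iota 0 5]].
  apply/setP => x; rewrite inE; apply/imsetP/mapP => [[z]|[s hs ->]].
    by rewrite inE => /mapP[s hs ->] ->; exists s.
  by exists (Pw [:: s], sigma s) => //; rewrite inE; apply/mapP; exists s.
have E2 : [set x.2 | x in sigma_pairs] = [set x in [seq sigma s | s <- iota 0 5]].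
  apply/setP => x; rewrite inE; apply/imsetP/mapP => [[z]|[s hs ->]].
    by rewrite inE => /mapP[s hs ->] ->; exists s.
  by exists (Pw [:: s], sigma s) => //; rewrite inE; apply/mapP; exists s.
have := pair_morphism _ _ sigma_pairs; rewrite E1 E2 => hf.
have [||f] := hf.
(* A trivial class fixes every conjugate of Gamma; by [W_inj] its word then fixes all indices, in
   particular the seven points. *)
- move=> y /sigma_pairs_word[w hw [w1 ->]]; apply/permP => x; rewrite perm1; apply: val_inj.
  have hx : (x.+1 < 150)%N by apply: leq_trans (_ : 8 <= 150)%N; rewrite // ltnS ltn_ord.
  apply/succn_inj; rewrite /= sigmaw_acts //.
  have hw6 := letters_below_leq 5 6 _ isT hw.
  apply: (W_inj _ _ F25 alpha2) => //; first exact: acts_lt.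
  by rewrite -W_acts // -w1 conjsg1.
- by move=> x /sigma_pairs_word[w hw [-> w1]]; apply: trivial_action.
move=> [fi fG fE]; exists f; split=> //; first by rewrite fG -sigma_group_Alt.
by move=> w /word_sigma_pairs/fE.
Qed.

Lemma Gam_isog : Gam \isog 'Alt_('I_7).
Proof. by have [f [fi <- _]] := sevenP; exact: sub_isog. Qed.

Lemma card_Gam : #|Gam| = 2520%N.
Proof.
rewrite (card_isog Gam_isog); apply/double_inj; rewrite -mul2n card_Alt ?card_ord //.
Qed.

End Seven.

(** * Intersections of two conjugates *)

Lemma orbit_class_count k : (k < 7)%N ->
  count (fun i => orbit_class i == k) (iota 0 150) = orbit_card k.
Proof. by case: k => [|[|[|[|[|[|[|k]]]]]]] // _; vm_compute. Qed.

(* [alt_ok r l chains]: the words [w = chains k y] lie in the stabilizer of [r]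
   in Gamma and permute the list [l] of indices; [w ++ w], which acts as an even
   permutation, fixes the first [k] entries of [l] and moves the [k]-th one to
   the [k + y]-th. *)
Definition alt_ok (r : nat) (l : seq nat) (chains : seq (seq (seq nat))) : bool :=
  let n := size l in
  [&& uniq l, all (fun i => i < 150)%N l,
      all (all (fun w => [&& letters_below 5 w, acts w r == r
                          & all (fun i => acts w i \in l) l])) chains
    & all (fun k => all (fun y => let w := nth [::] (nth [::] chains k) y in
        [&& (w \in flatten chains), acts (w ++ w) (nth 0 l k) == nth 0 l (k + y)
          & all (fun j => acts (w ++ w) (nth 0 l j) == nth 0 l j) (iota 0 k)])
      (iota 0 (n - k))) (iota 0 (n - 2))]%N.

Definition alt6_chains : seq (seq (seq nat)) :=
  [:: [:: [::]; [:: 2; 3]; [:: 3; 2]; [:: 2; 4; 3]; [:: 1; 0; 1]; [:: 0; 1; 0]];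
      [:: [::]; [:: 3; 4]; [:: 4; 3]; [:: 2; 0; 1; 0; 2]; [:: 0; 1; 2; 1; 0]];
      [:: [::]; [:: 0; 1; 2; 3; 2; 1; 0; 4]; [:: 3; 0; 1; 2; 1; 0; 3];
        [:: 0; 1; 2; 3; 2; 1; 0]];
      [:: [::]; [:: 4; 0; 1; 2; 3; 2; 1; 0; 4]; [:: 0; 1; 2; 3; 4; 3; 2; 1; 0]]]%N.

Lemma alt6_ok : alt_ok 1 [:: 2; 3; 4; 5; 6; 7]%N alt6_chains.
Proof. by vm_compute. Qed.

Definition alt5_chains : seq (seq (seq nat)) :=
  [:: [:: [::]; [:: 3; 2; 1; 0; 2]; [:: 1; 3; 2; 1; 0; 4]; [:: 0; 1; 2; 1; 3];
        [:: 0; 1; 2; 1; 0; 3; 4]];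
      [:: [::]; [:: 1; 2; 0; 1; 0; 4; 3; 2; 1]; [:: 1; 0; 2; 1; 3; 0; 2; 1; 4];
        [:: 0; 1; 3; 0; 2; 1; 4; 0; 3; 2; 1; 0]];
      [:: [::]; [:: 3; 0; 4]; [:: 0; 4; 3]]]%N.

Lemma alt5_ok : alt_ok 108 [:: 9; 11; 13; 17; 20]%N alt5_chains.
Proof. by vm_compute. Qed.

(** * Orders of the intersections, and the alternating ones *)

Section Intersections.

Variables (F : finFieldType) (alpha : F).
Hypotheses (F25 : #|F| = 25%N) (alpha2 : alpha ^+ 2 = 2).

Local Notation PGL3 := (PGLtype 3 F).
Local Notation Pw := (Pw F alpha).
Local Notation W := (W F alpha).
Local Notation Gam := (letters_group F alpha (iota 0 5)).

Lemma orbit_W k : (k < 7)%N ->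
  ((W (orbit_rep k)) :^: Gam)%g = [set W (val i) | i : 'I_150 & orbit_class i == k].
Proof.
move=> hk; apply/setP => A; apply/imsetP/imsetP => [[g /groupP_word[w hw ->] ->]|[i]].
  have h6 := letters_below_leq 5 6 _ isT hw; have hr := rep_lt k.
  exists (Ordinal (acts_lt _ _ h6 hr)); last by rewrite W_acts.
  by rewrite inE /= orbit_class_acts // orbit_class_rep.
rewrite inE => /eqP <- ->.
have /and4P[_ hw /eqP e _] := word_okP _ (ltn_ord i).
exists (Pw (orbit_word i)); first exact: Pw_group.
by rewrite W_acts ?rep_lt // ?e // (letters_below_leq 5).
Qed.

Definition Wgroup (i : nat) : {group PGL3} := (Gam :^ Pw (coset_word i))%G.

Lemma norm_W i : (i < 150)%N -> 'N_Gam(W i)%g = Gam :&: W i.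
Proof.
move=> hi; apply/setP => g; rewrite inE [RHS]inE; case gG: (g \in Gam) => //=.
rewrite mem_W //; last exact: (subsetP (Gam_sub_PGU F alpha)).
exact: (sameP normP eqP).
Qed.

Lemma card_ord_set (n : nat) (p : pred nat) : #|[set i : 'I_n | p i]| = count p (iota 0 n).
Proof.
rewrite cardsE cardE size_filter -val_enum_ord count_map enumT; apply: eq_count => i.
by rewrite /=.
Qed.

Lemma card_W (p : pred nat) : #|[set W (val i) | i : 'I_150 & p i]| = count p (iota 0 150).
Proof.
rewrite card_imset ?card_ord_set // => i j /(W_inj _ _ F25 alpha2 _ _ (ltn_ord i) (ltn_ord j)).
exact: val_inj.
Qed.

(** Orbit and stabilizer: the orbit is a class of conjugates under Gamma, and by [norm_W] the
    normalizer in Gamma of a member is the intersection. *)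
Lemma card_inter k : (k < 7)%N -> (#|Gam :&: W (orbit_rep k)| * orbit_card k = 2520)%N.
Proof.
move=> hk; rewrite -norm_W ?rep_lt // -(card_Gam _ _ F25 alpha2) -orbit_class_count //.
rewrite -card_W -orbit_W // card_conjugates.
exact: (Lagrange (subsetIl Gam _)).
Qed.

Lemma card_stab k : (k < 7)%N -> #|Gam :&: W (orbit_rep k)| = stab_card k.
Proof.
move=> hk; have := card_inter _ hk; have := leqnn 0.
case: k hk => [|[|[|[|[|[|[|k]]]]]]] // _ _; rewrite /orbit_card /stab_card /=; lia.
Qed.

Lemma alt_isog r l chains : alt_ok r l chains -> (r < 150)%N ->
  (2 * #|Gam :&: W r| = (size l)`!)%N -> (1 < size l)%N ->
  Gam :&: W r \isog 'Alt_('I_(size l)).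
Proof.
set n := size l; case/and4P => l_uniq /allP l_lt /allP words_ok chains_ok hr card_H n_gt1.
pose pf w (x : 'I_n) : 'I_n := insubd x (index (acts w (nth 0%N l x)) l).
pose pw w := perm_of (pf w).
have memw w : w \in flatten chains ->
    [/\ letters_below 5 w, acts w r = r & forall i, i \in l -> acts w i \in l].
  case/flattenP => ws /words_ok/allP h /h /and3P[h1 /eqP h2 /allP h3].
  by split.
have lx (x : 'I_n) : nth 0%N l x \in l by rewrite mem_nth.
have pfE w x : w \in flatten chains -> nth 0%N l (pf w x) = acts w (nth 0%N l x).
  case/memw => _ _ hl; rewrite /pf insubdK ?nth_index ?hl //.
  by rewrite -topredE /= index_mem hl.
have pf_inj w : w \in flatten chains -> injective (pf w).
  move=> hw x y /(congr1 (fun z : 'I_n => nth 0%N l z)); rewrite !pfE //.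
  have [w5 _ _] := memw _ hw; have w6 := letters_below_leq 5 6 _ isT w5.
  move/(congr1 (acts (word_inv w))); rewrite !acts_invK ?l_lt //.
  by move/eqP; rewrite nth_uniq // => /eqP/val_inj.
have pwE w (x : 'I_n) : w \in flatten chains -> nth 0%N l (pw w x) = acts w (nth 0%N l x).
  by move=> hw; rewrite /pw perm_ofE ?pfE //; exact: pf_inj.
pose X : {set PGL3 * 'S_n} := [set z in [seq (Pw w, pw w) | w <- flatten chains]].
(* The permutation in each pair is the one that the group element induces on the listed conjugates;
   by [W_inj] it is trivial when the element is. *)
have X_act z : z \in <<X>>%g -> forall x : 'I_n, (W (nth 0%N l x) :^ z.1)%g = W (nth 0%N l (z.2 x)).
  move: z; apply: gen_ind => [x|z|z t hz ht x].
  - by rewrite conjsg1 perm1.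
  - rewrite inE => /mapP[w hw ->] x /=; have [w5 _ _] := memw _ hw.
    by rewrite W_acts ?pwE ?l_lt // (letters_below_leq 5).
  - by rewrite /= conjsgM hz ht permM.
apply: (pair_isog _ _ X (Gam :&: Wgroup r)%G).
- move=> y /X_act /= h; apply/permP => x; rewrite perm1; apply: val_inj.
  have := h x; rewrite conjsg1 => /(W_inj _ _ F25 alpha2)/eqP.
  by rewrite nth_uniq ?l_lt // => /(_ isT isT)/eqP.
- apply/subsetP => x /imsetP[z]; rewrite inE => /mapP[w hw -> ->].
  rewrite -[_.1]/(Pw w); have [w5 hwr _] := memw _ hw; apply/setIP; split; first exact: Pw_group.
  by rewrite -[gval (Wgroup r)]/(W r) mem_W_word ?hwr // (letters_below_leq 5).
- apply: sift_sub => // k s hk sA sfix.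
  have hks := fix_lower_ge _ _ _ sfix; set y := (s k - k)%N; have hsk := ltn_ord (s k).
  have hk' : (k < n - 2)%N by lia.
  have hy : (y < n - k)%N by rewrite /y; lia.
  have /allP/(_ k) := chains_ok; rewrite mem_iota => /(_ hk')/allP/(_ y).
  rewrite mem_iota => /(_ hy) /and3P[hw /eqP h1 /allP h2].
  set w := nth _ _ _ in hw h1 h2.
  have pww (x : 'I_n) : nth 0%N l ((pw w * pw w)%g x) = acts (w ++ w) (nth 0%N l x).
    by rewrite permM !pwE // acts_cat.
  (* Squares are even, so no parity of the words needs to be computed. *)
  exists (pw w * pw w)%g.
    have pg : pw w \in <<[set x.2 | x in X]>>%g.
      apply/mem_gen/imsetP; exists (Pw w, pw w) => //.
      by rewrite inE; apply/mapP; exists w.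
    by rewrite inE Alt_even odd_permM addbb andbT groupM.
  split=> [j jk|]; apply: val_inj; apply/eqP; rewrite -(nth_uniq 0%N _ _ l_uniq) //= pww.
    by apply: h2; rewrite mem_iota.
  by rewrite h1 /y subnKC.
by rewrite -(leq_pmul2l (_ : 0 < 2)%N) // card_H card_Alt ?card_ord.
Qed.

End Intersections.

Lemma groupM3 (gT : finGroupType) (H : {group gT}) x y z :
  x \in H -> y \in H -> z \in H -> (x * y * z)%g \in H.
Proof. by move=> hx hy hz; rewrite !groupM. Qed.

(** * Generators and order bounds for SL_2 and PSL_2 over F_7 *)

Section SL2.

Variable F7 : finFieldType.
Hypotheses (card_F7 : #|F7| = 7%N) (natr_F7 : forall x : F7, exists n, x = n%:R).

Local Notation GL2 := {'GL_2[F7]}.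
Local Notation K := (SL_group 2 F7 :&: scalGL_group 2 F7)%G.

Definition mx2 (a b c d : F7) : 'M[F7]_2 :=
  \matrix_(i, j) (if i == 0 then if j == 0 then a else b else if j == 0 then c else d).

Lemma mx2M a b c d a' b' c' d' : mx2 a b c d *m mx2 a' b' c' d' =
  mx2 (a * a' + b * c') (a * b' + b * d') (c * a' + d * c') (c * b' + d * d').
Proof.
apply/matrixP => i j; rewrite !mxE !big_ord_recl big_ord0 !mxE /= addr0.
by case: (i == 0); case: (j == 0).
Qed.

Lemma ord2P (P : 'I_2 -> Prop) : P 0 -> P 1 -> forall i, P i.
Proof.
move=> h0 h1 [[|[|//]] hi].
- by rewrite (_ : Ordinal hi = 0) //; apply: val_inj.
- by rewrite (_ : Ordinal hi = 1) //; apply: val_inj.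
Qed.

Lemma mx2E (A : 'M[F7]_2) : A = mx2 (A 0 0) (A 0 1) (A 1 0) (A 1 1).
Proof. by apply/matrixP; apply: ord2P; apply: ord2P; rewrite mxE. Qed.

Lemma det_mx2 a b c d : \det (mx2 a b c d) = a * d - b * c.
Proof.
rewrite (expand_det_row _ 0) !big_ord_recl big_ord0 /cofactor !det_mx11 !mxE /=.
by rewrite addr0 expr0 expr1 mul1r mulN1r mulrN.
Qed.

Lemma det1_unit (A : 'M[F7]_2) : \det A = 1 -> A \in unitmx.
Proof. by rewrite unitmxE => ->; exact: unitr1. Qed.

Definition gl2 (A : 'M[F7]_2) : GL2 := insubd (1%g : GL2) A.

Lemma gl2K A : A \in unitmx -> GLval (gl2 A) = A.
Proof. by move=> u; rewrite /gl2 insubdK. Qed.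

Lemma SL2M (M N : GL2) : M \in SL 2 F7 -> N \in SL 2 F7 -> (M * N)%g \in SL 2 F7.
Proof. by rewrite !inE GL_MxE det_mulmx => /eqP-> /eqP->; rewrite mulr1. Qed.

Definition sl2T := gl2 (mx2 1 1 0 1).
Definition sl2S := gl2 (mx2 0 1 (-1) 0).

Lemma sl2TE : GLval sl2T = mx2 1 1 0 1.
Proof. by rewrite gl2K // det1_unit // det_mx2 !mulr1 mulr0 subr0. Qed.

Lemma sl2SE : GLval sl2S = mx2 0 1 (-1) 0.
Proof. by rewrite gl2K // det1_unit // det_mx2 mulr0 mul1r opprK add0r. Qed.

Lemma GLval_inj2 (x y : GL2) : GLval x = GLval y -> x = y.
Proof. by move=> h; apply: val_inj. Qed.

Lemma sl2T_exp n : GLval (sl2T ^+ n)%g = mx2 1 n%:R 0 1.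
Proof.
elim: n => [|n ih].
  rewrite expg0 GL_1E; apply/matrixP; apply: ord2P; apply: ord2P; by rewrite !mxE.
rewrite expgSr GL_MxE ih sl2TE mx2M !(mulr0, mul0r, mulr1, addr0, add0r).
by rewrite mulrS.
Qed.

Lemma SL2_gen : SL 2 F7 \subset <<[set sl2T; sl2S]>>%g.
Proof.
pose H : {group GL2} := <<[set sl2T; sl2S]>>%G.
suff sH : SL 2 F7 \subset H by [].
apply/subsetP => M; rewrite inE => /eqP dM.
have TH : sl2T \in H by apply: mem_gen; exact: set21.
have SH : sl2S \in H by apply: mem_gen; exact: set22.
have upper (x : F7) : exists2 g, g \in H & GLval g = mx2 1 x 0 1.
  by have [n ->] := natr_F7 x; eexists; [exact: (groupX n TH)|exact: sl2T_exp].
have lower (x : F7) : exists2 g, g \in H & GLval g = mx2 1 0 x 1.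
  have [g gH hg] := upper (- x).
  (* Conjugation by [sl2S] turns an upper unitriangular matrix into a lower one; the cube of [sl2S]
     is its inverse. *)
  eexists; first exact: (groupM3 _ H _ _ _ SH gH (groupM3 _ H _ _ _ SH SH SH)).
  by rewrite !GL_MxE hg sl2SE !mx2M; congr mx2; ring.
(* A matrix of determinant 1 with lower left entry [c] nonzero is an upper, a lower and an upper
   unitriangular factor; multiplication by [sl2S] brings the remaining matrices to this case. *)
have main (N : GL2) : \det (GLval N) = 1 -> GLval N 1 0 != 0 -> N \in H.
  rewrite {1}[GLval N]mx2E det_mx2.
  have := mx2E (GLval N); move: (GLval N 0 0) (GLval N 0 1) (GLval N 1 0) (GLval N 1 1).
  move=> a b c d hN dN c0.
  have [[g gH hg] [h hH hh]] := (upper ((a - 1) / c), lower c).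
  have [k kH hk] := upper ((d - 1) / c).
  apply: (eq_ind _ (fun z => z \in H) (groupM3 _ H _ _ _ gH hH kH)).
  apply: GLval_inj2; rewrite !GL_MxE hg hh hk hN !mx2M; congr mx2.
  - by field.
  - have -> : b = (a * d - 1) / c by rewrite -dN; field.
    by field.
  - by ring.
  - by field.
have [c0|] := eqVneq (GLval M 1 0) 0; last exact: main.
rewrite -(groupMl _ SH); apply: main.
  by rewrite GL_MxE det_mulmx dM mulr1 sl2SE det_mx2 mulr0 mul1r opprK add0r.
rewrite GL_MxE sl2SE [GLval M]mx2E mx2M mxE /= c0 mul0r addr0 mulN1r oppr_eq0.
apply/eqP => a0; have := dM; rewrite [GLval M]mx2E det_mx2 a0 c0 mul0r mulr0 subr0.
by move/eqP; rewrite eq_sym oner_eq0.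
Qed.

(** Dividing a matrix by a diagonal one of the same determinant embeds GL_2 into SL_2 times the six
    nonzero scalars, and GL_2(7) has order 336 * 6. The lower bound is all that [pair_isog] asks
    for. *)
Lemma card_SL2 : (336 <= #|SL 2 F7|)%N.
Proof.
have dg (x : F7) : x != 0 -> mx2 x 0 0 1 \in unitmx.
  by move=> x0; rewrite unitmxE det_mx2 mulr1 mulr0 subr0 unitfE.
pose D (M : GL2) := gl2 (mx2 (\det (GLval M)) 0 0 1).
pose f (M : GL2) : GL2 * F7 := (((D M)^-1 * M)%g, \det (GLval M)).
have det_unit (M : GL2) : \det (GLval M) != 0.
  by rewrite -unitfE -unitmxE; exact: (GL_unitmx M).
have fI : injective f.
  move=> M N h; have h1 : ((D M)^-1 * M = (D N)^-1 * N)%g := congr1 fst h.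
  have h2 : \det (GLval M) = \det (GLval N) := congr1 snd h.
  by move: h1; rewrite /D h2; exact: mulgI.
have : (#|[set: GL2]| <= #|setX (SL 2 F7) [set~ (0 : F7)%R]|)%N.
  rewrite -(card_imset _ fI); apply/subset_leq_card/subsetP => _ /imsetP[M _ ->].
  apply/setXP; split; last by rewrite !inE; exact: det_unit.
  suff : \det (GLval ((D M)^-1 * M)%g) == 1 by rewrite inE.
  rewrite GL_MxE GL_VxE gl2K ?dg ?det_unit //.
  by rewrite det_mulmx det_inv det_mx2 mulr1 mulr0 subr0 mulVf ?det_unit.
rewrite cardsX cardsC1 card_GL_2 card_F7 /=.
by rewrite (_ : 7 * 6 ^ 2 * 8 = 336 * 6)%N // leq_pmul2r.
Qed.

Lemma card_SL2_scal : (#|K| <= 2)%N.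
Proof.
pose N1 : GL2 := gl2 (-1)%:M.
have uN : ((-1)%:M : 'M[F7]_2) \in unitmx by rewrite unitmxE det_scalar unitrX ?unitrN1.
have hN : GLval N1 = (-1)%:M by exact: gl2K.
have sK : K \subset [set 1%g; N1].
  apply/subsetP => M /setIP[]; rewrite !inE => /eqP dM /is_scalar_mxP[c hc].
  have : c ^+ 2 = 1 by rewrite -dM hc det_scalar.
  move/eqP; rewrite sqrf_eq1 => /orP[] /eqP ec; apply/orP; [left|right]; apply/eqP/GLval_inj2.
    by rewrite hc ec GL_1E.
  by rewrite hc ec hN.
by apply: leq_trans (subset_leq_card sK) _; rewrite cards2; case: (_ != _).
Qed.

Lemma SL2_scal_norm (M : GL2) : M \in 'N(K).
Proof.
apply: (subsetP (cent_sub _)); apply/centP => y /setIP[_].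
rewrite inE => /is_scalar_mxP[a ya]; apply: GLval_inj2.
by rewrite !GL_MxE ya scalar_mxC.
Qed.

Lemma card_PSL2 : (168 <= #|PSL 2 F7|)%N.
Proof.
have nK : SL_group 2 F7 \subset 'N(K) by apply/subsetP => M _; exact: SL2_scal_norm.
have := card_SL2; rewrite -(Lagrange (subsetIl (SL_group 2 F7) (scalGL_group 2 F7))) -card_quotient //.
rewrite -[(_ / _)%g]/(PSL 2 F7) => h.
rewrite -(leq_pmul2l (_ : 0 < 2)%N) //; apply: leq_trans h _.
by rewrite leq_mul2r card_SL2_scal orbT.
Qed.

Definition pcoset (M : GL2) : coset_of (SL 2 F7 :&: scalGL 2 F7) := coset K M.

Lemma pcosetM : {morph pcoset : x y / (x * y)%g}.
Proof. exact: (coset_normedM _ K SL2_scal_norm). Qed.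

Lemma pcoset1 : pcoset 1%g = 1%g.
Proof. exact: (coset1 _ K). Qed.

Lemma PSL2_gen : PSL 2 F7 \subset <<[set pcoset sl2T; pcoset sl2S]>>%g.
Proof.
apply/subsetP => x /morphimP[M _ /(subsetP SL2_gen) hM xM].
have {xM} -> : x = pcoset M := xM.
move: M hM; apply: gen_ind.
- by rewrite pcoset1 group1.
- by move=> M /set2P[]->; apply: mem_gen; [exact: set21|exact: set22].
by move=> M N hM hN; rewrite pcosetM groupM.
Qed.

Lemma rowM2 (v : 'rV[F7]_2) a b c d :
  (v *m mx2 a b c d) 0 0 = v 0 0 * a + v 0 1 * c /\
  (v *m mx2 a b c d) 0 1 = v 0 0 * b + v 0 1 * d.
Proof.
have e : lift ord0 ord0 = 1 :> 'I_2 by exact: val_inj.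
by rewrite !mxE !big_ord_recl !big_ord0 !mxE /= !addr0 e.
Qed.

End SL2.

(** * The action on the projective line over F_7 *)

Section Slope.

Local Notation F7 := ('F_7 : finFieldType).
Local Notation mx2 := (mx2 F7).
Local Notation rowM2 := (rowM2 F7).

(* The projective line over F_7, the point [(1 : x)] being numbered [x] and
   [(0 : 1)] being numbered 7. *)
Definition slope (v : 'rV[F7]_2) : nat := if v 0 0 == 0 then 7%N else (v 0 1 / v 0 0 : F7).

Definition slopeT (n : nat) : nat := if n == 7%N then 7%N else (n.+1 %% 7)%N.
Definition slopeS (n : nat) : nat := nth 0%N [:: 7; 6; 3; 2; 5; 4; 1; 0]%N n.

Lemma slope_lt v : (slope v < 8)%N.
Proof. by rewrite /slope; case: ifP => // _; exact: leq_trans (ltn_ord _) _. Qed.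

Lemma slope_T v : slope (v *m mx2 1 1 0 1) = slopeT (slope v).
Proof.
rewrite /slope; have [-> ->] := rowM2 v 1 1 0 1.
rewrite !mulr1 mulr0 addr0; case: eqP => // /eqP v0.
rewrite mulrDl divff // /slopeT; set x := _ / _.
by have := ltn_ord x; case: eqP => [->|_ _].
Qed.

Lemma slope_S v : v != 0 -> slope (v *m mx2 0 1 (-1) 0) = slopeS (slope v).
Proof.
move=> v0; rewrite /slope; have [-> ->] := rowM2 v 0 1 (-1) 0.
rewrite !mulr0 mulr1 mulrN1 add0r addr0 oppr_eq0.
have [a0|a0] := eqVneq (v 0 0) 0.
  rewrite a0 mul0r; case: eqP => // b0.
  by case/eqP: v0; apply/rowP; apply: ord2P; rewrite mxE.
have [b0|b0] := eqVneq (v 0 1) 0; first by rewrite b0 mul0r.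
have -> : v 0 0 / - v 0 1 = - (v 0 1 / v 0 0)^-1 by rewrite invf_div invrN mulrN.
have : v 0 1 / v 0 0 != 0 by rewrite mulf_neq0 ?invr_eq0.
by case: (_ / _) => [[|[|[|[|[|[|[|//]]]]]]] hx] // _; vm_compute.
Qed.

(** Three points suffice: (0 : 1) and (1 : 0) make the matrix diagonal, and (1 : 1) makes the two
    entries equal. *)
Lemma slope_fixed (M : 'M[F7]_2) : (forall v : 'rV[F7]_2, v != 0 -> slope (v *m M) = slope v) ->
  is_scalar_mx M.
Proof.
rewrite [M](mx2E F7); move: (M 0 0) (M 0 1) (M 1 0) (M 1 1) => a b c d h.
pose r (x y : F7) : 'rV[F7]_2 := \row_j (if j == 0 then x else y).
have rE x y : r x y 0 0 = x /\ r x y 0 1 = y by rewrite !mxE.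
have r_neq0 x y : (x != 0) || (y != 0) -> r x y != 0.
  case/orP => [x0|y0]; apply/eqP => /rowP e.
    by have := e 0; have [-> _] := rE x y; rewrite mxE; apply/eqP.
  by have := e 1; have [_ ->] := rE x y; rewrite mxE; apply/eqP.
have slopeE x y : slope (r x y *m mx2 a b c d) = slope (r x y) ->
    (if x * a + y * c == 0 then 7%N else ((x * b + y * d) / (x * a + y * c) : F7) : nat) =
    (if x == 0 then 7%N else (y / x : F7) : nat).
  rewrite /slope; have [-> ->] := rowM2 (r x y) a b c d.
  by have [-> ->] := rE x y.
have lt7 (x : F7) : (x : nat) != 7%N by have := ltn_ord x; rewrite neq_ltn => ->.
have := slopeE 0 1 (h _ (r_neq0 _ _ _)); rewrite oner_eq0 orbT eqxx => /(_ isT).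
rewrite !mul0r !mul1r !add0r; case: eqP => [c0 _|_ /eqP]; last by rewrite (negPf (lt7 _)).
have := slopeE 1 0 (h _ (r_neq0 _ _ _)); rewrite oner_eq0 => /(_ isT).
rewrite !mul0r !mul1r !addr0; case: eqP => [_ /esym/eqP|/eqP a0]; first by rewrite (negPf (lt7 _)).
move/val_inj/eqP; rewrite mulf_eq0 invr_eq0 (negPf a0) orbF => /eqP b0.
have := slopeE 1 1 (h _ (r_neq0 _ _ _)); rewrite oner_eq0 => /(_ isT).
rewrite !mul1r c0 b0 addr0 add0r (negPf a0) => /val_inj; rewrite invr1.
move/(congr1 (fun x => x * a)); rewrite mulfVK // mul1r => ->.
apply/is_scalar_mxP; exists a.
by apply/matrixP; apply: ord2P; apply: ord2P; rewrite !mxE.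
Qed.

End Slope.

(** [l] lists eight indices in the order of the projective line. For each of the two orbits of size
    15 they are found in the other one. *)
Definition psl_ok (r : nat) (l wT wS : seq nat) : bool :=
  [&& uniq l, size l == 8, all (fun i => i < 150)%N l, letters_below 5 wT, letters_below 5 wS,
      acts wT r == r, acts wS r == r
    & all (fun x => (acts wT (nth 0 l x) == nth 0 l (slopeT x)) &&
                    (acts wS (nth 0 l x) == nth 0 l (slopeS x)))%N (iota 0 8)].

Lemma psl8_ok : psl_ok 8 [:: 37; 34; 31; 27; 32; 28; 30; 35]%N [:: 1; 2; 0; 1; 3; 2; 4]%N [:: 1]%N.
Proof. by vm_compute. Qed.

Lemma psl23_ok : psl_ok 23 [:: 22; 15; 13; 18; 12; 16; 20; 19]%N [:: 0; 2; 1; 3; 2; 1; 4]%N [:: 1]%N.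
Proof. by vm_compute. Qed.

(** The reversal gives the number 0 to {4, 5, 6}, the block in [A4x3_2], so that it corresponds to
    the orbit representatives 38 and 73. *)
Definition triples : seq (seq nat) :=
  rev [seq a :: bc | a <- iota 0 7,
         bc <- [seq [:: b; c] | b <- iota a.+1 (6 - a), c <- iota b.+1 (6 - b)]]%N.

(* The orbits of size 35 are numbered like the 3-subsets of the seven points. *)
Lemma triples_ok : all (fun b => all (fun k => all (fun s =>
    let k' := (act s (b + k) - b)%N in
    [&& (k' < 35)%N, act s (b + k) == (b + k')%N
      & all (fun x => (pact [:: s] x \in nth [::] triples k') == (x \in nth [::] triples k))
          (iota 0 7)])
  (iota 0 5)) (iota 0 35)) [:: 38; 73]%N.
Proof. by vm_compute. Qed.

Lemma triple0_ok : all (fun x => (x \in nth [::] triples 0) == (4 <= x)%N) (iota 0 7) &&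
  all (fun k => all (fun x => (x \in nth [::] triples k) == (4 <= x)%N) (iota 0 7) ==> (k == 0%N))
    (iota 0 35).
Proof. by vm_compute. Qed.

Lemma A4x3_2_group_set : group_set A4x3_2.
Proof.
apply/group_setP; split=> [|g h].
  apply/setIdP; split; first exact: group1.
  by apply/eqP; rewrite -[RHS]imset_id; apply: eq_imset => x; rewrite perm1.
move=> /setIdP[gA /eqP gD] /setIdP[hA /eqP hD]; apply/setIdP; split; first exact: groupM.
by apply/eqP; rewrite -{2}hD -{2}gD -imset_comp; apply: eq_imset => x; rewrite permM.
Qed.

(** * Isomorphism types of all intersections *)

Section InterTypes.

Variables (F : finFieldType) (alpha : F).
Hypotheses (F25 : #|F| = 25%N) (alpha2 : alpha ^+ 2 = 2).

Local Notation PGL3 := (PGLtype 3 F).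
Local Notation Pw := (Pw F alpha).
Local Notation W := (W F alpha).
Local Notation Wgroup := (Wgroup F alpha).
Local Notation Gam := (letters_group F alpha (iota 0 5)).

Lemma psl_isog r l wT wS : psl_ok r l wT wS -> (r < 150)%N ->
  #|Gam :&: W r| = 168%N -> Gam :&: W r \isog PSL 2 'F_7.
Proof.
case/and5P => l_uniq /eqP sz /allP l_lt hT /and4P[hS /eqP rT /eqP rS /allP hl] hr card_H.
have cF : #|('F_7 : finFieldType)| = 7%N by rewrite card_Fp.
have nF (x : ('F_7 : finFieldType)) : exists n, x = n%:R by exists x; rewrite natr_Zp.
have T6 := letters_below_leq 5 6 _ isT hT; have S6 := letters_below_leq 5 6 _ isT hS.
pose T := sl2T 'F_7; pose S := sl2S 'F_7.
pose X : {set PGL3 * coset_of (SL 2 'F_7 :&: scalGL 2 'F_7)} :=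
  [set (Pw wT, pcoset 'F_7 T); (Pw wS, pcoset 'F_7 S)].
(* A matrix acts on slopes and a group element on conjugates. Agreement on the eight listed ones
   ties the two components of a pair together, so that a trivial first component forces a scalar
   matrix. *)
pose acts_as g (M : {'GL_2['F_7]}) := forall v : 'rV['F_7]_2, v != 0 ->
  (W (nth 0%N l (slope v)) :^ g)%g = W (nth 0%N l (slope (v *m GLval M))).
have l8 v : (nth 0%N l (slope v) < 150)%N by apply: l_lt; rewrite mem_nth ?sz ?slope_lt.
have X_act z : z \in <<X>>%g -> exists M, [/\ z.2 = pcoset 'F_7 M, M \in SL 2 'F_7 & acts_as z.1 M].
  move: z; apply: gen_ind.
  - exists 1%g; split; [by rewrite pcoset1|exact: group1|].
    by move=> v _; rewrite conjsg1 GL_1E mulmx1.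
  - move=> z /set2P[]->.
      exists T; split=> //.
        by rewrite inE sl2TE det_mx2 !mulr1 mulr0 subr0.
      move=> v v0; rewrite W_acts // sl2TE slope_T; congr W.
      have /hl/andP[/eqP h _] : slope v \in iota 0 8 by rewrite mem_iota slope_lt.
      exact: h.
    exists S; split=> //.
      by rewrite inE sl2SE det_mx2 mulr0 mul1r opprK add0r.
    move=> v v0; rewrite W_acts // sl2SE slope_S //; congr W.
    have /hl/andP[_ /eqP h] : slope v \in iota 0 8 by rewrite mem_iota slope_lt.
    exact: h.
  move=> y z [M [yM MS hM]] [N [zN NS hN]]; exists (M * N)%g; split.
  - by rewrite -[(y * z)%g.2]/(y.2 * z.2)%g yM zN pcosetM.
  - exact: SL2M.
  move=> v v0; rewrite -[(y * z)%g.1]/(y.1 * z.1)%g conjsgM hM // hN ?GL_MxE ?mulmxA //.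
  have uM : GLval M \in unitmx := GL_unitmx M.
  by apply: contraNneq v0 => h; rewrite -(mulmxK uM v) h mul0mx.
apply: (pair_isog _ _ X (Gam :&: Wgroup r)%G
  (SL_group 2 'F_7 / (SL_group 2 'F_7 :&: scalGL_group 2 'F_7))%G).
- move=> y /X_act[M [yM MS hM]]; have {yM} -> : y = pcoset 'F_7 M := yM.
  have scM : is_scalar_mx (GLval M).
    apply: slope_fixed => v v0.
    have : (W (nth 0%N l (slope v)) :^ 1)%g = W (nth 0%N l (slope (v *m GLval M))) := hM v v0.
    rewrite conjsg1 => /(W_inj _ _ F25 alpha2) e.
    have /eqP := e (l8 _) (l8 _).
    by rewrite nth_uniq ?sz ?slope_lt // eq_sym => /eqP.
  rewrite /pcoset coset_id //; apply/setIP; split=> //.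
  by rewrite inE.
- apply/subsetP => x /imsetP[z /set2P[]-> ->]; apply/setIP; split; try exact: Pw_group.
    by rewrite -[gval (Wgroup r)]/(W r) -[_.1]/(Pw wT) mem_W_word ?rT.
  by rewrite -[gval (Wgroup r)]/(W r) -[_.1]/(Pw wS) mem_W_word ?rS.
- apply: subset_trans (PSL2_gen 'F_7 nF) (genS _).
  apply/subsetP => y /set2P[]->; apply/imsetP.
    by exists (Pw wT, pcoset 'F_7 T) => //; exact: set21.
  by exists (Pw wS, pcoset 'F_7 S) => //; exact: set22.
by rewrite card_H; exact: card_PSL2.
Qed.

(** The index [b] corresponds to the triple {4, 5, 6}, so the isomorphism with A_7 carries its
    stabilizer onto the setwise stabilizer of that triple. *)
Lemma triple_isog b : b \in [:: 38; 73]%N -> Gam :&: W b \isog A4x3_2.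
Proof.
move=> hb; have b150 : (b + 35 < 150)%N by move: hb; rewrite !inE => /orP[]/eqP->.
have [f [fi fG fE]] := sevenP _ _ F25 alpha2.
have hb150 : (b < 150)%N by exact: leq_ltn_trans (leq_addr 35 b) b150.
have step w k : letters_below 5 w -> (k < 35)%N -> exists k', [/\ (k' < 35)%N,
    acts w (b + k) = (b + k')%N &
    forall x : 'I_7, (val (sigmaw w x) \in nth [::] triples k') = (val x \in nth [::] triples k)].
  elim: w k => [|s w ih] k; first by exists k; split => // x; rewrite /sigmaw big_nil perm1.
  case/andP => hs hw hk.
  have /allP/(_ k) := allP triples_ok _ hb; rewrite mem_iota => /(_ hk)/allP/(_ s).
  rewrite mem_iota => /(_ hs) /and3P[k1lt /eqP e1 /allP h1].
  have [k2 [k2lt e2 h2]] := ih _ hw k1lt.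
  exists k2; split => // [|x]; first by rewrite -e2 -e1.
  rewrite /sigmaw big_cons permM h2.
  have hx : val x \in iota 0 7 by rewrite mem_iota /=.
  rewrite -(eqP (h1 _ hx)).
  by rewrite -sigmaw_pact /sigmaw ?big_seq1 // /letters_below /= hs.
have [/allP t0 /allP t0u] := andP triple0_ok.
have mem0 (x : 'I_7) : (val x \in nth [::] triples 0) = (4 <= x)%N.
  by apply/eqP/t0; rewrite mem_iota /=.
have stab w : letters_below 5 w ->
    (acts w b == b) = (sigmaw w @: [set i : 'I_7 | (4 <= i)%N] == [set i : 'I_7 | (4 <= i)%N]).
  move=> hw; have [k [k35 e h]] := step w 0 hw isT; rewrite addn0 in e.
  have -> : (acts w b == b) = (k == 0)%N by rewrite e -{2}[b]addn0 eqn_add2l.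
  apply/eqP/eqP => [k0|im].
    apply/setP => y; rewrite inE -mem0; apply/imsetP/idP => [[x]|hy].
      by rewrite inE -mem0 -(h x) k0 => hx ->.
    exists ((sigmaw w)^-1 y)%g; last by rewrite permKV.
    by rewrite inE -mem0 -(h _) k0 permKV.
  have : all (fun x => (x \in nth [::] triples k) == (4 <= x)%N) (iota 0 7).
    apply/allP => y; rewrite mem_iota => y7; pose y' : 'I_7 := Ordinal y7.
    rewrite -[y]/(val y') -{1}(permKV (sigmaw w) y') h mem0.
    have := mem_imset [set i : 'I_7 | (4 <= i)%N] ((sigmaw w)^-1 y')%g (@perm_inj _ (sigmaw w)).
    by rewrite im permKV !inE => ->.
  by move=> hk; have /t0u : k \in iota 0 35; [rewrite mem_iota|rewrite hk => /eqP].
have fH : (f @* (Gam :&: Wgroup b))%g = A4x3_2.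
  apply/setP => y; apply/morphimP/idP => [[x xG /setIP[_ xW] ->]|].
    have [w hw xw] := groupP_word _ _ _ _ xG; have : x \in W b := xW.
    have w6 := letters_below_leq 5 6 _ isT hw.
    rewrite {1}xw (mem_W_word _ _ F25 alpha2 _ _ w6 hb150) (stab _ hw) => hb'.
    rewrite xw (fE _ hw) inE hb' andbT -fG -(fE _ hw).
    by apply: mem_morphim; exact: Pw_group.
  rewrite inE => /andP[]; rewrite -{1}fG => /morphimP[x xG _ ->].
  have [w hw xw] := groupP_word _ _ _ _ xG; rewrite xw (fE _ hw) -(stab _ hw) => hb'.
  exists (Pw w); [exact: Pw_group| |by rewrite (fE _ hw)].
  apply/setIP; split; first exact: Pw_group.
  suff : Pw w \in W b by [].
  by rewrite (mem_W_word _ _ F25 alpha2 _ _ (letters_below_leq 5 6 _ isT hw) hb150).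
by rewrite -fH; apply: sub_isog fi; exact: subsetIl.
Qed.

Lemma inter_type k : (0 < k < 7)%N -> let H := Gam :&: W (orbit_rep k) in
  [\/ H \isog 'Alt_('I_6), H \isog PSL 2 'F_7, H \isog A4x3_2 | H \isog 'Alt_('I_5)].
Proof.
move=> hk; have := card_stab _ _ F25 alpha2 k (proj2 (andP hk)).
case: k hk => [|[|[|[|[|[|[|k]]]]]]] // _; rewrite [stab_card _]/= [orbit_rep _]/= => cH.
- by constructor 1; apply: (alt_isog _ _ F25 alpha2 _ _ _ alt6_ok) => //; rewrite cH.
- by constructor 2; apply: (psl_isog _ _ _ _ psl8_ok).
- by constructor 2; apply: (psl_isog _ _ _ _ psl23_ok).
- by constructor 3; apply: triple_isog.
- by constructor 3; apply: triple_isog.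
- by constructor 4; apply: (alt_isog _ _ F25 alpha2 _ _ _ alt5_ok) => //; rewrite cH.
Qed.

Lemma pair_types i j : (i < 150)%N -> (j < 150)%N -> i != j -> let H := W i :&: W j in
  [\/ H \isog 'Alt_('I_6), H \isog PSL 2 'F_7, H \isog A4x3_2 | H \isog 'Alt_('I_5)].
Proof.
move=> hi hj ij H; have [w hw [wi [k k7 wj]]] := pair_to_rep _ _ hi hj.
have k0 : (0 < k)%N.
  rewrite lt0n; apply: contra ij => /eqP k0.
  by rewrite -(acts_invK _ _ hw hi) -(acts_invK _ _ hw hj) wi wj k0.
have e : ((Wgroup i :&: Wgroup j) :^ Pw w)%g = Gam :&: W (orbit_rep k).
  by rewrite conjIg -[gval (Wgroup i)]/(W i) -[gval (Wgroup j)]/(W j) !W_acts // wi wj W0.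
have HE : H \isog Gam :&: W (orbit_rep k).
  by rewrite -e; exact: (conj_isog (Wgroup i :&: Wgroup j)%G).
have k07 : (0 < k < 7)%N by rewrite k0.
have trans (gT : finGroupType) (L : {group gT}) : Gam :&: W (orbit_rep k) \isog L -> H \isog L.
  exact: (@isog_trans _ _ _ (Wgroup i :&: Wgroup j)%G (Gam :&: Wgroup (orbit_rep k))%G).
case: (inter_type k k07) => h.
- by constructor 1; exact: trans h.
- constructor 2.
  exact: (trans _ (SL_group 2 'F_7 / (SL_group 2 'F_7 :&: scalGL_group 2 'F_7))%G h).
- by constructor 3; exact: (trans _ (Group A4x3_2_group_set) h).
- by constructor 4; exact: trans h.
Qed.

End InterTypes.

(** * Generation by Delta and a conjugate *)

Lemma index2_square (gT : finGroupType) (G K : {group gT}) x :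
  K \subset G -> #|G : K| = 2%N -> x \in G -> (x * x)%g \in K.
Proof.
move=> KG iK xG; have nK := normal_norm (index2_normal KG iK).
have xN := subsetP nK x xG.
rewrite coset_idr ?groupM // morphM // -expg2.
have /expg_cardG : coset K x \in (G / K)%g by apply: mem_morphim.
by rewrite card_quotient // iK.
Qed.

(** A subgroup of index 2 contains all squares, hence all 3-cycles, since a 3-cycle is the square of
    its inverse; and 3-cycles are enough to sift A_4. *)
Lemma Alt4_no_index2 (gT : finGroupType) (A K : {group gT}) :
  A \isog 'Alt_('I_4) -> K \subset A -> #|A : K| <> 2%N.
Proof.
move=> isoA KA iK; case/isogP: (isoA) => f fi fA.
have sq u : u \in 'Alt_('I_4) -> (u * u)%g \in (f @* K)%g.
  rewrite -fA => /morphimP[x xA _ ->]; rewrite -morphM //.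
  by apply: mem_morphim; [exact: groupM|exact: (index2_square _ A)].
have : 'Alt_('I_4) \subset (f @* K)%g.
  apply: sift_sub => // k s hk sA sfix; have hks := fix_lower_ge _ _ _ sfix.
  have [e|ne] := eqVneq (s k) k; first by exists 1%g; rewrite ?group1 // e; split=> [j _|]; rewrite perm1.
  (* The third point of the 3-cycle is taken above [k], so that the points below [k] stay fixed; 3
     works unless it is already [s k], and then 2 does. *)
  have [z zk zs] : exists2 z : 'I_4, (k < z)%N & z != s k.
    have [e3|n3] := eqVneq (s k : nat) 3%N.
      exists (inord 2); first by rewrite inordK //; lia.
      by rewrite -val_eqE /= inordK // e3.
    exists (inord 3); first by rewrite inordK //; lia.
    by rewrite -val_eqE /= inordK // eq_sym.
  have kz : z != k by rewrite -val_eqE /= neq_ltn zk orbT.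
  pose c := (tperm k z * tperm k (s k))%g.
  have cA : c \in 'Alt_('I_4).
    by rewrite Alt_even odd_permM !odd_tperm (eq_sym k z) kz (eq_sym k) ne.
  exists (c * c)%g; first by rewrite inE sq // groupM.
  split=> [j jk|]; rewrite permM.
    have jk' : k != j by rewrite -val_eqE /= neq_ltn jk orbT.
    have js : s k != j by rewrite -val_eqE /= neq_ltn (leq_trans jk hks) orbT.
    have jz : z != j by rewrite -val_eqE /= neq_ltn (ltn_trans jk zk) orbT.
    by rewrite /c !permM !(tpermD jk' jz, tpermD jk' js).
  have -> : c k = z by rewrite /c permM tpermL tpermD // eq_sym.
  by rewrite /c permM tpermR tpermL.
rewrite -fA => /subset_leq_card; rewrite !card_injm // => le.
have := cardG_gt0 K; move: le; rewrite -(Lagrange KA) iK.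
by move: #|K| => m; lia.
Qed.

Lemma card_Alt4 (gT : finGroupType) (A : {group gT}) : A \isog 'Alt_('I_4) -> #|A| = 12%N.
Proof. by move/card_isog->; apply/double_inj; rewrite -mul2n card_Alt ?card_ord. Qed.

(** Orbit sizes divide 12, and size 2 would give a stabilizer of index 2. *)
Lemma Alt4_orbit_card (T : finType) (A : {group {perm T}}) (x : T) : A \isog 'Alt_('I_4) ->
  #|orbit 'P A x| \in [:: 1; 3; 4; 6; 12]%N.
Proof.
move=> isoA; have := dvdn_orbit 'P A x; rewrite (card_Alt4 _ _ isoA).
have : #|orbit 'P A x| != 2%N.
  by rewrite card_orbit; apply/eqP/(Alt4_no_index2 _ _ _ isoA); exact: subsetIl.
have := @dvdn_leq #|orbit 'P A x| 12 isT.
move: #|_| => n le n2 n12; have := le n12.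
by move: n n2 n12 {le}; do 13?case.
Qed.

Lemma orbit1_fix (T : finType) (A : {group {perm T}}) (x : T) :
  #|orbit 'P A x| = 1%N -> forall s, s \in A -> s x = x.
Proof.
move/eqP/cards1P => [y oy] s sA.
have := mem_orbit 'P x sA; have := orbit_refl 'P A x; rewrite oy => /set1P-> /set1P.
by [].
Qed.

Definition fix3 (c : 'I_7) : {set 'S_7} :=
  [set s in 'Alt_('I_7) | [&& s c == c, s (pt7 5) == pt7 5 & s (pt7 6) == pt7 6]].

(** The four remaining points have 24 permutations, and multiplication by a transposition matches
    the even ones in question with as many odd ones. *)
Lemma card_fix3 (c : 'I_7) : (c < 5)%N -> (#|fix3 c| <= 12)%N.
Proof.
move=> c5; pose B := [set x : 'I_7 | x \notin [:: c; pt7 5; pt7 6]].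
have v5 : val (pt7 5) = 5%N by rewrite /= inordK.
have v6 : val (pt7 6) = 6%N by rewrite /= inordK.
have cB : #|B| = 4%N.
  have -> : B = ~: [set x in [:: c; pt7 5; pt7 6]] by apply/setP => x; rewrite !inE.
  rewrite cardsCs setCK cardsE (card_uniqP _) ?card_ord //=.
  rewrite !inE -!val_eqE !v5 !v6 /= andbT; lia.
have [p [q [pB qB pq]]] : exists p q, [/\ p \in B, q \in B & p != q].
  have : (1 < #|B|)%N by rewrite cB.
  by case/card_gt1P => p [q [? ? ?]]; exists p, q.
pose t := tperm p q.
have sub : fix3 c :|: fix3 c :* t \subset perm.Sym B.
  have fB s : s \in fix3 c -> s \in perm.Sym B.
    case/setIdP => _ /and3P[/eqP h1 /eqP h2 /eqP h3]; rewrite inE; apply/subsetP => x.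
    by apply: contraNT; rewrite !inE negbK => /or3P[]/eqP->; apply/eqP.
  apply/subsetP => s /setUP[/fB //|/rcosetP[u /fB uB ->]].
  rewrite groupM // inE; apply/subsetP => x; rewrite !inE /t.
  by case: tpermP => [->|->|_ _ /eqP //] _; move: pB qB; rewrite !inE.
have := subset_leq_card sub; rewrite perm.card_Sym cB.
have dis : [disjoint fix3 c & fix3 c :* t].
  apply/pred0P => s /=; apply/negP => /andP[/setIdP[]]; rewrite Alt_even => se _.
  case/rcosetP => u /setIdP[]; rewrite Alt_even => ue _ su.
  by move: se; rewrite su odd_permM (negPf ue) odd_tperm pq.
rewrite cardsU (disjoint_setI0 dis) cards0 subn0 card_rcoset.
by rewrite addnn -mul2n (_ : 4`! = 2 * 12)%N // leq_pmul2l.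
Qed.

(* A_4 has no orbit of size 2 or 5, so [A] fixes 5, 6 and a point of [{0, ..., 4}]. *)
Lemma Alt4_fix3 (A : {group 'S_7}) : A \isog 'Alt_('I_4) -> A \subset 'Alt_('I_7) ->
  (forall s (x : 'I_7), s \in A -> (x < 5)%N -> (s x < 5)%N) ->
  exists2 c : 'I_7, (c < 5)%N & A = fix3 c :> {set _}.
Proof.
move=> isoA AA st; pose X5 := [set x : 'I_7 | (x < 5)%N].
have o5 (x : 'I_7) : (x < 5)%N -> orbit 'P A x \subset X5.
  by move=> hx; apply/subsetP => y /orbitP[s sA <-]; rewrite inE; exact: st.
have cX5 : #|X5| = 5%N by rewrite cardsE cardE size_filter -(count_map val (fun x => x < 5)%N) -enumT val_enum_ord.
have st' s (x : 'I_7) : s \in A -> (5 <= x)%N -> (5 <= s x)%N.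
  move=> sA; apply: contraLR; rewrite -!ltnNge => h.
  by rewrite -[x](permK s); apply: st; rewrite ?groupV.
have o2 (x : 'I_7) : (5 <= x)%N -> forall s, s \in A -> s x = x.
  move=> hx; apply: orbit1_fix.
  have sub : orbit 'P A x \subset ~: X5.
    by apply/subsetP => y /orbitP[s sA <-]; rewrite !inE -leqNgt; exact: st'.
  have := subset_leq_card sub; rewrite [#|~: X5|]cardsCs setCK cX5 card_ord.
  have := Alt4_orbit_card _ _ x isoA; rewrite !inE.
  by move: #|orbit 'P A x| => n; lia.
have [c c5 fc] : exists2 c : 'I_7, (c < 5)%N & forall s, s \in A -> s c = c.
  pose z := pt7 0; have z5 : (z < 5)%N by rewrite inordK.
  have sz := subset_leq_card (o5 z z5); rewrite cX5 in sz.
  have : X5 :\: orbit 'P A z != set0.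
    rewrite -card_gt0 cardsD (setIidPr (o5 z z5)) cX5.
    have := Alt4_orbit_card _ _ z isoA; rewrite !inE; move: sz.
    by move: #|orbit 'P A z| => n; lia.
  case/set0Pn => y /setDP[]; rewrite inE => y5 yz.
  have [z1|z1] := eqVneq #|orbit 'P A z| 1%N; first by exists z => //; exact: orbit1_fix.
  exists y => //; apply: orbit1_fix.
  have sub : orbit 'P A y \subset X5 :\: orbit 'P A z.
    rewrite subsetD o5 //=; apply/pred0P => x /=; apply/negP => /andP[xy xz].
    by case/negP: yz; apply: orbit_trans xz; rewrite orbit_sym.
  (* The first orbit has size 3 or 4, so at most two of the five points are left, and an orbit among
     them can only have size 1. *)
  have := subset_leq_card sub; rewrite cardsD (setIidPr (o5 z z5)) cX5.
  have := Alt4_orbit_card _ _ y isoA; have := Alt4_orbit_card _ _ z isoA; rewrite !inE.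
  by move: z1 sz; move: #|orbit 'P A y| #|orbit 'P A z| => n m; lia.
exists c => //; apply/eqP; rewrite eqEcard (card_Alt4 _ _ isoA) card_fix3 // andbT.
apply/subsetP => s sA; apply/setIdP; split; first exact: (subsetP AA).
by rewrite fc // !o2 ?eqxx ?inordK.
Qed.

Lemma in_D_moves : all (fun s => all (fun x => (pact [:: s] x < 5)%N) (iota 0 5)) (iota 1 4).
Proof. by vm_compute. Qed.

Lemma D_chain_ok : all (fun k => all (fun y => let w := iota k.+1 y in
    [&& in_D w, (pact w k == k + y)%N & all (fun j => pact w j == j) (iota 0 k)])
  (iota 0 (5 - k))) (iota 0 5).
Proof. by vm_compute. Qed.

Definition in_fix3_words : seq (seq nat) := [:: [:: 3; 2]; [:: 4; 3]]%N.

Lemma fix3_words_ok : all (fun w => in_D w &&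
  all (fun x => (pact w x == x)) [:: 0; 5; 6]%N) in_fix3_words.
Proof. by vm_compute. Qed.

Lemma fix3_words_fixed : all (fun x =>
  all (fun w => pact w x == x) in_fix3_words ==> (x \in [:: 0; 5; 6])) (iota 0 7)%N.
Proof. by vm_compute. Qed.

Definition fixed_by_words (i : nat) : bool := all (fun w => acts w i == i) in_fix3_words.

(** The word of coset [i] carries the neighbours 1, ..., 7 of the index 0 to those of [i]. *)
Lemma fixed_neighbours : all (fun i => fixed_by_words i &&
    (2 < count fixed_by_words [seq acts (coset_word i) j | j <- iota 1 7])%N ==> (i == 0%N))
  (iota 0 150).
Proof. by vm_compute. Qed.

(** Letter 0 acts on the seven points as a 3-cycle on 0, 5 and 6; its powers are the rotations used
    below. *)
Lemma rotation_ok : all (fun x => has (fun k => pact (nseq k 0%N) x == 0%N) (iota 0 3)) [:: 0; 5; 6]%N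
  && all (fun x => (pact [:: 0%N] x \in [:: 0; 5; 6]) == (x \in [:: 0; 5; 6]))%N (iota 0 7).
Proof. by vm_compute. Qed.

(** * Normalizer of the distinguished A_4, and joins with Delta *)

Section GeneratedByDelta.

Variables (F : finFieldType) (alpha : F).
Hypotheses (F25 : #|F| = 25%N) (alpha2 : alpha ^+ 2 = 2).

Local Notation PGL3 := (PGLtype 3 F).
Local Notation Pw := (Pw F alpha).
Local Notation W := (W F alpha).
Local Notation Gam := (letters_group F alpha (iota 0 5)).
Local Notation PGU := (letters_group F alpha (iota 0 6)).
Local Notation Del := (letters_group F alpha (iota 1 4)).

Lemma in_D_below w : in_D w -> letters_below 5 w.
Proof. by apply: sub_all => s /andP[]. Qed.

Lemma Del_word g : g \in Del -> exists2 w, in_D w & g = Pw w.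
Proof. by case/letters_genP => w /sub_in_D wD ->; exists w. Qed.

Lemma word_Del w : in_D w -> Pw w \in Del.
Proof. by move/in_D_sub => h; exact: Pw_gen. Qed.

Lemma Del_sub_Gam : Del \subset Gam.
Proof. by apply/subsetP => g /Del_word[w /in_D_below w5 ->]; exact: Pw_group. Qed.

Lemma sigmaw_in_D w (x : 'I_7) : in_D w -> (x < 5)%N -> (sigmaw w x < 5)%N.
Proof.
elim: w x => [|s w ih] x; first by rewrite /sigmaw big_nil perm1.
case/andP => hs hw hx; rewrite /sigmaw big_cons permM; apply: ih => //.
have s5 : (s < 5)%N by case/andP: hs.
have -> : sigma s x = sigmaw [:: s] x by rewrite /sigmaw big_seq1.
rewrite sigmaw_pact /letters_below /= ?s5 //.
by apply: (allP (allP in_D_moves s _) (val x)); rewrite mem_iota.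
Qed.

Section WithMorphism.

Variable f : {morphism Gam >-> 'S_7}.
Hypotheses (fi : 'injm f) (fG : (f @* Gam = 'Alt_('I_7))%g).
Hypothesis fE : forall w, letters_below 5 w -> f (Pw w) = sigmaw w.

Lemma f_word g : g \in Gam -> exists2 w, letters_below 5 w & g = Pw w /\ f g = sigmaw w.
Proof. by case/groupP_word => w hw ->; exists w => //; rewrite fE. Qed.

Lemma f_Alt g : g \in Gam -> f g \in 'Alt_('I_7).
Proof. by move=> gG; rewrite -fG mem_morphim. Qed.

Lemma stab5_group_set : group_set
  [set s in 'Alt_('I_7) | [forall x : 'I_7, (x < 5)%N ==> (s x < 5)%N]].
Proof.
apply/group_setP; split=> [|s t].
  apply/setIdP; split; first exact: group1.
  by apply/forallP => x; rewrite perm1; apply/implyP.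
move=> /setIdP[sA /forallP hs] /setIdP[tA /forallP ht]; apply/setIdP; split; first exact: groupM.
by apply/forallP => x; apply/implyP => hx; rewrite permM; apply/(implyP (ht _))/(implyP (hs _)).
Qed.

(** Delta realizes every even permutation preserving {0, ..., 4}. Sifting on seven points stops
    exactly at the level 4, so the words of [D_chain_ok] in the letters of Delta suffice. *)
Lemma Del_stab g : g \in Gam -> (forall x : 'I_7, (x < 5)%N -> (f g x < 5)%N) -> g \in Del.
Proof.
move=> gG st; have : Group stab5_group_set \subset (f @* Del)%g.
  apply: sift_sub => [|k s hk]; first by apply/subsetP => s /setIdP[].
  move=> /setIdP[sA /forallP hs] sfix; have hks := fix_lower_ge _ _ _ sfix.
  have k5 : (k < 5)%N by [].
  have sk5 : (s k < 5)%N := implyP (hs k) k5; set y := (s k - k)%N.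
  have hy : y \in iota 0 (5 - k) by rewrite mem_iota /y; lia.
  have := allP (allP D_chain_ok (val k) _) y hy; rewrite mem_iota => /(_ k5) /and3P[wD /eqP h1 /allP h2].
  have w5 := in_D_below _ wD.
  exists (sigmaw (iota k.+1 y)).
    apply/setIP; split; first by rewrite -fE // mem_morphim ?word_Del // Pw_group.
    apply/setIdP; split; first by rewrite -fE // f_Alt // Pw_group.
    by apply/forallP => x; apply/implyP; exact: sigmaw_in_D.
  split=> [j jk|]; apply: val_inj; rewrite /= sigmaw_pact //.
    by apply/eqP/h2; rewrite mem_iota.
  by rewrite h1 /y subnKC.
move/subsetP/(_ (f g)) => h; rewrite -(injmK fi (Del_sub_Gam)); apply/morphpreP; split=> //.
apply: h; apply/setIdP; split; first exact: f_Alt.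
by apply/forallP => x; apply/implyP; exact: st.
Qed.

Lemma Del_f g (x : 'I_7) : g \in Del -> (x < 5)%N -> (f g x < 5)%N.
Proof. by case/Del_word => w wD -> hx; rewrite fE ?in_D_below //; exact: sigmaw_in_D. Qed.

Definition A0 : {set PGL3} := [set g in Gam | f g \in fix3 (pt7 0)].

Lemma card_A0 : (#|A0| <= 12)%N.
Proof.
apply: leq_trans (card_fix3 (pt7 0) _); last by rewrite inordK.
rewrite -(@card_in_imset _ _ f A0) => [|x y /setIdP[xG _] /setIdP[yG _]]; last exact: (injmP fi).
by apply/subset_leq_card/subsetP => _ /imsetP[x /setIdP[_ h] ->].
Qed.

Lemma ge5_pt7 (x : 'I_7) : (5 <= x)%N -> x = pt7 5 \/ x = pt7 6.
Proof.
move=> hx; have : (x : nat) = 5%N \/ (x : nat) = 6%N by have := ltn_ord x; lia.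
by case=> e; [left|right]; apply: val_inj; rewrite /= inordK.
Qed.

Lemma fix3_conj s u c : s \in fix3 c -> u \in 'Alt_('I_7) -> u c = pt7 0 ->
  (forall x : 'I_7, (x < 5)%N -> (u x < 5)%N) -> (s ^ u)%g \in fix3 (pt7 0).
Proof.
case/setIdP => sA /and3P[/eqP sc /eqP s5 /eqP s6] uA uc u5.
have high (y : 'I_7) : (5 <= y)%N -> (s ^ u)%g y == y.
  move=> hy; have hz : (5 <= (u^-1)%g y)%N.
    by move: hy; apply: contraLR; rewrite -!ltnNge => /u5; rewrite permKV.
  rewrite -{1}(permKV u y) permJ.
  by case: (ge5_pt7 _ hz) => e; [rewrite e s5|rewrite e s6]; rewrite -e permKV.
apply/setIdP; split; first by rewrite groupJ.
by rewrite (high (pt7 5)) ?(high (pt7 6)) ?inordK // -uc permJ sc eqxx.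
Qed.

Lemma A4_conj_A0 (A : {group PGL3}) : A \subset Del -> A \isog 'Alt_('I_4) ->
  exists2 d, d \in Del & (A :^ d)%g = A0.
Proof.
move=> AD isoA; have AG := subset_trans AD Del_sub_Gam.
have [|||c c5 fA] := Alt4_fix3 (f @* A)%G.
- by apply: isog_trans isoA; rewrite isog_sym; exact: sub_isog.
- by apply/subsetP => _ /morphimP[a aG _ ->]; exact: f_Alt.
- by move=> _ x /morphimP[a _ aA ->]; apply: Del_f; exact: (subsetP AD).
(* The descending product of adjacent exchanges moves the fixed point [c] to 0 inside Delta. *)
have : all (fun c => in_D (rev (iota 1 c)) && (pact (rev (iota 1 c)) c == 0)%N) (iota 0 5).
  by vm_compute.
move/allP/(_ (val c)); rewrite mem_iota => /(_ c5) /andP[wD /eqP wc].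
set w := rev _ in wD wc; have w5 := in_D_below _ wD.
exists (Pw w); first exact: word_Del.
have dG : Pw w \in Gam by exact: Pw_group.
apply/eqP; rewrite eqEcard cardJg (card_Alt4 _ _ isoA) card_A0 andbT.
apply/subsetP => _ /imsetP[a aA ->]; apply/setIdP.
have aG : a \in Gam := subsetP AG _ aA.
split; first exact: groupJ.
rewrite morphJ //; apply: (fix3_conj _ _ c).
- by rewrite -fA mem_morphim.
- exact: f_Alt.
- by rewrite fE //; apply: val_inj; rewrite /= sigmaw_pact // wc inordK.
- by move=> x; apply: Del_f; exact: word_Del.
Qed.

Lemma fix3_word_A0 w : w \in in_fix3_words -> Pw w \in A0.
Proof.
move=> hw; have /andP[wD /allP hfix] := allP fix3_words_ok _ hw.
have w5 := in_D_below _ wD; have wG : Pw w \in Gam by exact: Pw_group.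
have fx k : k \in [:: 0; 5; 6]%N -> sigmaw w (pt7 k) == pt7 k.
  move=> hk; have k7 : (k < 7)%N by move: hk; rewrite !inE => /or3P[]/eqP->.
  by apply/eqP/val_inj; rewrite /= sigmaw_pact // inordK // (eqP (hfix _ hk)).
apply/setIdP; split=> //; apply/setIdP; split; first exact: f_Alt.
by rewrite fE // !fx.
Qed.

Lemma A0_W a k : a \in A0 -> k \in [:: 0; 5; 6]%N -> a \in W k.+1.
Proof.
case/setIdP => aG; case/setIdP => _ /and3P[h0 h5 h6] hk.
have [w w5 [aw fw]] := f_word _ aG; rewrite aw in h0 h5 h6 fw *.
have k7 : (k < 7)%N by move: hk; rewrite !inE => /or3P[]/eqP->.
have k150 : (k.+1 < 150)%N by apply: leq_trans (_ : 8 <= 150)%N.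
rewrite (mem_W_word _ _ F25 alpha2 _ _ (letters_below_leq 5 6 _ isT w5) k150).
have -> : k.+1 = (val (pt7 k)).+1 by rewrite /= inordK.
rewrite -sigmaw_acts // -fw eqSS val_eqE.
by move: hk; rewrite !inE => /or3P[]/eqP->.
Qed.

(* [A0] lies in Gamma and in three of its seven neighbours, so the same holds for the
   conjugate of Gamma by [n]; by [fixed_neighbours] only Gamma has this property. *)
Lemma norm_A0_Gam n : n \in PGU -> (A0 :^ n)%g = A0 -> n \in Gam.
Proof.
case/(PGU_coset _ _ F25 alpha2) => i [hi [x xG ->]] nA.
suff i0 : i = 0%N by rewrite i0 Pw_coset0 mulg1.
have [u u5 [xu fx]] := f_word _ xG.
have u6 := letters_below_leq 5 6 _ isT u5.
have ri := coset_word_below _ hi.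
have in_n w (A : {set PGL3}) : A0 \subset A -> w \in in_fix3_words -> Pw w \in (A :^ (x * Pw (coset_word i)))%g.
  move=> sA hw; have sAn : (A0 :^ (x * Pw (coset_word i)))%g \subset (A :^ (x * Pw (coset_word i)))%g.
    by rewrite conjSg.
  by apply: (subsetP sAn); rewrite nA fix3_word_A0.
have w6 w : w \in in_fix3_words -> letters_below 6 w.
  by move/(allP fix3_words_ok)/andP => [/in_D_below h _]; exact: (letters_below_leq 5).
have fix_i : fixed_by_words i.
  apply/allP => w hw; rewrite -(mem_W_word _ _ F25 alpha2 _ _ (w6 _ hw) hi).
  have := in_n w Gam _ hw; rewrite conjsgM (conjGid xG); apply.
  by apply/subsetP => a /setIdP[].
have fix_j k : k \in [:: 0; 5; 6]%N -> fixed_by_words (acts (coset_word i) (acts u k.+1)).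
  move=> hk; have k150 : (k.+1 < 150)%N by move: hk; rewrite !inE => /or3P[]/eqP->.
  have uk : (acts u k.+1 < 150)%N by exact: acts_lt.
  apply/allP => w hw.
  rewrite -(mem_W_word _ _ F25 alpha2 _ _ (w6 _ hw) (acts_lt _ _ ri uk)).
  rewrite -(W_acts _ _ F25 alpha2 _ _ ri uk) -(W_acts _ _ F25 alpha2 _ _ u6 k150).
  by rewrite -xu -conjsgM; apply: in_n => //; apply/subsetP => a aA0; exact: A0_W.
have := allP fixed_neighbours i; rewrite mem_iota => /(_ hi)/implyP h; apply/eqP/h.
rewrite fix_i andTb count_map -size_filter.
pose l := [seq acts u k.+1 | k <- [:: 0; 5; 6]%N].
have ul : uniq l.
  rewrite map_inj_in_uniq // => j k hj hk /(congr1 (acts (word_inv u))).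
  have lt y : y \in [:: 0; 5; 6]%N -> (y.+1 < 150)%N by rewrite !inE => /or3P[]/eqP->.
  by rewrite !acts_invK ?lt // => [[]].
apply: (@uniq_leq_size _ l) => // y /mapP[k hk ->].
rewrite mem_filter; apply/andP; split; first exact: fix_j.
rewrite mem_iota.
have k7 : (k < 7)%N by move: hk; rewrite !inE => /or3P[]/eqP->.
have -> : k.+1 = (val (pt7 k)).+1 by rewrite /= inordK.
by rewrite -sigmaw_acts //= ltnS ltn_ord.
Qed.

(** A normalizing element permutes the common fixed points of [A0], and two words in [A0] already
    have no common fixed points besides 0, 5 and 6. *)
Lemma norm_A0_frame n (p : 'I_7) : n \in Gam -> (A0 :^ n)%g = A0 ->
  val p \in [:: 0; 5; 6]%N -> val (f n p) \in [:: 0; 5; 6]%N.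
Proof.
move=> nG nA hp; have := allP fix3_words_fixed (val (f n p)).
rewrite mem_iota => /(_ (ltn_ord _))/implyP; apply; apply/allP => w hw.
have /andP[wD _] := allP fix3_words_ok _ hw; have w5 := in_D_below _ wD.
rewrite -sigmaw_pact // val_eqE -fE //.
have := fix3_word_A0 _ hw; rewrite -{1}nA => /imsetP[a /setIdP[aG a3] ->].
rewrite morphJ // permJ; suff -> : f a p = p by [].
case/setIdP: a3 => _ /and3P[/eqP h0 /eqP h5 /eqP h6].
by move: hp; rewrite !inE => /or3P[]/eqP e;
  [rewrite (_ : p = pt7 0)|rewrite (_ : p = pt7 5)|rewrite (_ : p = pt7 6)] => //;
  apply: val_inj; rewrite e /= inordK.
Qed.

(** A rotation brings the image of 0 back to 0. The product then preserves {5, 6}, hence {0, ...,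
    4}, and so lies in Delta. *)
Lemma norm_A0 n : n \in PGU -> (A0 :^ n)%g = A0 ->
  exists2 k, (k < 3)%N & (n * Pw (nseq k 0%N))%g \in Del.
Proof.
move=> nP nA; have nG := norm_A0_Gam _ nP nA.
have v0 : val (pt7 0) = 0%N by rewrite /= inordK.
have h0 : val (f n (pt7 0)) \in [:: 0; 5; 6]%N by apply: norm_A0_frame; rewrite ?v0.
have [/allP rot /allP rotB] := andP rotation_ok.
have /hasP[k] := rot _ h0; rewrite mem_iota => k3 /eqP rk.
have r5 m : letters_below 5 (nseq m 0%N) by apply/allP => s /nseqP[->].
have rG m : Pw (nseq m 0%N) \in Gam by exact: Pw_group.
have rB m (x : 'I_7) : (val (sigmaw (nseq m 0%N) x) \in [:: 0; 5; 6]%N) = (val x \in [:: 0; 5; 6]%N).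
  elim: m x => [|m ih] x; first by rewrite /sigmaw big_nil perm1.
  rewrite -[nseq _ _]/([:: 0%N] ++ nseq m 0%N) sigmaw_cat permM ih.
  have -> : val (sigmaw [:: 0%N] x) = pact [:: 0%N] x by exact: sigmaw_pact.
  by apply/eqP/rotB; rewrite mem_iota; exact: (ltn_ord x).
exists k => //; apply: Del_stab; first by rewrite groupM.
move=> x hx; rewrite morphM // permM fE //.
have nB : (val (f n x) \in [:: 0; 5; 6]%N) = (val x \in [:: 0; 5; 6]%N).
  apply/idP/idP => [h|]; last exact: norm_A0_frame.
  have nV : (A0 :^ n^-1)%g = A0 by rewrite -{1}nA conjsgK.
  have := norm_A0_frame (n^-1)%g _ (groupVr nG) nV h.
  by rewrite morphV // permK.
have [x0|x0] := eqVneq (val x) 0%N.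
  have -> : x = pt7 0 by apply: val_inj; rewrite x0 v0.
  by rewrite sigmaw_pact // [pact _ _]rk.
have : val (sigmaw (nseq k 0%N) (f n x)) \notin [:: 0; 5; 6]%N.
  by rewrite rB nB !inE (negPf x0) /=; lia.
by move: (sigmaw _ _) => -[z z7] /=; rewrite !inE; lia.
Qed.

(** Letter 0 is the only generator of Gamma outside the list for Delta. On seven points letter 2 is
    a product of two transpositions, one of which a rotation moves within {0, 5, 6}; the product of
    letter 2 with its conjugate is a 3-cycle there. *)
Lemma join_rotation k : (0 < k < 3)%N ->
  Gam :=: <<Del :|: Del :^ Pw (nseq k 0%N)>>%g.
Proof.
move=> hk; set t := Pw (nseq k 0%N).
have tG : t \in Gam by apply: Pw_group; apply/allP => s /nseqP[->].
have P2 : Pw [:: 2%N] \in Del by exact: word_Del.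
apply/eqP; rewrite eqEsubset; apply/andP; split; last first.
  rewrite gen_subG subUset Del_sub_Gam /= -(conjGid tG).
  by rewrite conjSg Del_sub_Gam.
rewrite gen_subG; apply/subsetP => g; rewrite inE => /mapP[s]; rewrite mem_iota => hs ->.
have DJ : Del \subset <<Del :|: Del :^ t>>%g by rewrite sub_gen ?subsetUl.
have DtJ : (Del :^ t)%g \subset <<Del :|: Del :^ t>>%g by rewrite sub_gen ?subsetUr.
have P2t : (Pw [:: 2%N] ^ t)%g \in <<Del :|: Del :^ t>>%g.
  by apply: (subsetP DtJ); rewrite memJ_conjg.
have P2J := subsetP DJ _ P2.
case: s hs => [_|s hs]; last first.
  apply: (subsetP DJ); apply: word_Del; rewrite /in_D /= andbT; exact: hs.
have tE : (Pw [:: 2%N] ^ t)%g = Pw (word_inv (nseq k 0%N) ++ [:: 2%N] ++ nseq k 0%N).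
  by rewrite conjgE !Pw_cat (Pw_inv _ _ F25 alpha2).
case: k hk @t tG DJ DtJ P2t P2J tE => [|[|[|k]]] // _ t tG DJ DtJ P2t P2J tE.
  have -> : Pw [:: 0%N] = ((Pw [:: 2%N] ^ t) * Pw [:: 2%N])%g.
    by rewrite tE -Pw_cat; apply: (Pw_eq _ _ F25 alpha2); vm_compute.
  by rewrite groupM.
have -> : Pw [:: 0%N] = (Pw [:: 2%N] * (Pw [:: 2%N] ^ t))%g.
  by rewrite tE -Pw_cat; apply: (Pw_eq _ _ F25 alpha2); vm_compute.
by rewrite groupM.
Qed.

Lemma Del_not_A0 d : d \in Del -> (Del :^ d)%g <> A0.
Proof.
move=> dD; rewrite conjGid // => DA.
have : Pw [:: 1%N] \in A0 by rewrite -DA; exact: word_Del.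
case/setIdP => _ /setIdP[_ /and3P[/eqP]]; rewrite fE // => /(congr1 val).
by rewrite /= sigmaw_pact // inordK.
Qed.

Lemma Delta_join g : g \in PGU -> Del :&: Del :^ g \isog 'Alt_('I_4) ->
  Gam :=: <<Del :|: Del :^ g>>%g.
Proof.
move=> gP iso; pose A : {group PGL3} := (Del :&: Del :^ g)%G.
have AD : A \subset Del by exact: subsetIl.
have AgD : (A :^ g^-1)%G \subset Del.
  by rewrite sub_conjg invgK; exact: subsetIr.
have [d1 d1D h1] := A4_conj_A0 _ AD iso.
have [|d2 d2D h2] := A4_conj_A0 _ AgD.
  by apply: isog_trans iso; rewrite isog_sym; exact: conj_isog.
have DP : Del \subset PGU by exact: subset_trans Del_sub_Gam (Gam_sub_PGU F alpha).
have [d1P d2P] := (subsetP DP _ d1D, subsetP DP _ d2D).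
pose n := (d1^-1 * g^-1 * d2)%g.
have nP : n \in PGU by rewrite !groupM ?groupV.
have nA : (A0 :^ n)%g = A0 by rewrite -{1}h1 /n -!conjsgM !mulgA mulgV mul1g conjsgM -[RHS]h2.
have [k k3 hk] := norm_A0 _ nP nA; set t := Pw (nseq k 0%N) in hk.
have gE : g = (d2 * t * ((n * t)^-1 * d1^-1))%g.
  by rewrite /n !invMg !invgK !mulgA !mulgK mulgV mul1g.
set d3 := ((n * t)^-1 * d1^-1)%g in gE.
have d3D : d3 \in Del by rewrite groupM ?groupV.
have Dg : (Del :^ g)%g = ((Del :^ t) :^ d3)%g by rewrite gE !conjsgM (conjGid d2D).
(* For [k] = 0 the element [g] lies in Delta, so the intersection is all of Delta, which is not
   conjugate to [A0]. *)
have [k0|k0] := eqVneq k 0%N.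
  have t1 : t = 1%g by rewrite /t k0 /Pw big_nil.
  case: (Del_not_A0 d1 d1D); rewrite -h1; congr (_ :^ _)%g.
  by rewrite /A /= Dg t1 conjsg1 (conjGid d3D) setIid.
have Gt : Gam :=: <<Del :|: Del :^ t>>%g by apply: join_rotation; rewrite lt0n k0.
rewrite Dg -{1}(conjGid d3D) -conjUg genJ -Gt conjGid //.
exact: (subsetP Del_sub_Gam).
Qed.

End WithMorphism.
End GeneratedByDelta.

(** * The graphs *)

(** The inverse of the word of [i] moves [i] to 0, where the order depends only on the orbit of the
    image of [j]. *)
Definition inter_size (i j : nat) : nat :=
  stab_card (orbit_class (acts (word_inv (coset_word i)) j)).

Definition adjacent (sizes : seq nat) (i j : nat) : bool :=
  (i != j) && (inter_size i j \in sizes).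

Definition common (sizes comps : seq nat) (i j : nat) : nat :=
  count (fun z => (component_of z \in comps) && (adjacent sizes i z && adjacent sizes j z))
    (iota 0 150).

Definition srg_at0 (sizes comps : seq nat) (d l m : nat) : bool :=
  (count (fun z => (component_of z \in comps) && adjacent sizes 0 z) (iota 0 150) == d) &&
  all (fun k => let y := orbit_rep k in
    (component_of y \in comps) ==>
    (common sizes comps 0 y == if adjacent sizes 0 y then l else m)) (iota 1 6).

Lemma Hoffman_Singleton_at0 : srg_at0 [:: 360]%N [:: 0]%N 7 0 1.
Proof. by vm_compute. Qed.

Lemma Higman_Sims_at0 : all (fun c => srg_at0 [:: 360; 168] [:: 0; c] 22 0 6)%N [:: 1; 2]%N.
Proof. by vm_compute. Qed.

Lemma adjacent360_at0 : all (fun k => (adjacent [:: 360]%N 0 (orbit_rep k) == (k == 1))%N)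
  (iota 0 7).
Proof. by vm_compute. Qed.

Lemma component_count : all (fun c =>
  count (fun z => component_of z == c) (iota 0 150) == 50)%N (iota 0 3).
Proof. by vm_compute. Qed.

Lemma component_lt i : (component_of i < 3)%N.
Proof.
rewrite /component_of; have := orbit_class_lt i.
by case: (orbit_class i) => [|[|[|[|[|[|[|]]]]]]].
Qed.

(** Letters act on the three component labels by a cyclic shift, so a word is a translation modulo
    3; this is what allows the base vertex to be moved. *)
Lemma component_shift w : letters_below 6 w ->
  exists c, forall i, (i < 150)%N -> component_of (acts w i) = ((component_of i + c) %% 3)%N.
Proof.
elim: w => [|s w ih].
  by exists 0%N => i _; rewrite addn0 modn_small // component_lt.
case/andP => hs /ih[c hc]; exists ((s == 5) + c)%N => i hi.
have /and5P[h1 _ _ /eqP h2 _] := act_okP s i hs hi.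
by rewrite -[acts _ _]/(acts w (act s i)) hc // h2 modnDml addnA.
Qed.

Lemma count_acts w (p : pred nat) : letters_below 6 w ->
  count (fun i => p (acts w i)) (iota 0 150) = count p (iota 0 150).
Proof.
move=> hw; rewrite -(count_map (acts w) p).
suff /seq.permP : perm_eq [seq acts w i | i <- iota 0 150] (iota 0 150) by apply.
have u : uniq [seq acts w i | i <- iota 0 150].
  rewrite map_inj_in_uniq ?iota_uniq // => i j; rewrite !mem_iota => hi hj.
  by move/(congr1 (acts (word_inv w))); rewrite !acts_invK.
have sub : {subset [seq acts w i | i <- iota 0 150] <= iota 0 150}.
  by move=> _ /mapP[i + ->]; rewrite !mem_iota => hi; exact: acts_lt.
apply: uniq_perm; rewrite ?iota_uniq //.
by have [|_ e] := uniq_min_size u sub; [rewrite size_map|exact: e].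
Qed.

(** * From indices to the graphs on conjugates *)

Section Graph.

Variables (F : finFieldType) (alpha : F).
Hypotheses (F25 : #|F| = 25%N) (alpha2 : alpha ^+ 2 = 2).

Local Notation PGL3 := (PGLtype 3 F).
Local Notation Pw := (Pw F alpha).
Local Notation W := (W F alpha).
Local Notation Gam := (letters_group F alpha (iota 0 5)).

Lemma card_WI_acts w i j : letters_below 6 w -> (i < 150)%N -> (j < 150)%N ->
  #|W (acts w i) :&: W (acts w j)| = #|W i :&: W j|.
Proof. by move=> hw hi hj; rewrite -!W_acts // -conjIg cardJg. Qed.

Lemma card_WI i j : (i < 150)%N -> (j < 150)%N -> #|W i :&: W j| = inter_size i j.
Proof.
move=> hi hj; rewrite /inter_size; set w := word_inv (coset_word i).
have w6 : letters_below 6 w by rewrite letters_below_inv ?coset_word_below.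
rewrite -(card_WI_acts w) //.
have -> : acts w i = 0%N.
  by have := acts_invK (coset_word i) 0 (coset_word_below _ hi) erefl; rewrite acts_coset_word.
have hk : (acts w j < 150)%N by exact: acts_lt.
move: (acts w j) hk => k hk {w w6}; have /and4P[_ hu /eqP uk _] := word_okP _ hk.
have w6 := letters_below_leq 5 6 _ isT hu.
have uG : Pw (orbit_word k) \in Gam by exact: Pw_group.
rewrite -(card_stab _ _ F25 alpha2 _ (orbit_class_lt k)) W0 -[in LHS]uk.
rewrite -(W_acts _ _ F25 alpha2 _ _ w6 (rep_lt _)).
by rewrite -{1}(conjGid uG) -conjIg cardJg.
Qed.

Lemma inter_size_acts w i j : letters_below 6 w -> (i < 150)%N -> (j < 150)%N ->
  inter_size (acts w i) (acts w j) = inter_size i j.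
Proof. by move=> hw hi hj; rewrite -!card_WI ?acts_lt // card_WI_acts. Qed.

Lemma acts_eq w i j : letters_below 6 w -> (i < 150)%N -> (j < 150)%N ->
  (acts w i == acts w j) = (i == j).
Proof.
move=> hw hi hj; apply/eqP/eqP => [|-> //].
by move/(congr1 (acts (word_inv w))); rewrite !acts_invK.
Qed.

Lemma adjacent_acts w sizes i j : letters_below 6 w -> (i < 150)%N -> (j < 150)%N ->
  adjacent sizes (acts w i) (acts w j) = adjacent sizes i j.
Proof. by move=> hw hi hj; rewrite /adjacent acts_eq // inter_size_acts. Qed.

Lemma adjacent_sym sizes i j : (i < 150)%N -> (j < 150)%N ->
  adjacent sizes i j = adjacent sizes j i.
Proof. by move=> hi hj; rewrite /adjacent -!card_WI // setIC eq_sym. Qed.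

Definition Wset (p : pred nat) : {set {set PGL3}} := [set W (val i) | i : 'I_150 & p i].

Lemma WsetP (p : pred nat) A : reflect (exists i, [/\ (i < 150)%N, p i & A = W i]) (A \in Wset p).
Proof.
apply: (iffP imsetP) => [[i]|[i [hi pi ->]]]; last by exists (Ordinal hi); rewrite ?inE.
by rewrite inE => pi ->; exists (val i); split=> [|//|//]; exact: ltn_ord.
Qed.

Lemma mem_Wset (p : pred nat) i : (i < 150)%N -> (W i \in Wset p) = p i.
Proof.
move=> hi; apply/WsetP/idP => [[j [hj pj /(W_inj _ _ F25 alpha2) e]]|]; last by exists i.
by rewrite e.
Qed.

Lemma card_Wset_sub (p : pred nat) (Q : pred {set PGL3}) :
  #|[set y in Wset p | Q y]| = count (fun z => p z && Q (W z)) (iota 0 150).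
Proof.
rewrite -(card_W _ _ F25 alpha2); apply: eq_card => A; rewrite inE.
apply/andP/(WsetP (fun z => p z && Q (W z))) => [[/WsetP[i [hi pi ->]] QA]|[i [hi /andP[pi Qi] ->]]].
  by exists i; split=> //; rewrite pi.
by rewrite mem_Wset.
Qed.

Lemma srg_W (p : pred nat) (e : rel {set PGL3}) (ee : nat -> nat -> bool) v d l m :
  (forall i j, (i < 150)%N -> (j < 150)%N -> e (W i) (W j) = ee i j) ->
  (forall i j, (i < 150)%N -> (j < 150)%N -> ee i j = ee j i) ->
  (forall i, ee i i = false) ->
  count p (iota 0 150) = v ->
  (forall i, (i < 150)%N -> p i -> count (fun z => p z && ee i z) (iota 0 150) = d) ->
  (forall i j, (i < 150)%N -> (j < 150)%N -> p i -> p j -> i != j ->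
     count (fun z => p z && (ee i z && ee j z)) (iota 0 150) = if ee i j then l else m) ->
  srg (Wset p) e v d l m.
Proof.
move=> eE sym irr cv cd clm.
have cnt (q q' : pred nat) : (forall z, (z < 150)%N -> q z = q' z) ->
    count q (iota 0 150) = count q' (iota 0 150).
  by move=> h; apply: eq_in_count => z; rewrite mem_iota => /h.
have pairE i j : (i < 150)%N -> (j < 150)%N ->
    #|[set z in Wset p | e (W i) z && e (W j) z]| =
    count (fun z => p z && (ee i z && ee j z)) (iota 0 150).
  by move=> hi hj; rewrite card_Wset_sub; apply: cnt => z hz; rewrite !eE.
split.
- split; first by move=> _ _ /WsetP[i [hi _ ->]] /WsetP[j [hj _ ->]]; rewrite !eE // sym.
  by move=> _ /WsetP[i [hi _ ->]]; rewrite eE.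
- by rewrite -cv -(card_W _ _ F25 alpha2).
- move=> _ /WsetP[i [hi pi ->]]; rewrite card_Wset_sub -(cd i hi pi).
  by apply: cnt => z hz; rewrite eE.
- move=> _ _ /WsetP[i [hi pi ->]] /WsetP[j [hj pj ->]]; rewrite eE // => ij.
  by rewrite pairE // clm // ?ij //; apply: contraTneq ij => ->; rewrite irr.
move=> _ _ /WsetP[i [hi pi ->]] /WsetP[j [hj pj ->]] Wij; rewrite eE // => ij.
by rewrite pairE // clm // ?(negPf ij) //; apply: contraNneq Wij => ->.
Qed.

(* Every pair of vertices is moved by PGU_3 to a pair formed by 0 and an orbit
   representative, so the parameters need only be checked at the vertex 0. *)
Lemma srg_transport (sizes comps : seq nat) v d l m (e : rel {set PGL3}) :
  (forall i j, (i < 150)%N -> (j < 150)%N -> e (W i) (W j) = adjacent sizes i j) ->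
  (forall a c, a \in comps -> a < 3 -> (a + c) %% 3 = 0 ->
     exists2 cs, srg_at0 sizes cs d l m &
       forall b, (b < 3)%N -> (b \in comps) = ((b + c) %% 3 \in cs))%N ->
  count (fun z => component_of z \in comps) (iota 0 150) = v ->
  srg (Wset (fun z => component_of z \in comps)) e v d l m.
Proof.
move=> eE hcomps cv; apply: (srg_W _ _ (adjacent sizes)) => //.
- by move=> i j hi hj; exact: adjacent_sym.
- by move=> i; rewrite /adjacent eqxx.
- move=> i hi pi; have [w hw [wi _]] := pair_to_rep i i hi hi.
  have [c hc] := component_shift _ hw.
  have c0 : ((component_of i + c) %% 3 = 0)%N by rewrite -hc // wi.
  have [cs /andP[/eqP <- _] hcs] := hcomps _ _ pi (component_lt i) c0.
  rewrite -[RHS](count_acts w _ hw); apply: eq_in_count => z; rewrite mem_iota => hz.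
  by rewrite [RHS]/= hcs ?component_lt // -hc // -wi adjacent_acts.
move=> i j hi hj pi pj ij; have [w hw [wi [k k7 wj]]] := pair_to_rep i j hi hj.
have [c hc] := component_shift _ hw.
have c0 : ((component_of i + c) %% 3 = 0)%N by rewrite -hc // wi.
have [cs /andP[_ /allP at0] hcs] := hcomps _ _ pi (component_lt i) c0.
have k0 : (0 < k)%N.
  by rewrite lt0n; apply: contra ij => /eqP k0; rewrite -(acts_eq w) // wi wj k0.
have := at0 k; rewrite mem_iota k0 => /(_ k7)/implyP; rewrite -{1}wj hc // -hcs ?component_lt //.
move=> /(_ pj)/eqP; rewrite -{2}wj -{2}wi adjacent_acts // => <-.
rewrite /common -[RHS](count_acts w _ hw); apply: eq_in_count => z; rewrite mem_iota => hz.
by rewrite [RHS]/= hcs ?component_lt // -hc // -wj -wi !adjacent_acts.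
Qed.

Lemma Gamma_conjsE : Gamma_conjs alpha = Wset predT.
Proof.
rewrite /Gamma_conjs (Gamma_gen _ _ F25 alpha2) (PGU3_gen _ _ F25 alpha2).
apply/setP => A; apply/imsetP/WsetP => [[g gP ->]|[i [hi _ ->]]].
  have [i [hi [x xG ->]]] := PGU_coset _ _ F25 alpha2 g gP.
  by exists i; split=> //; rewrite conjsgM (conjGid xG).
by exists (Pw (coset_word i)) => //; exact: coset_word_PGU.
Qed.

Lemma E_W n i j : (i < 150)%N -> (j < 150)%N -> E_ alpha n (W i) (W j) = adjacent [:: n] i j.
Proof.
move=> hi hj; rewrite /E_ Gamma_conjsE !mem_Wset //= /adjacent inE -card_WI //.
congr (~~ _ && _); apply/eqP/eqP => [|-> //]; exact: W_inj.
Qed.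

(** Edges stay inside a component. Conversely, two distinct nonadjacent vertices of a component have
    a common neighbour because the last parameter of the Hoffman-Singleton graph is 1, so distance 2
    is never exceeded. *)
Lemma connect_W i j : (i < 150)%N -> (j < 150)%N ->
  connect (E_ alpha 360) (W i) (W j) = (component_of i == component_of j).
Proof.
have mod_inj a b c : (a < 3)%N -> (b < 3)%N -> ((a + c) %% 3 = (b + c) %% 3)%N -> a = b.
  by move=> ha hb /eqP; rewrite eqn_modDr !modn_small // => /eqP.
have edge i' j' : (i' < 150)%N -> (j' < 150)%N -> adjacent [:: 360]%N i' j' ->
    component_of i' = component_of j'.
  move=> hi' hj'; have [w hw [wi [k k7 wj]]] := pair_to_rep _ _ hi' hj'.
  rewrite -(adjacent_acts w) // wi wj; have := allP adjacent360_at0 k.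
  rewrite mem_iota => /(_ k7)/eqP-> /eqP k1; have [c hc] := component_shift _ hw.
  apply: (mod_inj _ _ c); rewrite ?component_lt // -!hc // wi wj k1 //.
move=> hi hj; apply/idP/eqP => [/connectP[p]|eij].
  elim: p i hi => [|A p ih] i hi /=; first by move=> _ /(W_inj _ _ F25 alpha2)->.
  case/andP => iA pA lA.
  have /WsetP[k [hk _ Ak]] : A \in Wset predT.
    by move: iA; rewrite /E_ Gamma_conjsE => /and4P[].
  rewrite Ak in iA pA lA; rewrite E_W // in iA.
  by rewrite (edge _ _ hi hk iA); exact: ih.
have [w hw [wi [k k7 wj]]] := pair_to_rep _ _ hi hj.
have [c hc] := component_shift _ hw.
have ck : component_of (orbit_rep k) = 0%N by rewrite -wj hc // -eij -hc // wi.
have [k0|k0] := eqVneq k 0%N.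
  suff -> : i = j by exact: connect0.
  by apply/eqP; rewrite -(acts_eq w) // wi wj k0.
have [/eqP k1|k1] := boolP (adjacent [:: 360]%N 0 (orbit_rep k) == true).
  by apply: connect1; rewrite E_W // -(adjacent_acts w) // wi wj.
have /andP[_ /allP/(_ k)] := Hoffman_Singleton_at0.
rewrite mem_iota lt0n k0 => /(_ k7)/implyP; rewrite ck => /(_ isT).
rewrite (negbTE (_ : ~~ adjacent _ _ _)); last by case: (adjacent _ _ _) k1.
move=> /eqP cm; have : has (fun z => (component_of z \in [:: 0]%N) &&
    (adjacent [:: 360]%N 0 z && adjacent [:: 360]%N (orbit_rep k) z)) (iota 0 150).
  by rewrite has_count -/(common [:: 360]%N [:: 0]%N 0 (orbit_rep k)) cm.
case/hasP => z; rewrite mem_iota => hz /and3P[_ z0 zk].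
have w'6 : letters_below 6 (word_inv w) by exact: letters_below_inv.
have hz' : (acts (word_inv w) z < 150)%N by exact: acts_lt.
apply: (@connect_trans _ _ (W (acts (word_inv w) z))); apply: connect1; rewrite E_W //.
  by rewrite -(adjacent_acts w) // acts_Kinv // wi.
by rewrite adjacent_sym // -(adjacent_acts w) // acts_Kinv // wj.
Qed.

Lemma componentsE : components (Gamma_conjs alpha) (E_ alpha 360) =
  [set Wset (fun z => component_of z \in [:: val c]) | c : 'I_3].
Proof.
have cls i : (i < 150)%N -> [set y in Gamma_conjs alpha | connect (E_ alpha 360) (W i) y] =
    Wset (fun z => component_of z \in [:: component_of i]).
  move=> hi; apply/setP => A; rewrite Gamma_conjsE inE.
  apply/andP/WsetP => [[/WsetP[j [hj _ ->]]]|[j [hj + ->]]].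
    by rewrite connect_W // => /eqP e; exists j; rewrite inE e.
  by rewrite inE mem_Wset // connect_W // eq_sym.
rewrite /components /equivalence_partition; apply/setP => C; apply/imsetP/imsetP.
  case=> A; rewrite {1}Gamma_conjsE => /WsetP[i [hi _ ->]] ->.
  by exists (Ordinal (component_lt i)) => //; rewrite cls.
case=> c _ ->; have : all (fun c => has (fun i => component_of i == c) (iota 0 150)) (iota 0 3).
  by vm_compute.
move/allP/(_ (val c)); rewrite mem_iota => /(_ (ltn_ord c))/hasP[i]; rewrite mem_iota => hi /eqP <-.
by exists (W i); rewrite ?cls // Gamma_conjsE mem_Wset.
Qed.

Lemma component_inj : injective (fun c : 'I_3 => Wset (fun z => component_of z \in [:: val c])).
Proof.
move=> a b ab; have : all (fun c => has (fun i => component_of i == c) (iota 0 150)) (iota 0 3).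
  by vm_compute.
move/allP/(_ (val a)); rewrite mem_iota => /(_ (ltn_ord a))/hasP[i]; rewrite mem_iota => hi /eqP ia.
have := mem_Wset (fun z => component_of z \in [:: val a]) i hi; rewrite ab mem_Wset // !inE ia eqxx.
by move/eqP/val_inj.
Qed.

Lemma component_HS (c : 'I_3) :
  is_Hoffman_Singleton (Wset (fun z => component_of z \in [:: val c])) (E_ alpha 360).
Proof.
apply: (srg_transport [:: 360]%N) => [i j hi hj|a b|]; first exact: E_W.
  rewrite inE => /eqP-> _ cb; exists [:: 0]%N; first exact: Hoffman_Singleton_at0.
  move=> x hx; rewrite !inE; have := ltn_ord c; rewrite -[nat_of_ord c]/(val c).
  by move: (val c) cb => y; lia.
have c03 : val c \in iota 0 3 by rewrite mem_iota; exact: ltn_ord.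
rewrite -[RHS](eqP (allP component_count _ c03)).
by apply: eq_count => z; exact: mem_seq1.
Qed.

Lemma components_HS (a b : 'I_3) : a != b ->
  is_Higman_Sims (Wset (fun z => component_of z \in [:: val a]) :|:
                  Wset (fun z => component_of z \in [:: val b]))
    [rel A B | E_ alpha 360 A B || E_ alpha 168 A B].
Proof.
move=> ab; have -> : Wset (fun z => component_of z \in [:: val a]) :|:
    Wset (fun z => component_of z \in [:: val b]) = Wset (fun z => component_of z \in [:: val a; val b]).
  apply/setP => A; rewrite inE; apply/orP/WsetP => [[]/WsetP[i [hi]]|[i [hi]]].
  - by rewrite inE => /eqP e ->; exists i; rewrite !inE e eqxx.
  - by rewrite inE => /eqP e ->; exists i; rewrite !inE e eqxx orbT.
  by rewrite !inE => /orP[]/eqP e ->; [left|right]; apply/WsetP; exists i; rewrite inE e eqxx.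
have a3 := ltn_ord a; have b3 := ltn_ord b.
have ab' : (a : nat) != b by rewrite val_eqE.
apply: (srg_transport [:: 360; 168]%N) => [i j hi hj|x c|].
- by rewrite /= !E_W // /adjacent !inE; case: (i == j).
(* The shift that takes the component [x] of the base vertex to 0 takes the other component [y] to 1
   or 2, the two cases computed in [Higman_Sims_at0]. *)
- rewrite !inE => xab x3 xc.
  have [y [y3 yx e]] : exists y, [/\ (y < 3)%N, y != x &
      forall z, (z \in [:: val a; val b]) = (z == x) || (z == y)].
    case/orP: xab => /eqP ->.
      by exists (val b); split=> [//||z]; rewrite ?inE // eq_sym.
    by exists (val a); split=> [//||z]; rewrite ?inE // orbC.
  exists [:: 0; (y + c) %% 3]%N.
    apply: (allP Higman_Sims_at0); rewrite !inE; lia.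
  by move=> z z3; rewrite e !inE; lia.
have cc (c : 'I_3) : count (fun z => component_of z == val c) (iota 0 150) = 50%N.
  by apply/eqP/(allP component_count); rewrite mem_iota; exact: (ltn_ord c).
have := count_predUI (fun z => component_of z == val a) (fun z => component_of z == val b) (iota 0 150).
rewrite !cc (@eq_count _ (predI _ _) pred0) ?count_pred0 ?addn0 => [h|z].
  by rewrite -[RHS]h; apply: eq_count => z; rewrite !inE.
by apply/negP => /andP[/eqP-> /eqP]; apply/eqP.
Qed.

End Graph.

Theorem theorem5p6 (F : finFieldType) (alpha : F)
    (F25 : #|F| = 25%N) (alpha2 : alpha ^+ 2 = 2) :
  let G := Gamma alpha in
  let D := Delta F in
  let V := Gamma_conjs alpha in
  let E := E_ alpha in
  let CC := components V (E 360%N) in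
  [/\ G \subset PGU3 F /\ G \isog 'Alt_('I_7),
      forall gamma, gamma \in PGU3 F ->
        (D :&: D :^ gamma)%g \isog 'Alt_('I_4) ->
        G = << D :|: D :^ gamma >>%g,
      #|V| = 150%N,
      forall G1 G2, G1 \in V -> G2 \in V -> G1 != G2 ->
        [\/ G1 :&: G2 \isog 'Alt_('I_6),
            G1 :&: G2 \isog PSL 2 'F_7,
            G1 :&: G2 \isog A4x3_2
          | G1 :&: G2 \isog 'Alt_('I_5)]
    & [/\ #|CC| = 3%N,
          forall C, C \in CC -> is_Hoffman_Singleton C (E 360%N)
        & forall C1 C2, C1 \in CC -> C2 \in CC -> C1 != C2 ->
            is_Higman_Sims (C1 :|: C2) [rel A B | E 360%N A B || E 168%N A B]]].
Proof.
move=> G D V E CC.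
have GE : G = letters_gen F alpha (iota 0 5) by exact: Gamma_gen.
have DE : D = letters_gen F alpha (iota 1 4) by exact: Delta_gen.
have PE : PGU3 F = letters_gen F alpha (iota 0 6) by exact: PGU3_gen.
have VE : V = Wset F alpha predT by exact: Gamma_conjsE.
split.
- rewrite GE PE; split; first exact: Gam_sub_PGU.
  exact: Gam_isog.
- move=> g; rewrite PE DE GE => gP iso.
  have [f [fi fG fE]] := sevenP _ _ F25 alpha2.
  exact: (Delta_join _ _ F25 alpha2 f fi fG fE).
- by rewrite VE (card_W _ _ F25 alpha2) count_predT size_iota.
- move=> G1 G2; rewrite VE => /WsetP[i [hi _ ->]] /WsetP[j [hj _ ->]] Wij.
  by apply: (pair_types _ _ F25 alpha2) => //; apply: contraNneq Wij => ->.
rewrite /CC componentsE //; split.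
- by rewrite card_imset ?card_ord //; exact: component_inj.
- by move=> _ /imsetP[c _ ->]; exact: component_HS.
move=> _ _ /imsetP[a _ ->] /imsetP[b _ ->] ab; apply: components_HS => //.
by apply: contraNneq ab => ->.
Qed.
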